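(* Let $n>2$ be an integer, let $K$ be the $(n-2)$-skeleton of the $n$-simplex and let $L$ be the $(n-2)$-skeleton of the $(n+1)$-simplex. For either $X=K$ or $X=L$, the configuration space $C(X)$ of images of linear embeddings of $X$ in $\mathbb R^n$ has the homotopy type of the double mapping cylinder \[SO(n)/A_{n+1}\leftarrow SO(n)/A_n\rightarrow SO(n)/S_n,\] where $A_m$ denotes the alternating group and $S_m$ the symmetric group.
   Context: A linear embedding of a finite simplicial complex $X$ in $\mathbb R^n$ is an injective map $X\to\mathbb R^n$ that is affine on each simplex; it is determined by the images of the vertices, so the space $E(X)$ of linear embeddings is topologized as a subspace of $(\mathbb R^n)^{N}$, with $N$ the number of vertices of $X$. The configuration space is $C(X)=E(X)/\mathrm{Aut}(X)$, where $\mathrm{Aut}(X)$ is the group of simplicial automorphisms. For $X=K$ and $X=L$ with $n>2$ this is the full symmetric group on the vertices, so points of $C(X)$ are unlabeled embedded complexes (for $n=3$: complete graphs $K_4$, $K_5$ linearly embedded in $\mathbb R^3$). Subgroups of $SO(n)$: fix a regular $n$-simplex $\Delta\subset\mathbb R^n$ centered at the origin and a facet $F$ of $\Delta$. $A_{n+1}\subset SO(n)$ is the group of orientation-preserving symmetries of $\Delta$; $A_n\subset A_{n+1}$ is the subgroup preserving $F$ (equivalently, fixing the vertex opposite $F$). $S_n\subset SO(n)$ is the group of elements of $SO(n)$ that preserve the linear hyperplane parallel to $F$ and preserve in that hyperplane the translate of $F$ centered at the origin; even permutations of the vertices of $F$ act trivially on the perpendicular direction and odd ones act by $-1$ on it,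 and the even ones form the same $A_n$. The maps of the double mapping cylinder are the quotient maps induced by the inclusions $A_n\subset A_{n+1}$ and $A_n\subset S_n$. The double mapping cylinder of $B\xleftarrow{f}A\xrightarrow{g}C$ is $B\sqcup (A\times[0,1])\sqcup C$ with $(a,0)\sim f(a)$ and $(a,1)\sim g(a)$. *)

(* Defs.v *)
From Stdlib Require Import Relation_Operators.
From mathcomp Require Import all_boot all_order all_algebra all_fingroup.
From mathcomp Require Import generic_quotient.

Set Implicit Arguments.
Unset Strict Implicit.
Unset Printing Implicit Defensive.

(** * Finite simplicial complexes *)

Record simplicial_complex (V : finType) := SimplicialComplex {
  faces : {set {set V}};
  face_neq0 : set0 \notin faces;
  face_vertex : forall v, [set v] \in faces;
  face_sub : forall s t : {set V},
    s \in faces -> t \subset s -> t != set0 -> t \in faces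
}.

Section Complexes.
Variable V : finType.

Definition full_faces : {set {set V}} := [set s | s != set0].

Lemma full_face_neq0 : set0 \notin full_faces.
Proof. by rewrite inE eqxx. Qed.

Lemma full_face_vertex v : [set v] \in full_faces.
Proof. by rewrite inE; apply/set0Pn; exists v; rewrite inE. Qed.

Lemma full_face_sub (s t : {set V}) :
  s \in full_faces -> t \subset s -> t != set0 -> t \in full_faces.
Proof. by rewrite !inE. Qed.

Definition full_simplex : simplicial_complex V :=
  SimplicialComplex full_face_neq0 full_face_vertex full_face_sub.

Section Skeleton.
Variables (d : nat) (X : simplicial_complex V).

Definition skeleton_faces : {set {set V}} :=
  [set s in faces X | (#|s| <= d.+1)%N].

Lemma skeleton_face_neq0 : set0 \notin skeleton_faces.
Proof. by rewrite inE (negPf (face_neq0 X)). Qed.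

Lemma skeleton_face_vertex v : [set v] \in skeleton_faces.
Proof. by rewrite inE face_vertex cards1. Qed.

Lemma skeleton_face_sub (s t : {set V}) :
  s \in skeleton_faces -> t \subset s -> t != set0 -> t \in skeleton_faces.
Proof.
rewrite !inE => /andP[sX sd] ts t0; rewrite (face_sub sX)//=.
exact: leq_trans (subset_leq_card ts) sd.
Qed.

(* The subcomplex of the simplices of dimension at most [d]. *)
Definition skeleton : simplicial_complex V :=
  SimplicialComplex skeleton_face_neq0 skeleton_face_vertex skeleton_face_sub.

End Skeleton.

Definition simplicial_aut (X : simplicial_complex V) : {set {perm V}} :=
  [set p : {perm V} | [forall s : {set V}, (p @: s \in faces X) == (s \in faces X)]].

End Complexes.

From mathcomp Require Import all_classical all_reals all_analysis.

Import Order.TTheory GRing.Theory Num.Theory.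
Import numFieldNormedType.Exports.

Local Open Scope classical_set_scope.
Local Open Scope ring_scope.
Local Open Scope quotient_scope.

(** * Quotient spaces *)

Section GeneratedQuotient.
Context {T : topologicalType} (r : T -> T -> Prop).

Definition generated_equiv : rel T := fun x y => `[< clos_refl_sym_trans T r x y >].

Lemma generated_equiv_class : equiv_class_of generated_equiv.
Proof.
split.
- by move=> x; apply/asboolP; exact: rst_refl.
- by move=> x y; apply/asboolP/asboolP; exact: rst_sym.
- move=> y x z /asboolP xy /asboolP yz; apply/asboolP.
  exact: rst_trans xy yz.
Qed.

Canonical generated_equiv_rel := EquivRelPack generated_equiv_class.

(* The quotient of [T] by the smallest equivalence relation containing [r]; when
   [r] is already an equivalence relation this is [T / r] (see
   [quotient_projE]). *)
Definition quotient_by : topologicalType :=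
  quotient_topology {eq_quot generated_equiv_rel}.

Definition quotient_proj (x : T) : quotient_by :=
  \pi_({eq_quot generated_equiv_rel}) x.

Definition quotient_repr (q : quotient_by) : T :=
  repr (q : {eq_quot generated_equiv_rel}).

Lemma quotient_reprK : cancel quotient_repr quotient_proj.
Proof. by move=> q; exact: reprK. Qed.

Lemma quotient_projP x y :
  quotient_proj x = quotient_proj y <-> clos_refl_sym_trans T r x y.
Proof.
split; first by move/eqmodP/asboolP.
by move=> xy; apply/eqmodP/asboolP.
Qed.

Lemma quotient_projE x y :
    (forall x, r x x) -> (forall x y, r x y -> r y x) ->
    (forall y x z, r x y -> r y z -> r x z) ->
  quotient_proj x = quotient_proj y <-> r x y.
Proof.
move=> r0 rS rT; rewrite quotient_projP; split; last exact: rst_step.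
elim=> //; [by move=> ? ? _; exact: rS | by move=> ? ? ? _ + _; exact: rT].
Qed.

End GeneratedQuotient.

(** * Homotopy equivalence and double mapping cylinders *)

Section Homotopy.
Variable R : realType.

Definition unit_interval : set R := `[0, 1]%classic.

Lemma unit_interval0 : 0 \in unit_interval.
Proof. by apply/mem_set; rewrite /unit_interval/= in_itv/= lexx ler01. Qed.

Lemma unit_interval1 : 1 \in unit_interval.
Proof. by apply/mem_set; rewrite /unit_interval/= in_itv/= lexx ler01. Qed.

Definition I0 : unit_interval := exist _ 0 unit_interval0.
Definition I1 : unit_interval := exist _ 1 unit_interval1.

Definition homotopic (X Y : topologicalType) (f g : X -> Y) : Prop :=
  exists H : X * unit_interval -> Y,
    [/\ continuous H, forall x, H (x, I0) = f x & forall x, H (x, I1) = g x].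

Definition homotopy_equivalent (X Y : topologicalType) : Prop :=
  exists (f : X -> Y) (g : Y -> X),
    [/\ continuous f, continuous g,
        homotopic (g \o f) idfun & homotopic (f \o g) idfun].

Section DoubleMappingCylinder.
Variables (A B C : topologicalType) (f : A -> B) (g : A -> C).

(* The three summands of [B + A * [0, 1] + C], in the order
   [Some false], [None], [Some true]. *)
Definition cylinder_piece (i : option bool) : topologicalType :=
  match i with
  | Some false => B
  | None => (A * unit_interval)%type
  | Some true => C
  end.

Definition cylinder_sum : topologicalType := {i & cylinder_piece i}.

Definition cylinder_left (b : B) : cylinder_sum :=
  existT cylinder_piece (Some false) b.
Definition cylinder_mid (a : A) (t : unit_interval) : cylinder_sum :=
  existT cylinder_piece None (a, t).
Definition cylinder_right (c : C) : cylinder_sum :=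
  existT cylinder_piece (Some true) c.

Inductive cylinder_glue : cylinder_sum -> cylinder_sum -> Prop :=
| cylinder_glue0 a : cylinder_glue (cylinder_mid a I0) (cylinder_left (f a))
| cylinder_glue1 a : cylinder_glue (cylinder_mid a I1) (cylinder_right (g a)).

Definition double_mapping_cylinder : topologicalType :=
  quotient_by cylinder_glue.

End DoubleMappingCylinder.
End Homotopy.

(** * Linear embeddings and configuration spaces *)

Section LinearEmbeddings.
Variables (R : realType) (n N : nat).

(* Points of a complex on the vertex set ['I_N] are given by their barycentric
   coordinates, so that the vertex [i] is [delta_mx i 0]. *)
Definition geom_simplex (s : {set 'I_N}) : set 'cV[R]_N :=
  [set t | [/\ forall i, 0 <= t i 0, forall i, i \notin s -> t i 0 = 0
             & \sum_i t i 0 = 1]].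

Definition realization (X : simplicial_complex 'I_N) : set 'cV[R]_N :=
  [set t | exists2 s, s \in faces X & geom_simplex s t].

Definition affine_on (A : set 'cV[R]_N) (f : 'cV[R]_N -> 'cV[R]_n) : Prop :=
  forall (a : R) t u, 0 <= a <= 1 -> A t -> A u ->
    f (a *: t + (1 - a) *: u) = a *: f t + (1 - a) *: f u.

Definition linear_embedding (X : simplicial_complex 'I_N)
    (f : 'cV[R]_N -> 'cV[R]_n) : Prop :=
  (forall s, s \in faces X -> affine_on (geom_simplex s) f) /\
  {in realization X &, injective f}.

(* A linear embedding is recorded by the matrix whose [i]-th column is the image
   of the vertex [i]. *)
Definition embedding_space (X : simplicial_complex 'I_N) : set 'M[R]_(n, N) :=
  [set x | exists2 f, linear_embedding X f &
                      forall i, f (delta_mx i 0) = col i x].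

Definition relabeling (X : simplicial_complex 'I_N) (x y : embedding_space X) :
    Prop :=
  exists2 p, p \in simplicial_aut X & val y = col_perm p (val x).

Definition configuration_space (X : simplicial_complex 'I_N) :
    topologicalType :=
  quotient_by (@relabeling X).

End LinearEmbeddings.

(** * Quotients of the rotation group *)

Section Rotations.
Variables (R : realType) (n : nat).

Definition SO : set 'M[R]_n := [set g | g *m g^T = 1%:M /\ \det g = 1].

Definition preserves (A : set 'cV[R]_n) (g : 'M[R]_n) : Prop :=
  [set g *m v | v in A] = A.

Definition same_coset (H : set 'M[R]_n) (g h : SO) : Prop :=
  H (invmx (val g) *m val h).

(* Left cosets: [g H = h H] when [g^-1 h] is in [H]. *)
Definition SO_quotient (H : set 'M[R]_n) : topologicalType :=
  quotient_by (@same_coset H).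

(* The map [gH |-> gH']; it does not depend on the representatives when [H] is
   contained in [H'] (see [SO_quotient_mapE]). *)
Definition SO_quotient_map (H H' : set 'M[R]_n) (q : SO_quotient H) :
    SO_quotient H' :=
  quotient_proj (@same_coset H') (quotient_repr q).

Lemma SO_quotient_mapE (H H' : set 'M[R]_n) (g : SO) : H `<=` H' ->
  SO_quotient_map H' (quotient_proj (@same_coset H) g) =
  quotient_proj (@same_coset H') g.
Proof.
move=> HH'; apply/quotient_projP.
have /quotient_projP := quotient_reprK (quotient_proj (@same_coset H) g).
move: (quotient_repr _) => h; elim=> [x y xy|x|x y _|x y z _ + _].
- by apply: rst_step; exact: HH'.
- exact: rst_refl.
- exact: rst_sym.
- exact: rst_trans.
Qed.

Section SimplexGroups.
Variables (D : 'M[R]_(n, n.+1)) (i0 : 'I_n.+1).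

(* The columns of [D] are the vertices of a regular simplex centered at 0. *)
Definition centered_regular_simplex : Prop :=
  \sum_i col i D = 0 /\
  exists2 l : R, 0 < l &
    forall i j, i != j -> \sum_k (D k i - D k j) ^+ 2 = l ^+ 2.

Definition Delta : set 'cV[R]_n :=
  [set D *m t | t in geom_simplex [set: 'I_n.+1]%SET].

Definition facet : set 'cV[R]_n :=
  [set D *m t | t in geom_simplex [set~ i0]%SET].

Definition facet_barycenter : 'cV[R]_n :=
  n%:R^-1 *: \sum_(i | i != i0) col i D.

Definition centered_facet : set 'cV[R]_n :=
  [set v - facet_barycenter | v in facet].

Definition facet_hyperplane : set 'cV[R]_n :=
  [set D *m t | t in [set t : 'cV[R]_n.+1 | t i0 0 = 0 /\ \sum_i t i 0 = 0]].

Definition alt_simplex : set 'M[R]_n :=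
  [set g | SO g /\ preserves Delta g].

Definition alt_facet : set 'M[R]_n :=
  [set g | alt_simplex g /\ preserves facet g].

Definition sym_facet : set 'M[R]_n :=
  [set g | [/\ SO g, preserves facet_hyperplane g & preserves centered_facet g]].

Definition rotation_cylinder : topologicalType :=
  double_mapping_cylinder R
    (@SO_quotient_map alt_facet alt_simplex)
    (@SO_quotient_map alt_facet sym_facet).

End SimplexGroups.
End Rotations.

(* Main.v *)
Require Import Defs.
From Stdlib Require Import Relation_Operators.
From mathcomp Require Import all_boot all_order all_algebra all_fingroup.
From mathcomp Require Import all_classical all_reals all_analysis.
From mathcomp Require Import ring lra zify.

Set Implicit Arguments.
Unset Strict Implicit.
Unset Printing Implicit Defensive.

Import Order.TTheory GRing.Theory Num.Theory.
Import numFieldNormedType.Exports.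

Local Open Scope classical_set_scope.
Local Open Scope ring_scope.

(** Both configuration spaces are compared with the same family of model
    embeddings. For a rotation [q] and a height [t] between 0 and 1 the model is
    the rotated regular simplex in which the vertex [i0] has been pushed towards
    the opposite facet: for [n + 1] points it reaches the barycenter of that
    facet at height 1; for [n + 2] points it is the additional point that moves,
    from the barycenter of the simplex at height 0 to the mirror image of [i0]
    in the facet at height 1. A model at height strictly between 0 and 1
    has only the symmetries of the facet, one at height 0 has all those of the
    simplex, and at height 1 the reflection in the facet becomes a symmetry too
    (it fixes all the points in the first case and exchanges two of them in the
    second). After passing to orientation preserving symmetries, and a
    translation that centers first the simplex and then the facet, the models
    up to relabeling are the points of the double mapping cylinder, which is a
    quotient of the product of the rotation group and the interval
    ([cylinder_point_map]).

    Conversely an embedding determines a height and a simplex. Two disjoint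
    faces of a linear image meet exactly when some affine dependency between the
    vertices has its positive and negative coefficients on them, so that [x]
    is an embedding of the [n - 2]-skeleton if and only if every affine
    dependency has at least [n] positive or at least [n] negative coefficients
    ([embedding_criterion]).
    - For [n + 1] points there is no dependency in general; if the points are
      dependent, one of them lies inside the simplex spanned by the others
      ([degenerate_inner_vertex]). The height [collapse] is 1 exactly in
      this situation.
    - For [n + 2] points there is exactly one dependency up to a factor
      ([embedding_dependency]), and it has one or two coefficients of the rarer
      sign: one point is inside the simplex spanned by the others or inside a
      facet of it, or the segment between two points crosses the simplex
      spanned by the others. If the rarer sign is the negative one, the height
      is the ratio of the two smallest coefficients when both are negative, and
      0 otherwise.

    Choosing the special vertices and the orientation restricts an embedding to
    a closed domain that meets every orbit of the finite group of relabelings,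
    so that it still carries the quotient topology ([config_domain_map]). On
    that domain the height and a nondegenerate simplex depend continuously on
    the embedding. The rotation associated with an embedding comes from the
    Gram-Schmidt process applied to the rows of the matrix of this simplex: it
    commutes with right multiplication by orthogonal matrices, hence with the
    symmetries of the regular simplex ([gram_schmidt_mulmxr]), and the
    segment between a matrix and its orthonormalization consists of invertible
    matrices ([gram_schmidt_path_det]). Therefore all the homotopies are straight
    lines, first from the embedding to the one with the same height and simplex
    in standard position, then from the simplex to the rotated regular one;
    these steps are carried out once for all in [configuration_space_equivalent],
    whose hypotheses are then established in the two cases. *)

(** * Quotient maps and homotopies *)

Definition quotient_map (X Y : topologicalType) (q : X -> Y) : Prop :=
  [/\ continuous q, forall y, exists x, q x = y &
      forall V : set Y, open (q @^-1` V) -> open V].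

Lemma continuous_compose (T U V : topologicalType) (f : T -> U) (g : U -> V) :
  continuous f -> continuous g -> continuous (fun x => g (f x)).
Proof. by move=> cf cg x; apply: continuous_comp; [exact: cf|exact: cg]. Qed.

Lemma continuous_pairing (T U V : topologicalType) (f : T -> U) (g : T -> V) :
  continuous f -> continuous g -> continuous (fun x => (f x, g x)).
Proof.
by move=> cf cg x; apply: (@cvg_pair _ _ _ (nbhs x)); [exact: cf|exact: cg].
Qed.

Lemma fst_continuous (U V : topologicalType) : continuous (@fst U V).
Proof. by move=> x; exact: cvg_fst. Qed.

Lemma snd_continuous (U V : topologicalType) : continuous (@snd U V).
Proof. by move=> x; exact: cvg_snd. Qed.

Section QuotientMaps.
Variables (X Y : topologicalType) (q : X -> Y).
Hypothesis q_quot : quotient_map q.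

Lemma quotient_map_continuous (Z : topologicalType) (k : Y -> Z) :
  continuous (k \o q) -> continuous k.
Proof.
case: q_quot => _ _ qo /continuousP kq; apply/continuousP => A oA.
by apply: qo; exact: kq.
Qed.

Lemma quotient_map_descend (Z : topologicalType) (h : X -> Z) :
    continuous h -> (forall x x', q x = q x' -> h x = h x') ->
  exists2 k : Y -> Z, continuous k & forall x, k (q x) = h x.
Proof.
move=> ch hq; have [_ qs _] := q_quot.
have [s sK] := choice qs.
exists (h \o s); last by move=> x; apply: hq; exact: sK.
apply: quotient_map_continuous; rewrite (_ : _ \o _ = h)//.
by apply/funext => x /=; apply: hq; exact: sK.
Qed.

End QuotientMaps.

Lemma quotient_proj_map (T : topologicalType) (r : T -> T -> Prop) :
  quotient_map (@quotient_proj T r).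
Proof.
split=> [|y|V]; first exact: pi_continuous.
  by exists (quotient_repr y); exact: quotient_reprK.
by [].
Qed.

Lemma continuous_set_type (T U : topologicalType) (A : set U)
    (f : T -> set_type A) :
  continuous (fun x => set_val (f x)) -> continuous f.
Proof. by move=> cf; exact: (continuous_comp_initial (w := set_val)). Qed.

Lemma set_val_continuous (U : topologicalType) (A : set U) :
  continuous (@set_val U A).
Proof. exact: initial_continuous. Qed.

Section IntervalProduct.
Variable R : realType.
Local Notation I := (@unit_interval R).

Lemma unit_intervalP (t : I) : 0 <= set_val t <= 1.
Proof. by have := set_valP t; rewrite /unit_interval/= in_itv. Qed.

(** The tube lemma for a closed interval [J] of parameters around [t0]: this
    local compactness of the interval is what makes [q * id] a quotient map. *)
Lemma quotient_map_interval (X Y : topologicalType) (q : X -> Y) :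
  quotient_map q ->
  quotient_map (fun p : X * I => (q p.1, p.2)).
Proof.
move=> [cq qs qo]; split.
- apply: continuous_pairing; last exact: snd_continuous.
  by apply: continuous_compose cq; exact: fst_continuous.
- by move=> [y t]; have [x <-] := qs y; exists (x, t).
move=> V; set P := _ @^-1` V => oP.
rewrite openE => -[y0 t0] Vy0; have [x0 x0E] := qs y0.
have Px0 : P (x0, t0) by rewrite /P /= x0E.
have [[A B] /= [nA nB] ABP] : nbhs (x0, t0) P by apply: open_nbhs_nbhs.
have [_ [[B' oB' <-] B't0 B'B]] := nB.
have /nbhs_ballP[e /= e0 eB'] : nbhs (set_val t0) B' by exact: open_nbhs_nbhs.
pose J : set R := `[0, 1] `&` closed_ball (set_val t0) (e / 2).
have cJ : compact J.
  by apply: compact_closedI; [exact: segment_compact|exact: closed_ball_closed].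
have e20 : 0 < e / 2 by rewrite divr_gt0.
have JB (t : I) : J (set_val t) -> B t.
  move=> [_ tt0]; apply: B'B; apply: eB'; move: tt0.
  rewrite closed_ballE// /closed_ball_/= -ball_normE/= => tt0.
  by rewrite (le_lt_trans tt0)// ltr_pdivrMr// mulr_natr mulr2n ltrDl.
pose W : set Y := [set y | forall t : I, J (set_val t) -> V (y, t)].
have oW : open W.
  apply: qo; rewrite openE => x Wx; rewrite /interior.
  pose Q (x' : X) (r : R) := forall t : I, set_val t = r -> P (x', t).
  have : \forall x' \near x, J `<=` Q x'.
    apply: (compact_near_coveringP J).1 => // r Jr.
    have r01 : r \in I by apply/mem_set; exact: Jr.1.
    pose u : I := exist _ r r01.
    have : P (x, u) by rewrite /P /=; exact: Wx.
    move=> Pxu; have [[A1 B1] /= [nA1 nB1] AB1P] : nbhs (x, u) P.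
      exact: open_nbhs_nbhs.
    have [_ [[B1' oB1' <-] B1'u B1'B1]] := nB1.
    have nB1' : nbhs r B1' by exact: open_nbhs_nbhs.
    exists (B1', A1) => //= -[r' x'] [/= B1r' A1x'] t tr'.
    by apply: AB1P; split => //=; apply: B1'B1; rewrite /= tr'.
  by apply: filterS => x' JQ t Jt; exact: (JQ _ Jt t).
have Wy0 : W y0.
  move=> t Jt; have : P (x0, t) by apply: ABP; split => /=;
    [exact: nbhs_singleton nA|exact: JB].
  by rewrite /P /= x0E.
rewrite /interior.
exists (W, [set t : I | ball (set_val t0) (e / 2) (set_val t)]) => /=.
  split; first exact: open_nbhs_nbhs.
  exact: (set_val_continuous (nbhsx_ballx _ _ e20)).
move=> [y t] [/= Wy tt0]; apply: Wy; split.
  by have := set_valP t.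
exact: subset_closed_ball tt0.
Qed.

End IntervalProduct.

Section Homotopies.
Variable R : realType.
Local Notation I := (@unit_interval R).

Lemma homotopic_trans (X Y : topologicalType) (f g h : X -> Y) :
  homotopic R f g -> homotopic R g h -> homotopic R f h.
Proof.
move=> [H [cH H0 H1]] [K [cK K0 K1]].
(* Clipping the parameter makes both halves of the concatenation continuous on
   the whole product, so that they can be glued along closed sets. *)
have clip01 (r : R) : Num.max 0 (Num.min 1 r) \in I.
  apply/mem_set; rewrite /unit_interval /= in_itv /=.
  by rewrite le_max lexx/= ge_max ler01/= ge_min lexx.
pose clip r : I := exist (fun r => r \in I) _ (clip01 r).
have cclip : continuous clip.
  apply: continuous_set_type => r /=.
  apply: continuous_max; first exact: cvg_cst.
  by apply: continuous_min; [exact: cvg_cst|exact: cvg_id].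
pose A : set (X * I) := [set p | set_val p.2 <= 2^-1].
pose B : set (X * I) := [set p | 2^-1 <= set_val p.2].
have c2 : continuous (fun p : X * I => set_val p.2).
  by apply: continuous_compose (@set_val_continuous _ _); exact: snd_continuous.
have cA : closed A.
  exact: ((continuous_closedP _).1 c2 [set r | r <= 2^-1] (@closed_le _ _)).
have cB : closed B.
  exact: ((continuous_closedP _).1 c2 [set r | 2^-1 <= r] (@closed_ge _ _)).
pose F (p : X * I) : Y := H (p.1, clip (2 * set_val p.2)).
pose G (p : X * I) : Y := K (p.1, clip (2 * set_val p.2 - 1)).
have cF : continuous F.
  apply: continuous_compose cH; apply: continuous_pairing.
    exact: fst_continuous.
  apply: continuous_compose cclip => p.
  by apply: cvgM; [exact: cvg_cst|exact: c2].
have cG : continuous G.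
  apply: continuous_compose cK; apply: continuous_pairing.
    exact: fst_continuous.
  apply: continuous_compose cclip => p.
  by apply: cvgB; [apply: cvgM; [exact: cvg_cst|exact: c2]|exact: cvg_cst].
pose L (p : X * I) : Y := if set_val p.2 <= 2^-1 then F p else G p.
have clipE (r : I) s : s = set_val r -> clip s = r.
  move=> ->; apply: val_inj => /=; have /andP[r0 r1] := unit_intervalP r.
  by rewrite (min_r r1) (max_r r0).
have half : (2 : R) * 2^-1 = 1 by rewrite divff.
have clip0 r : r <= 0 -> clip r = I0 R.
  move=> r0; apply: val_inj => /=.
  by rewrite (min_r (le_trans r0 ler01)) max_l.
have clip1 r : 1 <= r -> clip r = I1 R.
  by move=> r1; apply: val_inj => /=; rewrite (min_l r1) max_r.
exists L; split.
- have AB : A `|` B = setT.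
    by apply/seteqP; split => // p _; case: (leP (set_val p.2) 2^-1) => h2;
      [left|right; exact: ltW].
  have : {within A `|` B, continuous L}.
    apply: withinU_continuous => //.
      apply: (subspace_eq_continuous (f := F)); last exact: continuous_subspaceT.
      by move=> p /set_mem Ap; rewrite /from_subspace /L ifT.
    apply: (subspace_eq_continuous (f := G)); last exact: continuous_subspaceT.
    move=> p /set_mem p2; rewrite /from_subspace /L.
    case: ifPn => // p2'; have p2E : set_val p.2 = 2^-1.
      by apply/eqP; rewrite eq_le p2 p2'.
    by rewrite /F /G !p2E !half subrr (clip1 1)// (clip0 0)// H1 K0.
  by rewrite AB => /(continuous_subspace_setT L).2.
- move=> x; rewrite /L /F /=.
  by rewrite invr_ge0 ler0n mulr0 clip0.
- move=> x; rewrite /L /G /=.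
  rewrite leNgt invf_lt1// ltr1n /= mulr1.
  by rewrite clip1// lerBrDr -natr1.
Qed.

(** A homotopy on a quotient can be constructed before taking the quotient,
    since [quotient_map_interval] makes its product with the interval a quotient
    again. *)
Lemma homotopic_descend (X Y Z : topologicalType) (q : X -> Y) (H : X * I -> Z)
    (k0 k1 : Y -> Z) : quotient_map q -> continuous H ->
    (forall x x' t, q x = q x' -> H (x, t) = H (x', t)) ->
    (forall x, H (x, I0 R) = k0 (q x)) -> (forall x, H (x, I1 R) = k1 (q x)) ->
  homotopic R k0 k1.
Proof.
move=> qq cH Hq H0 H1.
have [|K cK KE] := quotient_map_descend (quotient_map_interval R qq) cH.
  by move=> [x t] [x' t'] /= [] /Hq h ->; exact: h.
have [_ qs _] := qq.
exists K; split => // y; have [x <-] := qs y.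
  by rewrite -H0 -KE.
by rewrite -H1 -KE.
Qed.

End Homotopies.

(** * The cylinder as a quotient of rotations times the interval *)

Section RotationCylinder.
Variables (R : realType) (n : nat) (H Hl Hr : set 'M[R]_n).
Hypotheses (HHl : H `<=` Hl) (HHr : H `<=` Hr).
Local Notation I := (@unit_interval R).
Local Notation SOn := (@SO R n).
Local Notation cyl := (double_mapping_cylinder R
  (@SO_quotient_map R n H Hl) (@SO_quotient_map R n H Hr)).
Local Notation glue := (@cylinder_glue R _ _ _
  (@SO_quotient_map R n H Hl) (@SO_quotient_map R n H Hr)).

Definition cylinder_point (p : SOn * I) : cyl :=
  quotient_proj glue (cylinder_mid _ _ (quotient_proj (@same_coset R n H) p.1) p.2).

Local Notation pS A := (quotient_proj (@same_coset R n A)).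

Lemma cylinder_point0 q :
  cylinder_point (q, I0 R) = quotient_proj glue (cylinder_left R _ _ (pS Hl q)).
Proof.
by apply/quotient_projP; apply: rst_step; rewrite -(SO_quotient_mapE q HHl); exact: cylinder_glue0.
Qed.

Lemma cylinder_point1 q :
  cylinder_point (q, I1 R) = quotient_proj glue (cylinder_right R _ _ (pS Hr q)).
Proof.
by apply/quotient_projP; apply: rst_step; rewrite -(SO_quotient_mapE q HHr); exact: cylinder_glue1.
Qed.

Lemma cylinder_point_continuous : continuous cylinder_point.
Proof.
have [cq _ _] := quotient_proj_map glue.
apply: continuous_compose cq.
apply: (continuous_compose (f := fun p : SOn * I => (pS H p.1, p.2))); last first.
  exact: (@existT_continuous _ (@cylinder_piece R _ _ _) None).
have [cq' _ _] := quotient_proj_map (@same_coset R n H).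
apply: continuous_pairing; last exact: snd_continuous.
by apply: continuous_compose cq'; exact: fst_continuous.
Qed.

(** The two end pieces of the cylinder are already covered by the middle one,
    because the two attaching maps are surjective. *)
Lemma cylinder_point_map : quotient_map cylinder_point.
Proof.
split; first exact: cylinder_point_continuous.
- move=> y; rewrite -(quotient_reprK y); case: (quotient_repr y) => -[[]|] /=.
  + by move=> c; exists (quotient_repr c, I1 R);
      rewrite cylinder_point1 quotient_reprK.
  + by move=> b; exists (quotient_repr b, I0 R);
      rewrite cylinder_point0 quotient_reprK.
  + by move=> [a t]; exists (quotient_repr a, t);
      rewrite /cylinder_point /= quotient_reprK.
move=> V oV; have [_ _] := quotient_proj_map glue; apply.
have slice (t : I) : open [set q : SOn | V (cylinder_point (q, t))].
  have /continuousP : continuous (fun q : SOn => (q, t)).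
    by apply: continuous_pairing; [move=> q; exact: cvg_id|exact: cst_continuous].
  by move=> /(_ _ oV).
apply/sigT_openP => -[[]|].
- have [_ _] := quotient_proj_map (@same_coset R n Hr); apply.
  by have := slice (I1 R); under eq_set do rewrite cylinder_point1.
- have [_ _] := quotient_proj_map (@same_coset R n Hl); apply.
  by have := slice (I0 R); under eq_set do rewrite cylinder_point0.
have [_ _] := quotient_map_interval R (quotient_proj_map (@same_coset R n H)).
by apply.
Qed.

(** Invariance under the larger subgroups at the two ends is exactly what the
    gluing imposes on a function defined on the middle piece. *)
Lemma cylinder_point_eq (Y : Type) (G : SOn * I -> Y) :
    (forall q q' t, same_coset H q q' -> G (q, t) = G (q', t)) ->
    (forall q q', same_coset Hl q q' -> G (q, I0 R) = G (q', I0 R)) ->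
    (forall q q', same_coset Hr q q' -> G (q, I1 R) = G (q', I1 R)) ->
  forall p p', cylinder_point p = cylinder_point p' -> G p = G p'.
Proof.
move=> GH Gl Gr.
(* Extend [G] to the two end pieces through representatives of cosets. *)
pose Gs (x : cylinder_sum R (SO_quotient H) (SO_quotient Hl) (SO_quotient Hr)) : Y :=
  match x with
  | existT (Some false) b => G (quotient_repr (b : SO_quotient Hl), I0 R)
  | existT None a => G (quotient_repr (a.1 : SO_quotient H), a.2)
  | existT (Some true) c => G (quotient_repr (c : SO_quotient Hr), I1 R)
  end.
have repr_eq A t : (forall q q', same_coset A q q' -> G (q, t) = G (q', t)) ->
    forall q, G (quotient_repr (pS A q), t) = G (q, t).
  move=> GA q; have /quotient_projP := quotient_reprK (pS A q).
  move: (quotient_repr _) => q'.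
  by elim=> [x y /GA|//|x y _ ->|x y z _ -> _ ->].
have Gmid q t : Gs (cylinder_mid _ _ (pS H q) t) = G (q, t).
  by apply: repr_eq => q1 q2; exact: GH.
have Gglue x y : glue x y -> Gs x = Gs y.
  case=> a; rewrite -(quotient_reprK a) Gmid SO_quotient_mapE//=.
    by rewrite (repr_eq _ _ Gl).
  by rewrite (repr_eq _ _ Gr).
move=> [q t] [q' t'] /quotient_projP /= qq'.
rewrite -!Gmid; move: (cylinder_mid _ _ _ t) (cylinder_mid _ _ _ t') qq' => a b.
elim=> {a b} [x y /Gglue|//|x y _ ->|x y z _ -> _ ->] //.
Qed.

End RotationCylinder.

(** * Continuity of matrix operations *)

Section MatrixLimits.
Variables (R : realType) (T : Type) (F : set_system T).
Context {FF : Filter F}.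

Lemma cvg_sumr (J : Type) (r : seq J) (P : pred J) (f : J -> T -> R) (a : J -> R) :
  (forall j, P j -> f j x @[x --> F] --> a j) ->
  \sum_(j <- r | P j) f j x @[x --> F] --> \sum_(j <- r | P j) a j.
Proof. by apply: cvg_big; exact: add_continuous. Qed.

Lemma cvg_prodr (J : Type) (r : seq J) (P : pred J) (f : J -> T -> R) (a : J -> R) :
  (forall j, P j -> f j x @[x --> F] --> a j) ->
  \prod_(j <- r | P j) f j x @[x --> F] --> \prod_(j <- r | P j) a j.
Proof. by apply: cvg_big; exact: mul_continuous. Qed.

Lemma cvg_mxP m n (f : T -> 'M[R]_(m, n)) (A : 'M[R]_(m, n)) :
  f x @[x --> F] --> A <-> forall i j, f x i j @[x --> F] --> A i j.
Proof.
split=> [fA i j|fA U [P AP PU]].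
  by apply: (cvg_comp f (fun M : 'M[R]_(m, n) => M i j) fA); exact: coord_continuous.
suff : \forall x \near F, forall i j, P i j (f x i j).
  by apply: filterS => x Px; exact: PU.
apply: filter_forall => i; apply: filter_forall => j.
exact: (fA i j _ (AP i j)).
Qed.

Lemma cvg_cstmx m n (A : 'M[R]_(m, n)) : A @[_ --> F] --> A.
Proof. by apply/cvg_mxP => i j; exact: cvg_cst. Qed.

Lemma cvg_mulmx m n p (f : T -> 'M[R]_(m, n)) (g : T -> 'M[R]_(n, p))
    (A : 'M[R]_(m, n)) (B : 'M[R]_(n, p)) :
  f x @[x --> F] --> A -> g x @[x --> F] --> B ->
  (f x *m g x) @[x --> F] --> A *m B.
Proof.
move=> /cvg_mxP fA /cvg_mxP gB; apply/cvg_mxP => i j; rewrite mxE.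
under eq_cvg do rewrite mxE.
by apply: cvg_sumr => k _; apply: cvgM.
Qed.

Lemma cvg_addmx m n (f g : T -> 'M[R]_(m, n)) (A B : 'M[R]_(m, n)) :
  f x @[x --> F] --> A -> g x @[x --> F] --> B ->
  (f x + g x) @[x --> F] --> A + B.
Proof.
move=> /cvg_mxP fA /cvg_mxP gB; apply/cvg_mxP => i j; rewrite mxE.
by under eq_cvg do rewrite mxE; apply: cvgD.
Qed.

Lemma cvg_oppmx m n (f : T -> 'M[R]_(m, n)) (A : 'M[R]_(m, n)) :
  f x @[x --> F] --> A -> (- f x) @[x --> F] --> - A.
Proof.
move=> /cvg_mxP fA; apply/cvg_mxP => i j; rewrite mxE.
by under eq_cvg do rewrite mxE; apply: cvgN.
Qed.

Lemma cvg_scalemx m n (a : T -> R) (f : T -> 'M[R]_(m, n)) (b : R)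
    (A : 'M[R]_(m, n)) :
  a x @[x --> F] --> b -> f x @[x --> F] --> A ->
  (a x *: f x) @[x --> F] --> b *: A.
Proof.
move=> ab /cvg_mxP fA; apply/cvg_mxP => i j; rewrite mxE.
by under eq_cvg do rewrite mxE; apply: cvgM.
Qed.

Lemma cvg_trmx m n (f : T -> 'M[R]_(m, n)) (A : 'M[R]_(m, n)) :
  f x @[x --> F] --> A -> (f x)^T @[x --> F] --> A^T.
Proof.
move=> /cvg_mxP fA; apply/cvg_mxP => i j; rewrite mxE.
by under eq_cvg do rewrite mxE; exact: fA.
Qed.

Lemma cvg_col_mx m m' n (f : T -> 'M[R]_(m, n)) (g : T -> 'M[R]_(m', n))
    (A : 'M[R]_(m, n)) (B : 'M[R]_(m', n)) :
  f x @[x --> F] --> A -> g x @[x --> F] --> B ->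
  col_mx (f x) (g x) @[x --> F] --> col_mx A B.
Proof.
move=> /cvg_mxP fA /cvg_mxP gB; apply/cvg_mxP => i j; rewrite mxE.
under eq_cvg do rewrite mxE.
by case: (fintype.split i) => k; [exact: fA|exact: gB].
Qed.

Lemma cvg_row_mx m n n' (f : T -> 'M[R]_(m, n)) (g : T -> 'M[R]_(m, n'))
    (A : 'M[R]_(m, n)) (B : 'M[R]_(m, n')) :
  f x @[x --> F] --> A -> g x @[x --> F] --> B ->
  row_mx (f x) (g x) @[x --> F] --> row_mx A B.
Proof.
move=> /cvg_mxP fA /cvg_mxP gB; apply/cvg_mxP => i j; rewrite mxE.
under eq_cvg do rewrite mxE.
by case: (fintype.split j) => k; [exact: fA|exact: gB].
Qed.

Lemma cvg_det n (f : T -> 'M[R]_n) (A : 'M[R]_n) :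
  f x @[x --> F] --> A -> \det (f x) @[x --> F] --> \det A.
Proof.
move=> /cvg_mxP fA; apply: cvg_sumr => s _; apply: cvgM; first exact: cvg_cst.
by apply: cvg_prodr => i _.
Qed.

Lemma cvg_cofactor n (f : T -> 'M[R]_n) (A : 'M[R]_n) i j :
  f x @[x --> F] --> A -> cofactor (f x) i j @[x --> F] --> cofactor A i j.
Proof.
move=> fA; apply: cvgM; first exact: cvg_cst.
apply: cvg_det; apply/cvg_mxP => a b; rewrite !mxE.
under eq_cvg do rewrite !mxE.
by have /cvg_mxP := fA; apply.
Qed.

Lemma cvg_mxE m n (f : T -> 'M[R]_(m, n)) (A : 'M[R]_(m, n)) i j :
  f x @[x --> F] --> A -> f x i j @[x --> F] --> A i j.
Proof. by move=> /cvg_mxP fA; exact: fA. Qed.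

Lemma cvg_adj n (f : T -> 'M[R]_n) (A : 'M[R]_n) :
  f x @[x --> F] --> A -> \adj (f x) @[x --> F] --> \adj A.
Proof.
move=> fA; apply/cvg_mxP => i j; rewrite mxE.
by under eq_cvg do rewrite mxE; apply: cvg_cofactor.
Qed.

Lemma cvg_maxr (f g : T -> R) (a b : R) :
  f x @[x --> F] --> a -> g x @[x --> F] --> b ->
  Num.max (f x) (g x) @[x --> F] --> Num.max a b.
Proof.
move=> fa gb.
have E (u v : R) : Num.max u v = (u + v + `|u - v|) / 2 by rewrite maxr_absE.
rewrite E; under eq_cvg do rewrite E.
apply: cvgM; last exact: cvg_cst.
by apply: cvgD; [exact: cvgD|apply: cvg_norm; exact: cvgB].
Qed.

End MatrixLimits.

Section MatrixContinuity.
Variables (R : realType) (S : topologicalType).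

Lemma continuous_mulmx m n p (f : S -> 'M[R]_(m, n)) (g : S -> 'M[R]_(n, p)) :
  continuous f -> continuous g -> continuous (fun s => f s *m g s).
Proof. by move=> cf cg s; apply: cvg_mulmx; [exact: cf|exact: cg]. Qed.

Lemma continuous_addmx m n (f g : S -> 'M[R]_(m, n)) :
  continuous f -> continuous g -> continuous (fun s => f s + g s).
Proof. by move=> cf cg s; apply: cvg_addmx; [exact: cf|exact: cg]. Qed.

Lemma continuous_scalemx m n (a : S -> R) (f : S -> 'M[R]_(m, n)) :
  continuous a -> continuous f -> continuous (fun s => a s *: f s).
Proof. by move=> ca cf s; apply: cvg_scalemx; [exact: ca|exact: cf]. Qed.

End MatrixContinuity.

(** * Orthonormalization of rows *)

(** Only the behaviour under right multiplication matters: row operations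
    commute with it, so that the Gram-Schmidt process on the rows is a
    deformation of the invertible matrices onto the orthogonal ones which is
    equivariant for the orthogonal group acting on the right. *)
Section GramSchmidt.
Variables (R : realType) (n : nat).
Local Notation MM := 'M[R]_n.

Definition sqnorm m (v : 'rV[R]_m) : R := (v *m v^T) 0 0.

Definition normalize m (v : 'rV[R]_m) : 'rV[R]_m := (Num.sqrt (sqnorm v))^-1 *: v.

Definition gs_residual (Y Q : MM) (k : 'I_n) : 'rV[R]_n :=
  row k Y *m (1%:M - Q^T *m Q).

(** In [gs_iter Y k] the rows of index at least [k] are still zero, so that
    [1 - Q^T *m Q] is the projection away from the rows already found. *)
Fixpoint gs_iter (Y : MM) (k : nat) : MM :=
  if k isn't k'.+1 then 0 else
  let Q := gs_iter Y k' in
  if insub k' is Some i then Q + delta_mx i 0 *m normalize (gs_residual Y Q i)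
  else Q.

Definition gram_schmidt (Y : MM) : MM := gs_iter Y n.

Lemma sqnorm_ge0 m (v : 'rV[R]_m) : 0 <= sqnorm v.
Proof. by rewrite /sqnorm mxE sumr_ge0// => i _; rewrite mxE -expr2 sqr_ge0. Qed.

Lemma sqnorm_eq0 m (v : 'rV[R]_m) : (sqnorm v == 0) = (v == 0).
Proof.
apply/eqP/eqP => [|->]; last by rewrite /sqnorm mul0mx mxE.
rewrite /sqnorm mxE => /eqP; rewrite psumr_eq0 => [/allP v0|i _]; last first.
  by rewrite mxE -expr2 sqr_ge0.
apply/rowP => i; have /implyP := v0 i (mem_index_enum i).
by rewrite !mxE mulf_eq0 orbb => /(_ isT)/eqP.
Qed.

Lemma gs_iterS Y (k : 'I_n) : gs_iter Y k.+1 =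
  gs_iter Y k + delta_mx k 0 *m normalize (gs_residual Y (gs_iter Y k) k).
Proof. by rewrite /= insubT//= => lt_kn; rewrite (_ : Sub _ _ = k)//; apply: val_inj. Qed.

Lemma gs_iter_mulmxr Y r k : r *m r^T = 1%:M ->
  gs_iter (Y *m r) k = gs_iter Y k *m r.
Proof.
move=> rr; elim: k => [|k IHk]; first by rewrite mul0mx.
have [lt_kn|le_nk] := ltnP k n; last first.
  by rewrite /= insubF ?IHk// ltnNge le_nk.
rewrite -[k]/(val (Ordinal lt_kn)) !gs_iterS /= IHk mulmxDl -mulmxA; congr (_ + _ *m _).
have -> : gs_residual (Y *m r) (gs_iter Y k *m r) (Ordinal lt_kn) =
          gs_residual Y (gs_iter Y k) (Ordinal lt_kn) *m r.
  rewrite /gs_residual row_mul -!mulmxA; congr (_ *m _).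
  rewrite mulmxBr mulmx1 mulmxBl mul1mx; congr (_ - _).
  by rewrite trmx_mul !mulmxA rr mul1mx.
rewrite /normalize -scalemxAl; congr (_^-1 *: _); congr (Num.sqrt _).
by rewrite /sqnorm trmx_mul -mulmxA (mulmxA r) rr mul1mx.
Qed.

(** The invariant of the iteration. By [gs_coef] the rows found so far are
    combinations of the first rows of [Y], which is why the next residual cannot
    vanish; [gs_upper] and [gs_diag] say that [Y] is a lower triangular multiple
    of the result, with a positive diagonal. *)
Record gs_spec (Y : MM) (k : nat) (Q : MM) : Prop := GsSpec {
  gs_orth : forall i j, (Q *m Q^T) i j = ((i == j) && (i < k)%N)%:R;
  gs_zero : forall i : 'I_n, (k <= i)%N -> row i Q = 0;
  gs_span : forall i : 'I_n, (i < k)%N -> row i Y *m (1%:M - Q^T *m Q) = 0;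
  gs_upper : forall i j : 'I_n, (i < j < k)%N -> (Y *m Q^T) i j = 0;
  gs_diag : forall i : 'I_n, (i < k)%N -> 0 < (Y *m Q^T) i i;
  gs_coef : exists2 C : MM, Q = C *m Y & forall i j : 'I_n, (k <= j)%N -> C i j = 0
}.

Lemma gs_residual_neq0 Y (k : 'I_n) Q :
  \det Y != 0 -> gs_spec Y k Q -> gs_residual Y Q k != 0.
Proof.
move=> Y0 [_ _ _ _ _ [C QC C0]]; apply/eqP; rewrite /gs_residual.
rewrite mulmxBr mulmx1 => /eqP; rewrite subr_eq0 {2}QC !mulmxA => /eqP YE.
have uY : Y \in unitmx by rewrite unitmxE unitfE.
have /(congr1 (mulmx^~ (invmx Y))) := YE.
rewrite mulmxK// {1}rowE mulmxK// => /rowP/(_ k).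
rewrite !mxE !eqxx big1 => [/eqP|j _]; first by rewrite oner_eq0.
by rewrite (C0 j k)// mulr0.
Qed.

Lemma gs_iter_spec Y k : \det Y != 0 -> (k <= n)%N -> gs_spec Y k (gs_iter Y k).
Proof.
move=> Y0; elim: k => [_|k IHk lt_kn].
  split => //=.
  - by move=> i j; rewrite mul0mx mxE andbF.
  - by move=> i _; rewrite row0.
  - by move=> i j; rewrite andbF.
  - by exists 0; [rewrite mul0mx|move=> i j _; rewrite mxE].
have {IHk} spec := IHk (ltnW lt_kn).
pose K := Ordinal lt_kn; rewrite -[k]/(val K) gs_iterS.
set Q := gs_iter Y K; have [Qorth Qzero Qspan Qup Qdiag [C QC C0]] : gs_spec Y K Q := spec.
have := gs_residual_neq0 (k := K) Y0 spec; rewrite -/Q.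
set v := gs_residual Y Q K => v0.
set u := normalize v.
have nv : 0 < sqnorm v by rewrite lt_neqAle eq_sym sqnorm_eq0 v0 sqnorm_ge0.
set a := Num.sqrt (sqnorm v); have a0 : 0 < a by rewrite sqrtr_gt0.
have uE : u = a^-1 *: v by [].
have QPQ : Q *m Q^T *m Q = Q.
  apply/row_matrixP => i; have [ik|ki] := ltnP i K.
    rewrite row_mul (_ : row i (Q *m Q^T) = delta_mx 0 i) -?rowE//.
    by apply/rowP => j; rewrite [LHS]mxE Qorth [RHS]mxE ik andbT eq_sym.
  by rewrite -mulmxA row_mul (Qzero _ ki) mul0mx.
have QtPQ : Q^T *m (Q *m Q^T) = Q^T.
  by have := congr1 trmx QPQ; rewrite !trmx_mul trmxK.
have vQ : v *m Q^T = 0.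
  by rewrite /v /gs_residual -mulmxA mulmxBl mul1mx -mulmxA QtPQ subrr mulmx0.
have uQ : u *m Q^T = 0 by rewrite uE -scalemxAl vQ scaler0.
have Qu : Q *m u^T = 0 by rewrite -[Q]trmxK -trmx_mul uQ trmx0.
have uu : u *m u^T = 1%:M.
  rewrite uE linearZ /= -scalemxAl -scalemxAr scalerA.
  rewrite [v *m v^T]mx11_scalar -/(sqnorm v) scale_scalar_mx -invfM -expr2 sqr_sqrtr ?ltW//.
  by rewrite mulVf// gt_eqF.
have eQ : (delta_mx K 0 : 'cV[R]_n)^T *m Q = 0.
  by rewrite trmx_delta -rowE Qzero//=.
have Qe : Q^T *m (delta_mx K 0 : 'cV[R]_n) = 0.
  by rewrite -[delta_mx _ _]trmxK -trmx_mul eQ trmx0.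
set Q' := Q + _.
have Q'Q' : Q'^T *m Q' = Q^T *m Q + u^T *m u.
  rewrite /Q' [(_ + _)^T]linearD /= mulmxDl !mulmxDr trmx_mul.
  rewrite [Q^T *m (_ *m _)]mulmxA Qe mul0mx addr0 -[_ *m _ *m Q]mulmxA eQ mulmx0 add0r.
  rewrite mulmxA -[X in X *m u]mulmxA trmx_delta mul_delta_mx; congr (_ + _ *m _).
  by rewrite (_ : delta_mx 0 0 = 1%:M) ?mulmx1//; apply/matrixP => i j; rewrite !ord1 !mxE.
have yu (i : 'I_n) : (i < K)%N -> row i Y *m u^T = 0.
  move=> ik; have := congr1 (mulmx^~ u^T) (Qspan _ ik).
  rewrite mul0mx mulmxBr mulmx1 mulmxBl -!mulmxA Qu !mulmx0 subr0.
  by [].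
have vau : v = a *: u by rewrite uE scalerA divff ?scale1r// gt_eqF.
have yKu : row K Y *m u^T = a%:M.
  have -> : row K Y = v + row K Y *m Q^T *m Q.
    by rewrite /v /gs_residual mulmxBr mulmx1 -mulmxA subrK.
  rewrite mulmxDl -[_ *m Q *m _]mulmxA Qu mulmx0 addr0 vau.
  by rewrite -scalemxAl uu scale_scalar_mx mulr1.
have YQ' i j : (Y *m Q'^T) i j = (Y *m Q^T) i j + (row i Y *m u^T) 0 0 * (j == K)%:R.
  rewrite /Q' [(_ + _)^T]linearD /= trmx_mul trmx_delta mulmxDr mxE; congr (_ + _).
  rewrite mulmxA [LHS]mxE big_ord1 [delta_mx _ _ _ _]mxE eqxx /=; congr (_ * _).
  by rewrite -row_mul [RHS]mxE.
have QK0 i : (Y *m Q^T) i K = 0.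
  rewrite mxE big1// => j _; have /rowP/(_ j) := Qzero K (leqnn _).
  by rewrite !mxE => ->; rewrite mulr0.
have ltSK (i : 'I_n) : (i < K.+1)%N = (i == K) || (i < K)%N.
  by rewrite ltnS leq_eqVlt.
split.
- move=> i j; rewrite /Q' [(_ + _)^T]linearD /= trmx_mul mulmxDl !mulmxDr.
  rewrite (mulmxA Q) Qu mul0mx addr0 -[_ *m u *m Q^T]mulmxA uQ mulmx0 add0r.
  rewrite mulmxA -[_ *m u *m u^T]mulmxA uu mulmx1 trmx_delta mul_delta_mx.
  rewrite mxE Qorth mxE ltSK; have [->|] := eqVneq i K.
    by rewrite ltnn andbF add0r andbT eq_sym.
  by rewrite /= addr0.
- move=> i ki; rewrite /Q' linearD /= Qzero ?add0r; last exact: ltnW.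
  rewrite row_mul; apply/rowP => j; rewrite !mxE big1// => l _; rewrite !mxE.
  by rewrite (_ : i == K = false) ?mul0r//; apply/negP => /eqP iK; rewrite iK ltnn in ki.
- move=> i; rewrite ltSK Q'Q' opprD addrA mulmxBr => /orP[/eqP->|ik].
    by rewrite mulmxA yKu mul_scalar_mx -vau subrr.
  by rewrite mulmxA yu// mul0mx subr0 Qspan.
- move=> i j /andP[ij]; rewrite YQ' ltSK => /orP[/eqP jK|jk].
    by rewrite jK QK0 yu -?jK// mxE mul0r addr0.
  by rewrite Qup ?ij// (_ : j == K = false) ?mulr0 ?addr0// lt_eqF.
- move=> i; rewrite YQ' ltSK => /orP[/eqP->|ik].
    by rewrite QK0 yKu eqxx mulr1 add0r mxE mulr1n.
  by rewrite yu// [X in _ + X * _]mxE mul0r addr0 Qdiag.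
exists (C + delta_mx K 0 *m (a^-1 *: (delta_mx 0 K - row K Y *m Q^T *m C))).
  rewrite mulmxDl -QC -[X in _ = _ + X]mulmxA /Q'; congr (_ + _ *m _).
  rewrite -scalemxAl mulmxBl -rowE -!mulmxA -QC uE /v /gs_residual.
  by rewrite mulmxBr mulmx1.
move=> i j kj; rewrite mxE C0 ?add0r; last exact: ltnW.
have jK : (j == K) = false by apply/eqP => jK; rewrite jK ltnn in kj.
rewrite mxE big_ord1 !mxE eqxx /= jK.
rewrite big1 ?subr0 ?mulr0// => l _; by rewrite C0 ?mulr0// ltnW.
Qed.

Section Invertible.
Variables (Y : MM).
Hypothesis Y0 : \det Y != 0.

Let spec : gs_spec Y n (gram_schmidt Y) := gs_iter_spec Y0 (leqnn n).

Lemma gram_schmidt_orth : gram_schmidt Y *m (gram_schmidt Y)^T = 1%:M.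
Proof. by apply/matrixP => i j; rewrite (gs_orth spec) ltn_ord andbT mxE. Qed.

(** [Y *m Q^T] is lower triangular with positive diagonal, and so is its
    convex combination with a positive multiple of the identity. *)
Lemma gram_schmidt_path_det (a b : R) : 0 <= a -> 0 <= b -> 0 < a + b ->
  exists2 d : R, 0 < d &
    \det (a *: Y + b *: gram_schmidt Y) = d * \det (gram_schmidt Y).
Proof.
move=> a0 b0 ab; pose Q := gram_schmidt Y; pose L := Y *m Q^T.
have YE : Y = L *m Q.
  by rewrite /L -mulmxA (mulmx1C gram_schmidt_orth) mulmx1.
exists (\prod_i (a * L i i + b)).
  apply: prodr_gt0 => i _.
  have Lii : 0 < L i i by rewrite (gs_diag spec).
  have [a_eq0|a_neq0] := eqVneq a 0.
    by rewrite a_eq0 mul0r add0r; rewrite a_eq0 add0r in ab.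
  by rewrite ltr_pwDl// mulr_gt0// lt_neqAle eq_sym a_neq0.
rewrite {1}YE -/Q scalemxAl -[X in _ + b *: X]mul1mx scalemxAl -mulmxDl det_mulmx; congr (_ * _).
have entry i j : (a *: L + b *: 1%:M) i j = a * L i j + b * (i == j)%:R.
  by rewrite [LHS]mxE; congr (_ + _); rewrite [LHS]mxE//; congr (_ * _); rewrite mxE.
rewrite det_trig; last first.
  apply/is_trig_mxP => i j ij; rewrite entry.
  have -> : L i j = 0 by rewrite (gs_upper spec)// ij/=.
  by rewrite (_ : i == j = false) ?mulr0 ?addr0// lt_eqF.
by apply: eq_bigr => i _; rewrite entry eqxx mulr1.
Qed.

Lemma gram_schmidt_det : 0 < \det Y -> \det (gram_schmidt Y) = 1.
Proof.
move=> Ygt0; have [d d0] := gram_schmidt_path_det ler01 (lexx 0) (ltr_wpDr (lexx 0) ltr01).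
rewrite scale1r scale0r addr0 => YE.
have Q0 : 0 < \det (gram_schmidt Y) by rewrite YE pmulr_rgt0 in Ygt0.
have /(congr1 determinant) := gram_schmidt_orth; rewrite det_mulmx det_tr det1.
by move=> /eqP; rewrite -expr2 sqrf_eq1 => /orP[/eqP//|/eqP Q1]; move: Q0; rewrite Q1 ltr0N1.
Qed.

End Invertible.

Lemma gram_schmidt_mulmxr Y r : r *m r^T = 1%:M ->
  gram_schmidt (Y *m r) = gram_schmidt Y *m r.
Proof. exact: gs_iter_mulmxr. Qed.

(** By equivariance it is enough to orthonormalize the scalar matrix. *)
Lemma gram_schmidt_scale_orth (c : R) r : 0 < c -> r *m r^T = 1%:M ->
  gram_schmidt (c *: r) = r.
Proof.
move=> c0 rr; rewrite -[r in c *: r]mul1mx scalemxAl gram_schmidt_mulmxr//.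
rewrite -[RHS]mul1mx; congr (_ *m _); rewrite scalemx1.
suff H k : (k <= n)%N ->
    gs_iter c%:M k = \matrix_(i, j) ((i == j) && (i < k)%N)%:R.
  by rewrite /gram_schmidt H//; apply/matrixP => i j; rewrite !mxE ltn_ord andbT.
elim: k => [_|k IHk lt_kn]; first by apply/matrixP => i j; rewrite !mxE andbF.
pose K := Ordinal lt_kn; rewrite -[k]/(val K) gs_iterS /= IHk ?(ltnW lt_kn)//.
set P := \matrix_(_, _) _.
have -> : gs_residual c%:M P K = c *: delta_mx 0 K.
  rewrite /gs_residual mulmxBr mulmx1 (_ : row K _ *m _ = 0) ?subr0.
    by apply/rowP => j; rewrite !mxE eqxx /= mulr_natr eq_sym.
  rewrite mulmxA (_ : row K _ *m P^T = 0) ?mul0mx//.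
  apply/rowP => j; rewrite !mxE big1// => l _; rewrite !mxE.
  have [<-|] := eqVneq K l; last by rewrite mul0r.
  by rewrite [j == K]eq_sym; have [<-|] := eqVneq K j; rewrite ?ltnn mulr0.
have -> : normalize (c *: delta_mx 0 K) = delta_mx 0 K :> 'rV[R]_n.
  rewrite /normalize /sqnorm [(c *: _)^T]linearZ /= -scalemxAl -scalemxAr scalerA trmx_delta.
  rewrite mul_delta_mx !mxE !eqxx mulr1 -expr2 sqrtr_sqr gtr0_norm//.
  by rewrite mulVf ?scale1r// gt_eqF.
rewrite mul_delta_mx; apply/matrixP => i j; rewrite !mxE ltnS.
rewrite (leq_eqVlt i) -[i == k :> nat]/(i == K).
have [->|] := eqVneq i K; last by rewrite /= addr0.
by rewrite ltnn andbF add0r andbT eq_sym.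
Qed.

Lemma cvg_gram_schmidt (T : Type) (F : set_system T) {FF : Filter F}
    (f : T -> MM) (Y : MM) :
  \det Y != 0 -> f x @[x --> F] --> Y ->
  gram_schmidt (f x) @[x --> F] --> gram_schmidt Y.
Proof.
move=> Y0 fY; rewrite /gram_schmidt.
suff : forall k, (k <= n)%N -> gs_iter (f x) k @[x --> F] --> gs_iter Y k by apply.
elim=> [_|k IHk lt_kn]; first exact: cvg_cstmx.
have {}IHk := IHk (ltnW lt_kn); have spec := gs_iter_spec Y0 (ltnW lt_kn).
pose K := Ordinal lt_kn; rewrite -[k]/(val K) gs_iterS.
under eq_cvg do rewrite gs_iterS.
apply: cvg_addmx => //; apply: cvg_mulmx; first by apply/cvg_mxP => i j; exact: cvg_cst.
have cv : gs_residual (f x) (gs_iter (f x) K) K @[x --> F] -->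
          gs_residual Y (gs_iter Y K) K.
  apply: cvg_mulmx; first by rewrite !rowE; under eq_cvg do rewrite rowE;
    apply: cvg_mulmx => //; exact: cvg_cstmx.
  apply: cvg_addmx; first exact: cvg_cstmx.
  apply: cvg_oppmx; apply: cvg_mulmx; last exact: IHk.
  by apply: cvg_trmx; exact: IHk.
apply: cvg_scalemx => //; apply: cvgV.
  rewrite sqrtr_eq0 -ltNge lt_neqAle eq_sym sqnorm_eq0 sqnorm_ge0 andbT.
  exact: (gs_residual_neq0 (k := K)).
apply: (cvg_comp _ Num.sqrt); last exact: sqrt_continuous.
by apply: cvg_mxE; apply: cvg_mulmx => //; exact: cvg_trmx.
Qed.

End GramSchmidt.

(** * The regular simplex and its rotation groups *)

Section SimplexAlgebra.
Variables (R : realType) (n : nat).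
Hypothesis n_gt0 : (0 < n)%N.
Local Notation ones := (const_mx 1 : 'rV[R]_n.+1).

Lemma n_neq0 : n%:R != 0 :> R.
Proof. by rewrite pnatr_eq0 -lt0n. Qed.

Lemma nS_neq0 : n%:R + 1 != 0 :> R.
Proof. by rewrite natr1 pnatr_eq0. Qed.

Lemma ones_mulmx (m : nat) (A : 'M[R]_(n.+1, m)) j : (ones *m A) 0 j = \sum_i A i j.
Proof. by rewrite mxE; apply: eq_bigr => i _; rewrite mxE mul1r. Qed.

Lemma mulmx_ones (m : nat) (A : 'M[R]_(m, n.+1)) i : (A *m ones^T) i 0 = \sum_j A i j.
Proof. by rewrite mxE; apply: eq_bigr => j _; rewrite !mxE mulr1. Qed.

Lemma ones_perm (s : {perm 'I_n.+1}) : ones *m perm_mx s = ones.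
Proof.
apply/rowP => j; rewrite ones_mulmx mxE (bigD1 (s^-1%g j))//= big1 ?addr0.
  by rewrite !mxE permKV eqxx.
move=> i ij; rewrite !mxE (_ : s i == j = false)//; apply/eqP => sij.
by rewrite -sij permK eqxx in ij.
Qed.

Lemma perm_ones (s : {perm 'I_n.+1}) : perm_mx s *m ones^T = ones^T.
Proof. by rewrite -[LHS]trmxK trmx_mul trmxK tr_perm_mx ones_perm. Qed.

Lemma onesT : ones *m ones^T = (n%:R + 1)%:M.
Proof.
rewrite [LHS]mx11_scalar mulmx_ones; congr (_%:M).
by under eq_bigr do rewrite mxE; rewrite sumr_const card_ord natr1.
Qed.

Variable i0 : 'I_n.+1.
Local Notation e0 := (delta_mx 0 i0 : 'rV[R]_n.+1).

(** Adding [eta *m e0] to the identity moves the vertex [i0] to the barycenter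
    of the others. *)
Definition eta : 'cV[R]_n.+1 := \col_k if k == i0 then -1 else n%:R^-1.

(** The affine dilation by the factor [k] of the vertex [i0], from the
    barycenter of the opposite facet. *)
Definition dilation (k : R) : 'M[R]_n.+1 := 1%:M + (1 - k) *: (eta *m e0).

Lemma e0_eta : e0 *m eta = -1.
Proof. by rewrite -rowE; apply/matrixP => i j; rewrite !ord1 !mxE eqxx. Qed.

Lemma ones_eta : ones *m eta = 0.
Proof.
apply/matrixP => i j; rewrite !ord1 ones_mulmx [RHS]mxE (bigD1 i0)//= mxE eqxx.
rewrite (eq_bigr (fun=> n%:R^-1)) => [|k /negPf ki]; last by rewrite mxE ki.
rewrite sumr_const cardC1 card_ord /= -[_ *+ _]mulr_natr mulVf ?n_neq0//.
by rewrite addNr.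
Qed.

Lemma e0_ones : e0 *m ones^T = 1.
Proof. by rewrite -rowE; apply/matrixP => i j; rewrite !ord1 !mxE. Qed.

Lemma ones_dilation k : ones *m dilation k = ones.
Proof. by rewrite mulmxDr mulmx1 -scalemxAr mulmxA ones_eta mul0mx scaler0 addr0. Qed.

Lemma e0_dilation k : e0 *m dilation k = k *: e0.
Proof.
rewrite mulmxDr mulmx1 -scalemxAr mulmxA e0_eta mulNmx mul1mx scalerN scalerBl.
by rewrite scale1r opprB addrC subrK.
Qed.

Lemma dilationM k k' : dilation k *m dilation k' = dilation (k * k').
Proof.
rewrite {1}/dilation mulmxDl mul1mx -scalemxAl -mulmxA e0_dilation.
rewrite -scalemxAr scalerA /dilation -addrA -scalerDl; congr (_ + _ *: _); ring.
Qed.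

Lemma dilation1 : dilation 1 = 1%:M.
Proof. by rewrite /dilation subrr scale0r addr0. Qed.

Lemma perm_eta (s : {perm 'I_n.+1}) : s i0 = i0 -> perm_mx s *m eta = eta.
Proof.
move=> si; rewrite -row_permE; apply/colP => k; rewrite !mxE.
by rewrite -{1}si (inj_eq perm_inj).
Qed.

Lemma e0_perm (s : {perm 'I_n.+1}) : e0 *m perm_mx s = delta_mx 0 (s i0).
Proof. by rewrite -rowE; apply/rowP => j; rewrite !mxE eqxx /= eq_sym. Qed.

Lemma perm_dilation (s : {perm 'I_n.+1}) k : s i0 = i0 ->
  perm_mx s *m dilation k = dilation k *m perm_mx s.
Proof.
move=> si; rewrite mulmxDr mulmxDl mulmx1 mul1mx -scalemxAr -scalemxAl; congr (_ + _ *: _).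
by rewrite mulmxA perm_eta// -mulmxA e0_perm si.
Qed.

Lemma col_dilation m (z : 'M[R]_(m, n.+1)) k j : j != i0 ->
  col j (z *m dilation k) = col j z.
Proof.
move=> ji; rewrite mulmxDr mulmx1 -scalemxAr mulmxA; apply/colP => i.
rewrite !mxE big_ord1 !mxE eqxx /=.
by rewrite (negPf ji) mulr0 mulr0 addr0.
Qed.

(** A relabeling or affine change [T] of a simplex with distinguished vertex
    [i0] does not change the point of the cylinder at height [t]; here
    [dilation (-1)] is the reflection in the facet opposite to [i0]. *)
Definition admissible (t : R) (T : 'M[R]_n.+1) : Prop :=
  (exists2 s : {perm 'I_n.+1}, s i0 = i0 &
     T = perm_mx s \/ t = 1 /\ T = perm_mx s *m dilation (-1)) \/
  (t = 0 /\ exists s : {perm 'I_n.+1}, T = perm_mx s).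

Lemma admissible_ones t T : admissible t T -> ones *m T = ones.
Proof.
case=> [[s _ [->|[_ ->]]]|[_ [s ->]]]; rewrite ?ones_perm//.
by rewrite mulmxA ones_perm ones_dilation.
Qed.

Section Simplex.
Variables (c : R) (D : 'M[R]_(n, n.+1)).
Hypothesis c_gt0 : 0 < c.
Hypothesis D_ones : D *m ones^T = 0.
Hypothesis DDt : D *m D^T = c%:M.
Hypothesis DtD : D^T *m D = c *: (1%:M - (n%:R + 1)^-1 *: (ones^T *m ones)).

Local Notation u := (col i0 D).
Let c_neq0 : c != 0. Proof. by rewrite gt_eqF. Qed.

(** The linear map induced on the space of the simplex by an affine map that is
    given by the matrix [T] in barycentric coordinates. *)
Definition rho (T : 'M[R]_n.+1) : 'M[R]_n := c^-1 *: (D *m T *m D^T).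

(** The simplex translated by [t] times the way from its center to the center
    of the facet opposite to [i0]. *)
Definition shifted (t : R) : 'M[R]_(n, n.+1) := D + (t / n%:R) *: (u *m ones).

Lemma ones_Dt : ones *m D^T = 0.
Proof. by rewrite -[LHS]trmxK trmx_mul trmxK D_ones trmx0. Qed.

Lemma shifted_Dt t : shifted t *m D^T = c%:M.
Proof. by rewrite mulmxDl -scalemxAl -mulmxA ones_Dt mulmx0 scaler0 addr0 DDt. Qed.

Lemma shifted_mul_Dt t (T : 'M[R]_n.+1) : ones *m T = ones ->
  shifted t *m T *m D^T = D *m T *m D^T.
Proof.
move=> T1; rewrite /shifted mulmxDl -scalemxAl -(mulmxA u) T1.
by rewrite mulmxDl -scalemxAl -(mulmxA u) ones_Dt mulmx0 scaler0 addr0.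
Qed.

Lemma D_eta : D *m eta = - ((n%:R + 1) / n%:R) *: u.
Proof.
have -> : eta = n%:R^-1 *: ones^T - ((n%:R + 1) / n%:R) *: delta_mx i0 0.
  apply/colP => k; rewrite !mxE eqxx andbT; case: eqP => _ /=.
    by rewrite mulr1n; field; exact: n_neq0.
  by rewrite mulr0n mulr0 subr0 mulr1.
by rewrite mulmxBr -!scalemxAr D_ones scaler0 sub0r -colE scaleNr.
Qed.

Lemma rhoM T T' : ones *m T' = ones -> rho (T *m T') = rho T *m rho T'.
Proof.
move=> T1; rewrite /rho -scalemxAl -scalemxAr -!mulmxA (mulmxA D^T) DtD.
rewrite -scalemxAl -!scalemxAr mulmxBl mul1mx mulmxBr mulmxBr.
rewrite -scalemxAl -!scalemxAr -!mulmxA (mulmxA ones) T1 ones_Dt !mulmx0 scaler0 subr0.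
by rewrite [c^-1 *: (c *: _)]scalerA mulVf// scale1r.
Qed.

Lemma rho1 : rho 1%:M = 1%:M.
Proof. by rewrite /rho mulmx1 DDt scale_scalar_mx mulVf. Qed.

Lemma rho_tr T : (rho T)^T = rho T^T.
Proof. by rewrite /rho linearZ /= !trmx_mul trmxK mulmxA. Qed.

Lemma rhoD T T' : rho (T + T') = rho T + rho T'.
Proof. by rewrite /rho mulmxDr mulmxDl scalerDr. Qed.

Lemma rhoZ a T : rho (a *: T) = a *: rho T.
Proof. by rewrite /rho -scalemxAr -scalemxAl !scalerA mulrC. Qed.

Lemma col_Dt : e0 *m D^T = u^T.
Proof. by rewrite colE trmx_mul trmx_delta. Qed.

Lemma rho_dilation k :
  rho (dilation k) = 1%:M - ((1 - k) * (n%:R + 1) / n%:R / c) *: (u *m u^T).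
Proof.
rewrite /dilation rhoD rho1 rhoZ; congr (_ + _).
rewrite /rho mulmxA D_eta -scalemxAl -scalemxAl -mulmxA col_Dt !scalerA -[RHS]scaleNr.
by congr (_ *: _); field; rewrite n_neq0 c_neq0.
Qed.

Lemma rho_dilation_sym k : (rho (dilation k))^T = rho (dilation k).
Proof.
by rewrite rho_dilation linearB /= linearZ /= trmx1 trmx_mul trmxK.
Qed.

Lemma rho_D T : ones *m T = ones ->
  rho T *m D = D *m T - (n%:R + 1)^-1 *: (D *m T *m ones^T *m ones).
Proof.
move=> T1; rewrite /rho -scalemxAl -mulmxA DtD -scalemxAr scalerA mulVf// scale1r.
by rewrite mulmxBr mulmx1 -scalemxAr !mulmxA.
Qed.

Lemma rho_perm_D (s : {perm 'I_n.+1}) : rho (perm_mx s) *m D = D *m perm_mx s.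
Proof.
rewrite rho_D ?ones_perm// -(mulmxA D) perm_ones D_ones mul0mx scaler0.
by rewrite subr0.
Qed.

Lemma rho_perm_u (s : {perm 'I_n.+1}) : s i0 = i0 -> rho (perm_mx s) *m u = u.
Proof.
move=> si; rewrite colE mulmxA rho_perm_D -mulmxA; congr (_ *m _).
by rewrite -[LHS]trmxK trmx_mul trmx_delta tr_perm_mx e0_perm trmx_delta -{1}si permK.
Qed.

Lemma shifted_eta t : shifted t *m eta = D *m eta.
Proof. by rewrite /shifted mulmxDl -scalemxAl -mulmxA ones_eta mulmx0 scaler0 addr0. Qed.

Lemma Dt_shifted1 : D^T *m shifted 1 =
  c *: (1%:M + n%:R^-1 *: (e0^T *m ones - ones^T *m ones)).
Proof.
have e1 : ones *m e0^T = 1 by rewrite -[LHS]trmxK trmx_mul trmxK e0_ones trmx1.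
have uE : u = D *m e0^T by rewrite trmx_delta -colE.
rewrite /shifted uE mulmxDr -scalemxAr !mulmxA DtD -!scalemxAl scalerA.
rewrite mulmxBl mul1mx -!scalemxAl -(mulmxA ones^T) e1 mulmx1 mulmxBl -scalemxAl.
move: (e0^T *m ones) (ones^T *m ones) => A B.
apply/matrixP => i j; rewrite !mxE.
by field; rewrite n_neq0 nS_neq0.
Qed.

(** The center of the facet opposite to [i0] is fixed by every [dilation]. *)
Lemma rho_dilation_shifted k :
  rho (dilation k) *m shifted 1 = shifted 1 *m dilation k.
Proof.
have uE : u = D *m e0^T by rewrite trmx_delta -colE.
have e00 : e0 *m e0^T = 1.
  by rewrite trmx_delta mul_delta_mx; apply/matrixP => i j; rewrite !ord1 !mxE.
have dE : dilation k *m (e0^T - ones^T) = e0^T - ones^T.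
  rewrite /dilation mulmxDl mul1mx -scalemxAl -(mulmxA eta) mulmxBr e00 e0_ones subrr.
  by rewrite mulmx0 scaler0 addr0.
rewrite /rho -scalemxAl -mulmxA Dt_shifted1 -scalemxAr scalerA mulVf// scale1r.
rewrite mulmxDr mulmx1 -scalemxAr -mulmxBl mulmxA -(mulmxA D) dE.
rewrite mulmxBr D_ones subr0 -uE.
by rewrite /shifted mulmxDl -!scalemxAl -(mulmxA u) ones_dilation div1r.
Qed.

Lemma Dt_u : D^T *m u = c *: (e0^T - (n%:R + 1)^-1 *: ones^T).
Proof.
have e1 : ones *m e0^T = 1 by rewrite -[LHS]trmxK trmx_mul trmxK e0_ones trmx1.
rewrite (colE i0 D) mulmxA DtD -scalemxAl mulmxBl mul1mx -trmx_delta; congr (_ *: (_ - _)).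
by rewrite -scalemxAl -(mulmxA ones^T) e1 mulmx1.
Qed.

Lemma dilation_e0 k : dilation k *m e0^T = e0^T + (1 - k) *: eta.
Proof.
have e00 : e0 *m e0^T = 1.
  by rewrite trmx_delta mul_delta_mx; apply/matrixP => i j; rewrite !ord1 !mxE.
by rewrite /dilation mulmxDl mul1mx -scalemxAl -(mulmxA eta) e00 mulmx1.
Qed.

Lemma dilation_ones k : dilation k *m ones^T = ones^T + (1 - k) *: eta.
Proof. by rewrite /dilation mulmxDl mul1mx -scalemxAl -(mulmxA eta) e0_ones mulmx1. Qed.

(** [rho (dilation k)] is the scaling by [k] along the axis of the facet. *)
Lemma rho_dilation_u k : rho (dilation k) *m u = k *: u.
Proof.
have uE : u = D *m e0^T by rewrite trmx_delta -colE.
rewrite /rho -scalemxAl -mulmxA Dt_u -scalemxAr scalerA mulVf// scale1r.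
rewrite mulmxBr -scalemxAr -!mulmxA dilation_e0 dilation_ones.
rewrite !mulmxDr -!scalemxAr D_eta D_ones -uE.
apply/matrixP => i j; rewrite !mxE.
by field; rewrite n_neq0 nS_neq0.
Qed.

Lemma admissible_shifted t T : admissible t T ->
  rho T *m shifted t = shifted t *m T.
Proof.
case=> [[s si [->|[-> ->]]]|[-> [s ->]]].
- rewrite /shifted mulmxDr rho_perm_D mulmxDl -scalemxAr -scalemxAl mulmxA.
  by rewrite rho_perm_u// -(mulmxA u) ones_perm.
- rewrite rhoM ?ones_dilation// -mulmxA rho_dilation_shifted mulmxA.
  rewrite mulmxA; congr (_ *m _).
  rewrite /shifted mulmxDr rho_perm_D mulmxDl -scalemxAr -scalemxAl mulmxA.
  by rewrite rho_perm_u// -(mulmxA u) ones_perm.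
by rewrite /shifted mul0r !scale0r !addr0 rho_perm_D.
Qed.

(** [shifted t] spans the space, so that a matrix is determined by its effect on
    it; the translation part disappears because [D^T] kills [ones]. *)
Lemma shifted_rho t T h : ones *m T = ones -> h *m shifted t = shifted t *m T ->
  h = rho T.
Proof.
move=> T1 hT; rewrite /rho -(shifted_mul_Dt t T1) -hT -mulmxA shifted_Dt.
by rewrite mul_mx_scalar scalerA mulVf ?scale1r.
Qed.

Lemma rho_perm_orth s : rho (perm_mx s) *m (rho (perm_mx s))^T = 1%:M.
Proof.
by rewrite rho_tr tr_perm_mx -rhoM ?ones_perm// -perm_mxM mulgV perm_mx1 rho1.
Qed.

Lemma rho_orth t T : admissible t T -> rho T *m (rho T)^T = 1%:M.
Proof.
case=> [[s si [->|[_ ->]]]|[_ [s ->]]]; rewrite ?rho_perm_orth//.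
rewrite rhoM ?ones_dilation// trmx_mul mulmxA -(mulmxA (rho (perm_mx s))).
rewrite rho_dilation_sym -rhoM ?ones_dilation// dilationM mulrNN mulr1 dilation1.
by rewrite rho1 mulmx1 rho_perm_orth.
Qed.

Definition sqlen m (v : 'cV[R]_m) : R := (v^T *m v) 0 0.

Lemma sqlen_sum m (v : 'cV[R]_m) : sqlen v = \sum_k v k 0 ^+ 2.
Proof. by rewrite /sqlen mxE; apply: eq_bigr => k _; rewrite mxE expr2. Qed.

Lemma sqlenZ m (v : 'cV[R]_m) a : sqlen (a *: v) = a ^+ 2 * sqlen v.
Proof.
by rewrite !sqlen_sum mulr_sumr; apply: eq_bigr => k _; rewrite mxE exprMn.
Qed.

Lemma sqlen_orth m (h : 'M[R]_m) v : h *m h^T = 1%:M -> sqlen (h *m v) = sqlen v.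
Proof. by move=> /mulmx1C hh; rewrite /sqlen trmx_mul mulmxA -(mulmxA v^T) hh mulmx1. Qed.

Lemma sqlen_D (t : 'cV[R]_n.+1) : sqlen (D *m t) =
  c * (\sum_k t k 0 ^+ 2 - (n%:R + 1)^-1 * (\sum_k t k 0) ^+ 2).
Proof.
rewrite /sqlen trmx_mul mulmxA -(mulmxA t^T) DtD -scalemxAr -scalemxAl mxE.
congr (_ * _); rewrite mulmxBr mulmx1 mulmxBl mxE -/(sqlen t) sqlen_sum.
rewrite [X in _ + X = _]mxE; congr (_ - _).
rewrite -scalemxAr -scalemxAl [LHS]mxE; congr (_ * _).
rewrite mulmxA -(mulmxA (_ *m _)) -trmx_mul [LHS]mxE big_ord1 [X in X * _]mxE.
by rewrite ones_mulmx expr2.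
Qed.

Lemma sqlen_shifted1 (t : 'cV[R]_n.+1) : t i0 0 = 0 -> \sum_k t k 0 = 1 ->
  sqlen (shifted 1 *m t) = c * (\sum_k t k 0 ^+ 2 - n%:R^-1).
Proof.
move=> t0 t1; have ot : ones *m t = 1.
  by apply/matrixP => i j; rewrite !ord1 ones_mulmx t1 mxE.
have e0t : e0 *m t = 0 by rewrite -rowE; apply/matrixP => i j; rewrite !ord1 !mxE.
have uDt : u^T *m (D *m t) = (- c / (n%:R + 1))%:M.
  have -> : u^T *m (D *m t) = (D^T *m u)^T *m t by rewrite trmx_mul trmxK mulmxA.
  rewrite Dt_u linearZ linearB linearZ /= !trmxK -scalemxAl mulmxBl -scalemxAl ot e0t.
  by apply/matrixP => i j; rewrite !ord1 !mxE !eqxx ?mulr1n; field; exact: nS_neq0.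
have uu : u^T *m u = (c * n%:R / (n%:R + 1))%:M.
  have -> : u^T *m u = (D^T *m u)^T *m e0^T.
    by rewrite trmx_mul trmxK -mulmxA trmx_delta -colE.
  rewrite Dt_u linearZ linearB linearZ /= !trmxK -scalemxAl mulmxBl -scalemxAl.
  have -> : ones *m e0^T = 1 by rewrite -[LHS]trmxK trmx_mul trmxK e0_ones trmx1.
  have -> : e0 *m e0^T = 1.
    by rewrite trmx_delta mul_delta_mx; apply/matrixP => i j; rewrite !ord1 !mxE.
  by apply/matrixP => i j; rewrite !ord1 !mxE !eqxx ?mulr1n; field; exact: nS_neq0.
rewrite /shifted mulmxDl -scalemxAl -(mulmxA u) ot mulmx1 /sqlen.
rewrite [(_ + _)^T]linearD /= [(_ *: u)^T]linearZ /= mulmxDl !mulmxDr.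
rewrite -!scalemxAl -!scalemxAr uDt uu.
have -> : (D *m t)^T *m u = (- c / (n%:R + 1))%:M.
  by rewrite -[LHS]trmxK trmx_mul trmxK uDt tr_scalar_mx.
rewrite [LHS]mxE [X in X + _ = _]mxE -/(sqlen _) sqlen_D t1.
rewrite !mxE !eqxx ?mulr1n; field; rewrite n_neq0 nS_neq0//.
Qed.

(** The norm of a point of a regular simplex is an increasing function of the
    sum of the squares of its barycentric coordinates, which is at most 1 with
    equality at the vertices only: an isometry preserving the simplex permutes
    its vertices. *)
Lemma simplex_vertex (t : 'cV[R]_n.+1) : (forall k, 0 <= t k 0) ->
  \sum_k t k 0 = 1 -> \sum_k t k 0 ^+ 2 = 1 -> exists j, t = delta_mx j 0.
Proof.
move=> t0 t1 t2.
have t_le1 k : t k 0 <= 1.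
  by rewrite -t1 (bigD1 k)//= lerDl sumr_ge0.
have t01 k : t k 0 * (1 - t k 0) = 0.
  apply/eqP; have : \sum_k t k 0 * (1 - t k 0) == 0.
    under eq_bigr do rewrite mulrBr mulr1 -expr2.
    by rewrite sumrB t1 t2 subrr.
  rewrite psumr_eq0 => [/allP/(_ k (mem_index_enum k))//|i _].
  by rewrite mulr_ge0// subr_ge0.
have [j tj] : exists j, t j 0 != 0.
  apply/existsP; rewrite -negb_forall; apply/negP => /forallP tz.
  by move: t1; rewrite big1 => [/eqP|k _]; rewrite ?(eqP (tz k))// eq_sym oner_eq0.
have tj1 : t j 0 = 1.
  by move/eqP: (t01 j); rewrite mulf_eq0 (negPf tj) subr_eq0 => /eqP.
exists j; apply/colP => k; rewrite !mxE eqxx andbT; case: eqVneq => [->//|kj].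
have : \sum_(l | l != j) t l 0 == 0.
  by move: t1; rewrite (bigD1 j)//= tj1 => /eqP; rewrite -subr_eq0 addrAC subrr add0r.
rewrite psumr_eq0 => [/allP/(_ k (mem_index_enum k))|i _]; last exact: t0.
by rewrite kj => /eqP.
Qed.

Lemma D_inj (t t' : 'cV[R]_n.+1) : \sum_k t k 0 = 1 -> \sum_k t' k 0 = 1 ->
  D *m t = D *m t' -> t = t'.
Proof.
move=> t1 t'1 DE; apply/eqP; rewrite -subr_eq0; apply/eqP.
have o : ones *m (t - t') = 0.
  by apply/matrixP => i j; rewrite !ord1 ones_mulmx; under eq_bigr do rewrite !mxE;
     rewrite sumrB t1 t'1 subrr mxE.
have : D^T *m (D *m (t - t')) = 0 by rewrite mulmxBr DE subrr mulmx0.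
rewrite mulmxA DtD -scalemxAl mulmxBl mul1mx -scalemxAl -mulmxA o mulmx0 scaler0 subr0.
by move=> /eqP; rewrite scaler_eq0 (negPf c_neq0) => /eqP.
Qed.

Lemma shifted_inj s (t t' : 'cV[R]_n.+1) : \sum_k t k 0 = 1 -> \sum_k t' k 0 = 1 ->
  shifted s *m t = shifted s *m t' -> t = t'.
Proof.
move=> t1 t'1.
have ot (v : 'cV[R]_n.+1) : \sum_k v k 0 = 1 -> ones *m v = 1.
  by move=> v1; apply/matrixP => i j; rewrite !ord1 ones_mulmx v1 mxE.
rewrite /shifted !mulmxDl -!scalemxAl -!(mulmxA u) !ot// => /addIr.
exact: D_inj.
Qed.

Lemma sum_delta (k : 'I_n.+1) : \sum_j (delta_mx k 0 : 'cV[R]_n.+1) j 0 = 1.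
Proof.
rewrite (bigD1 k)//= big1 => [|j /negPf jk]; last by rewrite mxE jk.
by rewrite addr0 mxE !eqxx.
Qed.

Lemma sum_delta2 (k : 'I_n.+1) : \sum_j (delta_mx k 0 : 'cV[R]_n.+1) j 0 ^+ 2 = 1.
Proof.
rewrite (bigD1 k)//= big1 => [|j /negPf jk]; last by rewrite mxE jk expr0n.
by rewrite addr0 mxE !eqxx expr1n.
Qed.

Lemma vertex_permutation (V : 'M[R]_(n, n.+1)) (h : 'M[R]_n) (f : 'I_n.+1 -> 'I_n.+1) :
    h *m h^T = 1%:M ->
    (forall k k', col k V = col k' V -> k = k') ->
    (forall k, h *m col k V = col (f k) V) ->
  exists2 s : {perm 'I_n.+1}, s =1 f & h *m V = V *m perm_mx s^-1.
Proof.
move=> hh Vinj hV; have fI : injective f.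
  move=> k k' fk; apply: Vinj; have := hV k; rewrite fk -hV => /(congr1 (mulmx h^T)).
  by rewrite !mulmxA (mulmx1C hh) !mul1mx.
exists (perm fI); first exact: permE.
rewrite -col_permE; apply/matrixP => i j.
have /colP/(_ i) := hV j; rewrite (colE j) mulmxA -colE 2![LHS]mxE [RHS]mxE => hVij.
by rewrite [RHS]mxE permE -hVij mxE.
Qed.

Lemma col_D_inj k k' : col k D = col k' D -> k = k'.
Proof.
rewrite !colE => /(D_inj (sum_delta k) (sum_delta k'))/colP/(_ k).
by rewrite !mxE !eqxx /= andbT; case: eqVneq => // _ /eqP; rewrite oner_eq0.
Qed.

Lemma DeltaP v : Delta D v <-> exists t : 'cV[R]_n.+1,
  [/\ forall k, 0 <= t k 0, \sum_k t k 0 = 1 & v = D *m t].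
Proof.
split=> [[t [t0 _ t1] <-]|[t [t0 t1 ->]]]; first by exists t.
by exists t => //; split => // i; rewrite inE.
Qed.

Lemma facetP v : facet D i0 v <-> exists t : 'cV[R]_n.+1,
  [/\ forall k, 0 <= t k 0, t i0 0 = 0, \sum_k t k 0 = 1 & v = D *m t].
Proof.
split=> [[t [t0 ti t1] <-]|[t [t0 ti t1 ->]]].
  by exists t; split => //; apply: ti; rewrite !inE eqxx.
by exists t => //; split => // i; rewrite !inE negbK => /eqP->.
Qed.

Lemma shifted1E (t : 'cV[R]_n.+1) : \sum_k t k 0 = 1 ->
  shifted 1 *m t = D *m t - facet_barycenter D i0.
Proof.
move=> t1; have ot : ones *m t = 1.
  by apply/matrixP => i j; rewrite !ord1 ones_mulmx t1 mxE.
rewrite /shifted mulmxDl -scalemxAl -(mulmxA u) ot mulmx1; congr (_ + _).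
have D0 : \sum_k col k D = 0.
  apply/colP => i; rewrite summxE; have /colP/(_ i) := D_ones.
  by rewrite mulmx_ones => <-; apply: eq_bigr => k _; rewrite mxE.
rewrite /facet_barycenter -scalerN div1r; congr (_ *: _).
by move: D0; rewrite (bigD1 i0)//= => /eqP; rewrite addr_eq0 => /eqP.
Qed.

Lemma centered_facetP v : centered_facet D i0 v <-> exists t : 'cV[R]_n.+1,
  [/\ forall k, 0 <= t k 0, t i0 0 = 0, \sum_k t k 0 = 1 & v = shifted 1 *m t].
Proof.
split=> [[w /facetP[t [t0 ti t1 ->]] <-]|[t [t0 ti t1 ->]]].
  by exists t; split => //; rewrite shifted1E.
by exists (D *m t); [apply/facetP; exists t|rewrite shifted1E].
Qed.

Lemma hyperplaneP v : facet_hyperplane D i0 v <-> exists t : 'cV[R]_n.+1,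
  [/\ t i0 0 = 0, \sum_k t k 0 = 0 & v = shifted 1 *m t].
Proof.
have E (t : 'cV[R]_n.+1) : \sum_k t k 0 = 0 -> shifted 1 *m t = D *m t.
  move=> t1; have ot : ones *m t = 0.
    by apply/matrixP => i j; rewrite !ord1 ones_mulmx t1 mxE.
  by rewrite /shifted mulmxDl -scalemxAl -(mulmxA u) ot mulmx0 scaler0 addr0.
split=> [[t [ti t1] <-]|[t [ti t1 ->]]]; first by exists t; rewrite E.
by exists t => //; rewrite E.
Qed.

Lemma alt_simplex_perm h : alt_simplex D h ->
  exists s : {perm 'I_n.+1}, h *m D = D *m perm_mx s.
Proof.
move=> [[hh _] hD].
have vtx k : exists j, h *m col k D = col j D.
  have : Delta D (h *m col k D).
    rewrite -hD; exists (col k D) => //; apply/DeltaP; exists (delta_mx k 0).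
    by split; [move=> j; rewrite mxE ler0n|exact: sum_delta|rewrite colE].
  move=> /DeltaP[t [t0 t1 tE]].
  have := sqlen_orth (col k D) hh; rewrite tE (colE k D) !sqlen_D t1 sum_delta sum_delta2.
  move=> /(mulfI c_neq0)/addIr/(simplex_vertex t0 t1)[j tj].
  by exists j; rewrite tj -colE.
have [f fE] := choice vtx.
have [s _ sE] := vertex_permutation hh col_D_inj fE.
by exists s^-1%g.
Qed.

Lemma alt_facet_perm h : alt_facet D i0 h ->
  exists2 s : {perm 'I_n.+1}, s i0 = i0 & h *m D = D *m perm_mx s.
Proof.
move=> [ah hF]; have [[hh _] _] := ah; have [s hs] := alt_simplex_perm ah.
exists s => //; apply/eqP; apply: contraT => si.
have hk k : h *m col k D = col (s^-1%g k) D.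
  by rewrite (colE k) mulmxA hs -{1}(invgK s) -col_permE -colE; apply/colP => i; rewrite !mxE.
have : facet D i0 (h *m col (s i0) D).
  rewrite -hF; exists (col (s i0) D) => //; apply/facetP; exists (delta_mx (s i0) 0).
  split; [by move=> j; rewrite mxE ler0n| |exact: sum_delta|by rewrite colE].
  by rewrite mxE eq_sym (negPf si).
rewrite hk permK => /facetP[t [t0 ti t1]]; rewrite colE.
move=> /(D_inj (sum_delta _) t1) tE.
by move: ti; rewrite -tE mxE !eqxx => /eqP; rewrite oner_eq0.
Qed.

Lemma Dt_shifted1_u : (shifted 1)^T *m u = c *: e0^T.
Proof.
have uE : u = D *m e0^T by rewrite trmx_delta -colE.
have -> : (shifted 1)^T *m u = (e0 *m (D^T *m shifted 1))^T.
  by rewrite !trmx_mul trmxK uE mulmxA.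
have e00 : e0 *m e0^T = 1.
  by rewrite trmx_delta mul_delta_mx; apply/matrixP => i j; rewrite !ord1 !mxE.
rewrite Dt_shifted1 -scalemxAr mulmxDr mulmx1 -scalemxAr mulmxBr !mulmxA e00 e0_ones.
by rewrite subrr scaler0 addr0 linearZ.
Qed.

Lemma sqlen_u : sqlen u = c * n%:R / (n%:R + 1).
Proof.
rewrite colE sqlen_D sum_delta sum_delta2 expr1n.
by field; exact: nS_neq0.
Qed.

Lemma shifted1_i0 : shifted 1 *m e0^T = (1 + n%:R^-1) *: u.
Proof.
rewrite /shifted mulmxDl -scalemxAl -(mulmxA u) trmx_delta -colE scalerDl scale1r div1r.
rewrite (_ : ones *m _ = 1) ?mulmx1//.
by apply/matrixP => i j; rewrite !ord1 -colE !mxE.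
Qed.

(** A symmetry of the centered facet permutes its vertices, hence preserves the
    line orthogonal to them; on this line, which carries [u], it is the identity
    or the opposite, and the latter is the effect of [dilation (-1)]. *)
Lemma sym_facet_perm h : sym_facet D i0 h ->
  exists T, admissible 1 T /\ h *m shifted 1 = shifted 1 *m T.
Proof.
set V := shifted 1; move=> [[hh _] _ hF].
have vtx k : exists j, if k == i0 then j = i0 else j != i0 /\ h *m col k V = col j V.
  case: eqVneq => [_|ki]; first by exists i0.
  have ek : (delta_mx k 0 : 'cV[R]_n.+1) i0 0 = 0 by rewrite mxE eq_sym (negPf ki).
  have : centered_facet D i0 (h *m col k V).
    rewrite -hF; exists (col k V) => //; apply/centered_facetP; exists (delta_mx k 0).
    by split; [move=> j; rewrite mxE ler0n| |exact: sum_delta|rewrite colE].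
  move=> /centered_facetP[t [t0 ti t1 tE]].
  have := sqlen_orth (col k V) hh; rewrite tE (colE k V) !sqlen_shifted1 ?sum_delta//.
  rewrite sum_delta2 => /(mulfI c_neq0)/addIr/(simplex_vertex t0 t1)[j tj].
  exists j; split; last by rewrite tj -colE.
  by apply: contra_eqN ti => /eqP jE; rewrite tj jE mxE !eqxx oner_eq0.
have [f fE] := choice vtx.
have fi0 : f i0 = i0 by have := fE i0; rewrite eqxx.
have fk k : k != i0 -> f k != i0 /\ h *m col k V = col (f k) V.
  by move=> ki; have := fE k; rewrite (negPf ki).
have Vinj k k' : col k V = col k' V -> k = k'.
  rewrite !colE => /(shifted_inj (sum_delta k) (sum_delta k'))/colP/(_ k).
  by rewrite !mxE !eqxx /= andbT; case: eqVneq => // _ /eqP; rewrite oner_eq0.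
have fI : injective f.
  move=> k k' fkk'; have [k0|k0] := eqVneq k i0; have [k'0|k'0] := eqVneq k' i0.
  - by rewrite k0 k'0.
  - by have [] := fk _ k'0; rewrite -fkk' k0 fi0 eqxx.
  - by have [] := fk _ k0; rewrite fkk' k'0 fi0 eqxx.
  have [_ hk] := fk _ k0; have [_] := fk _ k'0; rewrite -fkk' -hk.
  by move=> /(congr1 (mulmx h^T)); rewrite !mulmxA (mulmx1C hh) !mul1mx => /Vinj.
pose s := perm fI; have si : s i0 = i0 by rewrite permE.
have sVi : s^-1%g i0 = i0 by rewrite -{1}si permK.
set y := h *m u.
(* The image [y] of [u] is orthogonal to the facet, hence a multiple of [u]. *)
have Vy k : k != i0 -> (col k V)^T *m y = 0.
  move=> ki; have kE : k = f (s^-1%g k) by rewrite -[f _]permE permKV.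
  have k'i : s^-1%g k != i0 by rewrite -sVi (inj_eq perm_inj).
  have [_] := fk _ k'i; rewrite -kE => <-.
  rewrite /y trmx_mul mulmxA -(mulmxA _ h^T) (mulmx1C hh) mulmx1.
  rewrite colE trmx_mul trmx_delta -mulmxA Dt_shifted1_u -scalemxAr -rowE.
  by apply/matrixP => i j; rewrite !ord1 !mxE (negPf k'i) andbF mulr0.
set b := (u^T *m y) 0 0; have bE : u^T *m y = b%:M by rewrite [LHS]mx11_scalar.
have VtY : V^T *m y = ((1 + n%:R^-1) * b) *: e0^T.
  apply/colP => k; have -> : (V^T *m y) k 0 = ((col k V)^T *m y) 0 0.
    by rewrite !mxE; apply: eq_bigr => i _; rewrite !mxE.
  have [->|ki] := eqVneq k i0; last by rewrite Vy// !mxE (negPf ki) andbF mulr0.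
  rewrite colE -trmx_delta shifted1_i0 linearZ /= -scalemxAl bE !mxE !eqxx.
  by rewrite mulr1 mulr1n.
have DtY : D^T *m y = b *: ((1 + n%:R^-1) *: e0^T - n%:R^-1 *: ones^T).
  have -> : D = V - n%:R^-1 *: (u *m ones) by rewrite /V /shifted div1r addrK.
  rewrite linearB linearZ /= trmx_mul mulmxBl VtY -scalemxAl -mulmxA bE.
  by rewrite mul_mx_scalar scalerBr !scalerA mulrC [n%:R^-1 * b]mulrC.
pose a := c^-1 * b * (1 + n%:R^-1).
have yE : y = a *: u.
  have : D *m D^T *m y = c *: y by rewrite DDt mul_scalar_mx.
  rewrite -mulmxA DtY -scalemxAr mulmxBr -!scalemxAr D_ones scaler0 subr0.
  rewrite trmx_delta -colE => /(congr1 ( *:%R c^-1)).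
  by rewrite !scalerA mulVf// scale1r => <-.
have u0 : sqlen u != 0.
  by rewrite sqlen_u !mulf_neq0 ?invr_eq0 ?n_neq0 ?nS_neq0.
have a2 : a ^+ 2 = 1.
  have := sqlen_orth u hh; rewrite -/y yE sqlenZ -[RHS]mul1r => /(mulIf u0); exact.
have colV (W : 'M[R]_(n, n.+1)) k : k != i0 ->
    col k W = col (f k) V -> col k W = col k (V *m perm_mx s^-1).
  by move=> ki ->; rewrite -col_permE; apply/colP => i; rewrite !mxE permE.
have hVk k : k != i0 -> col k (h *m V) = col k (V *m perm_mx s^-1).
  by move=> ki; apply: colV => //; have [_ <-] := fk _ ki; rewrite !colE mulmxA.
have hVi : col i0 (h *m V) = a *: ((1 + n%:R^-1) *: u).
  by rewrite colE -mulmxA -trmx_delta shifted1_i0 -scalemxAr -/y yE !scalerA mulrC.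
have Pe : perm_mx s^-1 *m e0^T = e0^T.
  by rewrite -[LHS]trmxK trmx_mul trmxK tr_perm_mx e0_perm invgK si.
have VPi : col i0 (V *m perm_mx s^-1) = (1 + n%:R^-1) *: u.
  by rewrite colE -mulmxA -trmx_delta Pe shifted1_i0.
have mx_col (A B : 'M[R]_(n, n.+1)) : (forall k, col k A = col k B) -> A = B.
  by move=> AB; apply/matrixP => i j; have /colP/(_ i) := AB j; rewrite !mxE.
move/eqP: a2; rewrite sqrf_eq1 => /orP[/eqP a1|/eqP a1].
  exists (perm_mx s^-1); split; first by left; exists s^-1%g => //; left.
  apply: mx_col => k; have [->|ki] := eqVneq k i0; last exact: hVk.
  by rewrite hVi VPi a1 scale1r.
exists (perm_mx s^-1 *m dilation (-1)); split.
  by left; exists s^-1%g => //; right.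
apply: mx_col => k; have [->|ki] := eqVneq k i0.
  rewrite hVi a1 (colE i0 (_ *m _)) mulmxA -[RHS]mulmxA -trmx_delta dilation_e0 mulmxDr -(mulmxA V) Pe.
  rewrite shifted1_i0 -scalemxAr -(mulmxA V) perm_eta// shifted_eta D_eta.
  by rewrite !scalerA -scalerDl; congr (_ *: _); field; exact: n_neq0.
by rewrite mulmxA col_dilation// hVk.
Qed.

(** The rotations that fix the classes in the cylinder at height [t]; they
    are the rotations among the [rho T] with [T] admissible. *)
Definition height_group (t : R) (h : 'M[R]_n) : Prop :=
  [\/ alt_facet D i0 h, t = 0 /\ alt_simplex D h | t = 1 /\ sym_facet D i0 h].

Lemma height_group_SO t h : height_group t h -> SO h.
Proof. by case=> [[[]]|[_ []]|[_ []]]. Qed.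

Lemma height_group_admissible t h : height_group t h ->
  exists T, admissible t T /\ h *m shifted t = shifted t *m T.
Proof.
have D0 : D = shifted 0 by rewrite /shifted mul0r scale0r addr0.
case=> [/alt_facet_perm[s si hD]|[-> /alt_simplex_perm[s hD]]|[-> /sym_facet_perm//]].
  have adm r : admissible r (perm_mx s) by left; exists s => //; left.
  exists (perm_mx s); split => //.
  rewrite D0 in hD; rewrite (shifted_rho (ones_perm s) hD).
  exact: admissible_shifted.
by exists (perm_mx s); split; [right; split => //; exists s|rewrite -D0].
Qed.

Lemma preserves_image (A : set 'cV[R]_n) (S : 'cV[R]_n.+1 -> Prop) W h
    (s : {perm 'I_n.+1}) :
    (forall v, A v <-> exists t, S t /\ v = W *m t) ->
    (forall t, S t -> S (perm_mx s *m t)) -> (forall t, S t -> S (perm_mx s^-1 *m t)) ->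
    (forall t, S t -> h *m (W *m t) = W *m (perm_mx s *m t)) ->
  preserves A h.
Proof.
move=> AP Ss Ss' hS; apply/seteqP; split=> [_ [v /AP[t [St ->]] <-]|v /AP[t [St ->]]].
  by apply/AP; rewrite hS//; eexists; split; last reflexivity; exact: Ss.
exists (W *m (perm_mx s^-1 *m t)); first by apply/AP; eexists; split; last reflexivity; exact: Ss'.
by rewrite hS; [rewrite (mulmxA (perm_mx s)) -perm_mxM mulgV perm_mx1 mul1mx|exact: Ss'].
Qed.

Lemma perm_mx_col (s : {perm 'I_n.+1}) (t : 'cV[R]_n.+1) k :
  (perm_mx s *m t) k 0 = t (s k) 0.
Proof. by rewrite -row_permE mxE. Qed.

Lemma sum_perm_mx (s : {perm 'I_n.+1}) (t : 'cV[R]_n.+1) :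
  \sum_k (perm_mx s *m t) k 0 = \sum_k t k 0.
Proof.
rewrite [RHS](reindex_inj (@perm_inj _ s)).
by apply: eq_bigr => k _; rewrite perm_mx_col.
Qed.

Lemma preserves_centered_facet h (s : {perm 'I_n.+1}) : s i0 = i0 ->
    (forall w : 'cV[R]_n.+1, w i0 0 = 0 ->
       h *m (shifted 1 *m w) = shifted 1 *m (perm_mx s *m w)) ->
  preserves (facet_hyperplane D i0) h /\ preserves (centered_facet D i0) h.
Proof.
move=> si act; have sVi : s^-1%g i0 = i0 by rewrite -{1}si permK.
split.
  apply: (@preserves_image _ (fun t => t i0 0 = 0 /\ \sum_k t k 0 = 0) (shifted 1) _ s).
  - move=> v; rewrite hyperplaneP.
    by split=> [[w [wi w1 ->]]|[w [[wi w1] ->]]]; exists w.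
  - by move=> w [wi w1]; rewrite sum_perm_mx perm_mx_col si.
  - by move=> w [wi w1]; rewrite sum_perm_mx perm_mx_col sVi.
  by move=> w [wi _]; exact: act.
apply: (@preserves_image _ (fun t => [/\ forall k, 0 <= t k 0, t i0 0 = 0 & \sum_k t k 0 = 1])
  (shifted 1) _ s).
- move=> v; rewrite centered_facetP.
  by split=> [[w [w0 wi w1 ->]]|[w [[w0 wi w1] ->]]]; exists w.
- by move=> w [w0 wi w1]; rewrite sum_perm_mx perm_mx_col si; split=> // k; rewrite perm_mx_col.
- by move=> w [w0 wi w1]; rewrite sum_perm_mx perm_mx_col sVi; split=> // k; rewrite perm_mx_col.
by move=> w [_ wi _]; exact: act.
Qed.

Lemma admissible_height_group t T : admissible t T -> \det (rho T) = 1 ->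
  height_group t (rho T).
Proof.
move=> adm dT; have soT : SO (rho T) by split => //; exact: rho_orth adm.
have hDelta s : preserves (Delta D) (rho (perm_mx s)).
  apply: (@preserves_image _ (fun t => (forall k, 0 <= t k 0) /\ \sum_k t k 0 = 1) D _ s).
  - move=> v; rewrite DeltaP.
    by split=> [[w [w0 w1 ->]]|[w [[w0 w1] ->]]]; exists w.
  - by move=> w [w0 w1]; split; [move=> k; rewrite perm_mx_col|rewrite sum_perm_mx].
  - by move=> w [w0 w1]; split; [move=> k; rewrite perm_mx_col|rewrite sum_perm_mx].
  by move=> w _; rewrite mulmxA rho_perm_D mulmxA.
case: adm soT => [[s si [->|[-> ->]]]|[-> [s ->]]] soT.
- constructor 1; split; first by split.
  have sVi : s^-1%g i0 = i0 by rewrite -{1}si permK.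
  apply: (@preserves_image _ (fun t => [/\ forall k, 0 <= t k 0, t i0 0 = 0 & \sum_k t k 0 = 1]) D _ s).
  - move=> v; rewrite facetP.
    by split=> [[w [w0 wi w1 ->]]|[w [[w0 wi w1] ->]]]; exists w.
  - by move=> w [w0 wi w1]; rewrite sum_perm_mx perm_mx_col si; split=> // k; rewrite perm_mx_col.
  - by move=> w [w0 wi w1]; rewrite sum_perm_mx perm_mx_col sVi; split=> // k; rewrite perm_mx_col.
  by move=> w _; rewrite mulmxA rho_perm_D mulmxA.
- constructor 3; split => //.
  have adm1 : admissible 1 (perm_mx s *m dilation (-1)) by left; exists s => //; right.
  have act (w : 'cV[R]_n.+1) : w i0 0 = 0 ->
      rho (perm_mx s *m dilation (-1)) *m (shifted 1 *m w) = shifted 1 *m (perm_mx s *m w).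
    move=> wi; rewrite mulmxA (admissible_shifted adm1) -!mulmxA; congr (_ *m (_ *m _)).
    rewrite /dilation mulmxDl mul1mx -scalemxAl -mulmxA (_ : e0 *m w = 0).
      by rewrite mulmx0 scaler0 addr0.
    by rewrite -rowE; apply/matrixP => i j; rewrite !ord1 !mxE.
  by have [] := preserves_centered_facet si act.
by constructor 2; split => //; split.
Qed.

Lemma alt_facet_simplex : alt_facet D i0 `<=` alt_simplex D.
Proof. by move=> h []. Qed.

Lemma alt_facet_sym_facet : alt_facet D i0 `<=` sym_facet D i0.
Proof.
move=> h hF; have [s si hD] := alt_facet_perm hF.
have [[[_ h1] _] _] := hF.
have hE : h = rho (perm_mx s).
  by apply: (shifted_rho (t := 0) (ones_perm s)); rewrite /shifted mul0r !scale0r !addr0.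
have [] := preserves_centered_facet (h := h) si; last by split => //; case: hF => [[]].
move=> w _; rewrite hE mulmxA (admissible_shifted (t := 1)) ?mulmxA//.
by left; exists s => //; left.
Qed.

End Simplex.
Lemma trace_sq_eq0 m (A : 'M[R]_m) : \tr (A *m A^T) = 0 -> A = 0.
Proof.
have sq i : (A *m A^T) i i = \sum_j A i j ^+ 2.
  by rewrite mxE; apply: eq_bigr => j _; rewrite mxE expr2.
rewrite /mxtrace; under eq_bigr do rewrite sq.
move/eqP; rewrite psumr_eq0 => [/allP A0|i _]; last by rewrite sumr_ge0// => j _; exact: sqr_ge0.
apply/matrixP => i j; have := A0 i (mem_index_enum i).
rewrite /= psumr_eq0 => [/allP/(_ j (mem_index_enum j))/=|k _]; last exact: sqr_ge0.
by rewrite sqrf_eq0 mxE => /eqP.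
Qed.

(** Since the columns of [D] sum to zero, their distances determine their scalar
    products, that is, [D^T *m D]. This matrix is a multiple of a projection of
    rank [n], which forces the [n] by [n] matrix [D *m D^T] to be scalar. *)
Lemma regular_simplex_gram (D : 'M[R]_(n, n.+1)) : centered_regular_simplex D ->
  exists2 c : R, 0 < c & [/\ D *m ones^T = 0, D *m D^T = c%:M &
    D^T *m D = c *: (1%:M - (n%:R + 1)^-1 *: (ones^T *m ones))].
Proof.
move=> [Dsum [l l0 dist]].
have D1 : D *m ones^T = 0.
  apply/colP => i; have /colP/(_ i) := Dsum; rewrite summxE mulmx_ones => <-.
  by apply: eq_bigr => k _; rewrite mxE.
pose c := l ^+ 2 / 2; have c0 : 0 < c by rewrite divr_gt0// exprn_gt0.
have nS := nS_neq0.
pose G := D^T *m D.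
have Gdist i j : G i i + G j j - 2 * G i j = if i == j then 0 else l ^+ 2.
  have -> : G i i + G j j - 2 * G i j = \sum_k (D k i - D k j) ^+ 2.
    rewrite /G !mxE -big_split /= mulr_sumr -sumrB; apply: eq_bigr => k _.
    by rewrite !mxE; ring.
  by case: eqVneq => [->|/dist//]; rewrite big1// => k _; rewrite subrr expr0n.
have Grow i : \sum_j G i j = 0.
  by rewrite -mulmx_ones /G -mulmxA D1 mulmx0 mxE.
have sumc (x : R) : \sum_(i < n.+1) x = (n%:R + 1) * x.
  by rewrite sumr_const card_ord natr1 -[LHS]mulr_natl.
have Gii i : (n%:R + 1) * G i i + \sum_j G j j = n%:R * l ^+ 2.
  have : \sum_j (G i i + G j j - 2 * G i j) = n%:R * l ^+ 2.
    under eq_bigr do rewrite Gdist.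
    rewrite (bigD1 i)//= eqxx add0r (eq_bigr (fun=> l ^+ 2)) => [|j /negPf ji].
      by rewrite sumr_const cardC1 card_ord /= -[LHS]mulr_natl.
    by rewrite eq_sym ji.
  by rewrite sumrB big_split /= -mulr_sumr Grow mulr0 subr0 sumc.
have trG : \sum_j G j j = c * n%:R.
  have : \sum_i ((n%:R + 1) * G i i + \sum_j G j j) = \sum_(i < n.+1) n%:R * l ^+ 2.
    by apply: eq_bigr => i _; rewrite Gii.
  rewrite big_split /= -mulr_sumr !sumc => E.
  have {}E : (n%:R + 1) * (2 * \sum_j G j j) = (n%:R + 1) * (n%:R * l ^+ 2).
    by rewrite -E; ring.
  by move/(mulfI nS): E; rewrite /c => E; lra.
have GE : G = c *: (1%:M - (n%:R + 1)^-1 *: (ones^T *m ones)).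
  have Gd i : G i i = c * n%:R / (n%:R + 1).
    have := Gii i; rewrite trG => E.
    apply: (mulfI nS); rewrite mulrCA divff// mulr1.
    by move: E; rewrite /c; lra.
  have JE i j : (ones^T *m ones) i j = 1 by rewrite mxE big_ord1 !mxE mulr1.
  apply/matrixP => i j; transitivity (c * ((i == j)%:R - (n%:R + 1)^-1)); last first.
    move: (ones^T *m ones) JE => J JE.
    by rewrite !mxE JE mulr1.
  case: eqVneq => [->|ij]; first by rewrite Gd mulr1n; field.
  have := Gdist i j; rewrite (negPf ij) !Gd => E.
  have {}E : G i j = c * n%:R / (n%:R + 1) - c.
    have c2 : l ^+ 2 = 2 * c by rewrite /c; field.
    by move: E; rewrite c2; lra.
  by rewrite E mulr0n; field.
exists c => //; split => //.
(* [E] is symmetric and proportional to its square, with trace zero. *)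
pose E := D *m D^T - c%:M.
have ED : E *m D = 0.
  rewrite /E mulmxBl -mulmxA -/G GE -scalemxAr mulmxBr mulmx1 -scalemxAr mulmxA D1.
  by rewrite mul0mx scaler0 subr0 mul_scalar_mx subrr.
have EE : E *m E = - c *: E.
  by rewrite {2}/E mulmxBr mulmxA ED mul0mx sub0r mul_mx_scalar scaleNr.
have Es : E^T = E by rewrite /E linearB /= trmx_mul trmxK tr_scalar_mx.
have trE : \tr E = 0.
  by rewrite /E linearB /= mxtrace_mulC mxtrace_scalar /mxtrace -/G trG mulr_natr subrr.
have : \tr (E *m E^T) = 0 by rewrite Es EE linearZ /= trE mulr0.
by move=> /trace_sq_eq0 E0; apply/eqP; rewrite -subr_eq0 -/E E0.
Qed.

End SimplexAlgebra.

(** * Affine dependencies and embeddings of skeleta *)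

Section Criterion.
Variables (R : realType) (n N : nat).
Hypothesis n_gt2 : (2 < n)%N.
Local Notation X := (skeleton (n - 2) (full_simplex 'I_N)).
Local Notation ones := (const_mx 1 : 'rV[R]_N).

Definition pos_part_set (l : 'cV[R]_N) : {set 'I_N} := [set i | 0 < l i 0]%SET.
Definition neg_part_set (l : 'cV[R]_N) : {set 'I_N} := [set i | l i 0 < 0]%SET.

Definition affine_dependency (x : 'M[R]_(n, N)) (l : 'cV[R]_N) : Prop :=
  x *m l = 0 /\ ones *m l = 0.

Lemma skeleton_faceP (s : {set 'I_N}) :
  s \in faces X = (s != finset.set0) && (#|s| < n)%N.
Proof.
rewrite !inE; congr andb.
by case: n n_gt2 => [|[|[|k]]] //= _; rewrite subn2.
Qed.

Lemma skeleton_aut (p : {perm 'I_N}) : p \in simplicial_aut X.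
Proof.
rewrite inE; apply/forallP => s; rewrite !skeleton_faceP card_imset; last exact: perm_inj.
by rewrite imset_eq0.
Qed.

(** [affine_on] only speaks of pairs of points; the general case splits off one
    vertex at a time. *)
Lemma affine_barycenter (s : {set 'I_N}) (f : 'cV[R]_N -> 'cV[R]_n) (t : 'cV[R]_N) :
  affine_on (@geom_simplex R N s) f -> @geom_simplex R N s t ->
  f t = \sum_i t i 0 *: f (delta_mx i 0).
Proof.
move=> fA; have [k] := ubnP #|[set i | t i 0 != 0]%SET|.
elim: k t => // k IHk t; rewrite ltnS => tk [t0 ts t1].
have [i ti] : exists i, t i 0 != 0.
  apply/existsP; rewrite -negb_forall; apply/negP => /forallP tz.
  move/eqP: t1; rewrite big1 ?(eq_sym 0) ?oner_eq0// => j _.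
  by apply/eqP; exact: tz.
have i_s : i \in s by apply: contraNT ti => /ts ->.
have t_le1 : t i 0 <= 1 by rewrite -t1 (bigD1 i)//= lerDl sumr_ge0.
have di : @geom_simplex R N s (delta_mx i 0).
  split=> [j|j js|]; first by rewrite mxE ler0n.
    by rewrite mxE; case: eqVneq js => // ->; rewrite i_s.
  by rewrite (bigD1 i)//= big1 ?mxE ?eqxx ?addr0// => j /negPf ji; rewrite mxE ji.
have [ti1|ti1] := eqVneq (t i 0) 1.
  have tE : t = delta_mx i 0.
    apply/colP => j; rewrite mxE eqxx andbT; case: eqVneq => [->//|ji].
    have : \sum_(l | l != i) t l 0 == 0.
      by move: t1; rewrite (bigD1 i)//= ti1 => /eqP; rewrite -subr_eq0 addrAC subrr add0r.
    rewrite psumr_eq0 => [/allP/(_ j (mem_index_enum j))|l _]; last exact: t0.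
    by rewrite ji => /eqP.
  rewrite [in RHS](bigD1 i)//= ti1 scale1r big1 ?addr0 -?tE// => j ji.
  by rewrite tE mxE (negPf ji) scale0r.
have ti1' : 1 - t i 0 != 0 by rewrite subr_eq0 eq_sym.
pose t' := (1 - t i 0)^-1 *: (t - t i 0 *: delta_mx i 0).
have t'E j : t' j 0 = if j == i then 0 else t j 0 / (1 - t i 0).
  rewrite !mxE eqxx andbT; case: eqVneq => [->|_]; first by rewrite mulr1 subrr mulr0.
  by rewrite mulr0 subr0 mulrC.
have t's : @geom_simplex R N s t'.
  split=> [j|j js|].
  - by rewrite t'E; case: ifP => // _; rewrite divr_ge0// subr_ge0.
  - by rewrite t'E; case: ifP => // _; rewrite ts ?mul0r.
  rewrite (bigD1 i)//= t'E eqxx add0r.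
  rewrite (eq_bigr (fun j => t j 0 / (1 - t i 0))) => [|j /negPf ji]; last by rewrite t'E ji.
  rewrite -mulr_suml; apply: (mulIf ti1'); rewrite mul1r divfK//.
  by have := t1; rewrite (bigD1 i)//= => <-; rewrite addrAC subrr add0r.
have tE : t = t i 0 *: delta_mx i 0 + (1 - t i 0) *: t'.
  by rewrite /t' scalerA divff// scale1r addrC subrK.
rewrite {1}tE fA ?t0// (IHk t')//; last first.
  apply: leq_trans tk; apply: proper_card; apply/properP; split.
    apply/fintype.subsetP => j; rewrite !inE t'E; case: ifP => [_|_]; first by rewrite eqxx.
    by rewrite mulf_eq0 negb_or => /andP[].
  by exists i; rewrite !inE ?t'E ?eqxx.
rewrite scaler_sumr [in LHS](bigD1 i)//= [in RHS](bigD1 i)//=; congr (_ + _).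
rewrite t'E eqxx scale0r scaler0 add0r; apply: eq_bigr => j /negPf ji.
by rewrite t'E ji scalerA mulrCA divff// mulr1.
Qed.

(** Two disjoint faces of a linear image meet exactly when there is an affine
    dependency whose positive and negative parts are supported on them. *)
Lemma embedding_criterion (x : 'M[R]_(n, N)) :
  embedding_space X x <->
  (forall l, affine_dependency x l -> l != 0 ->
     (n <= #|pos_part_set l|)%N \/ (n <= #|neg_part_set l|)%N).
Proof.
split=> [[f [fA finj] fx] l [xl ol] l0|crit]; last first.
  exists (mulmx x); last by move=> i; rewrite colE.
  split=> [s _ a t v _ _ _|t v]; first by rewrite mulmxDr -!scalemxAr.
  move=> /set_mem[s sX [t0 ts t1]] /set_mem[s' s'X [v0 vs v1]] xtv.
  apply/eqP; rewrite -subr_eq0; apply/negPn/negP => tv0.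
  have dep : affine_dependency x (t - v).
    split; first by rewrite mulmxBr xtv subrr.
    apply/matrixP => i j; rewrite !ord1 !mxE.
    under eq_bigr do rewrite !mxE mul1r.
    by rewrite sumrB t1 v1 subrr.
  move: sX s'X; rewrite !skeleton_faceP => /andP[_ sn] /andP[_ s'n].
  have supp (r : {set 'I_N}) (w w' : 'cV[R]_N) i : (forall j, 0 <= w' j 0) ->
      (forall j, j \notin r -> w j 0 = 0) -> 0 < w i 0 - w' i 0 -> i \in r.
    move=> w'0 wr; apply: contraTT => ir.
    by rewrite wr// sub0r -leNgt oppr_le0.
  have pos_s : (#|pos_part_set (t - v)| <= #|s|)%N.
    apply/subset_leq_card/fintype.subsetP => i; rewrite inE !mxE.
    exact: supp v0 ts.
  have neg_s : (#|neg_part_set (t - v)| <= #|s'|)%N.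
    apply/subset_leq_card/fintype.subsetP => i; rewrite inE !mxE -oppr_gt0 opprB.
    exact: supp t0 vs.
  by case: (crit _ dep tv0) => le_n; [have := leq_trans le_n pos_s|have := leq_trans le_n neg_s];
    rewrite leqNgt ?sn ?s'n.
have suml : \sum_i l i 0 = 0.
  by have /matrixP/(_ 0 0) := ol; rewrite !mxE; under eq_bigr do rewrite mxE mul1r.
(* The normalized positive and negative parts of [l] have the same image. *)
pose p i := Num.max 0 (l i 0); pose m i := Num.max 0 (- l i 0).
have p0 i : 0 <= p i by rewrite le_max lexx.
have m0 i : 0 <= m i by rewrite le_max lexx.
have pm i : p i - m i = l i 0.
  rewrite /p /m; have [li|li] := leP 0 (l i 0).
    by rewrite max_l ?subr0// oppr_le0.
  by rewrite max_r ?sub0r ?opprK// oppr_ge0 ltW.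
have Spm : \sum_i p i = \sum_i m i.
  apply/eqP; rewrite -subr_eq0 -sumrB.
  by under eq_bigr do rewrite pm; rewrite suml.
have S0 : \sum_i p i != 0.
  apply: contra l0 => Sz; have Sz' := Sz; rewrite Spm in Sz'.
  rewrite psumr_eq0 in Sz => //; rewrite psumr_eq0 in Sz' => //.
  apply/eqP/colP => i; rewrite mxE -pm.
  have /eqP -> := allP Sz i (mem_index_enum i); have /eqP -> := allP Sz' i (mem_index_enum i).
  by rewrite subrr.
set S := \sum_i p i in S0 Spm; have Sgt0 : 0 < S.
  by rewrite lt_neqAle eq_sym S0 sumr_ge0.
apply/orP; rewrite -[X in X || _]negbK -[X in _ || X]negbK -negb_and -!ltnNge.
apply/negP => /andP[pn mn].
pose t : 'cV[R]_N := \col_i (p i / S); pose v : 'cV[R]_N := \col_i (m i / S).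
have tg : @geom_simplex R N (pos_part_set l) t.
  split=> [i|i|]; first by rewrite mxE divr_ge0// ltW.
    by rewrite inE -leNgt => li; rewrite mxE /p max_l// mul0r.
  by under eq_bigr do rewrite mxE; rewrite -mulr_suml divff.
have vg : @geom_simplex R N (neg_part_set l) v.
  split=> [i|i|]; first by rewrite mxE divr_ge0// ltW.
    by rewrite inE -leNgt => li; rewrite mxE /m max_l ?mul0r// oppr_le0.
  by under eq_bigr do rewrite mxE; rewrite -mulr_suml -Spm divff.
have nonempty (r : {set 'I_N}) (w : 'cV[R]_N) : @geom_simplex R N r w -> r != finset.set0.
  move=> [_ wr w1]; apply/eqP => r0; move: w1; rewrite big1 => [/eqP|i _].
    by rewrite eq_sym oner_eq0.
  by rewrite wr// r0 inE.
have pX : pos_part_set l \in faces X by rewrite skeleton_faceP pn (nonempty _ t).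
have mX : neg_part_set l \in faces X by rewrite skeleton_faceP mn (nonempty _ v).
have fE (w : 'cV[R]_N) r : r \in faces X -> @geom_simplex R N r w -> f w = x *m w.
  move=> rX rw; rewrite (affine_barycenter (fA _ rX) rw).
  apply/colP => i; rewrite summxE mxE; apply: eq_bigr => j _.
  by rewrite fx !mxE mulrC.
have tv : t - v = S^-1 *: l.
  by apply/colP => i; rewrite !mxE -pm mulrBr ![_ / S]mulrC.
have tE : t = v.
  apply: finj; [by apply/mem_set; exists (pos_part_set l)|by apply/mem_set; exists (neg_part_set l)|].
  rewrite (fE _ _ pX tg) (fE _ _ mX vg); apply/eqP; rewrite -subr_eq0 -mulmxBr tv.
  by rewrite -scalemxAr xl scaler0.
move/eqP: l0; apply; apply/eqP.
have : S^-1 *: l == 0 by rewrite -tv tE subrr.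
by rewrite scaler_eq0 invr_eq0 (negPf S0).
Qed.

Lemma embedding_perm (x : 'M[R]_(n, N)) (p : {perm 'I_N}) :
  embedding_space X x -> embedding_space X (x *m perm_mx p).
Proof.
rewrite !embedding_criterion => crit l [xl ol] l0.
have lE i : (perm_mx p *m l) i 0 = l (p i) 0 by rewrite -row_permE mxE.
have dep : affine_dependency x (perm_mx p *m l).
  split; first by rewrite mulmxA.
  apply/matrixP => i j; rewrite !ord1 -[RHS](congr1 (fun M : 'M[R]_1 => M 0 0) ol) !mxE.
  rewrite [RHS](reindex_inj (@perm_inj _ p)).
  by apply: eq_bigr => k _; rewrite lE !mxE.
have [|h|h] := crit _ dep.
- apply: contra l0 => /eqP pl0; apply/eqP/colP => i.
  by rewrite -[i](permKV p) -lE pl0 !mxE.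
- left; apply: leq_trans h _; rewrite -(card_imset _ (@perm_inj _ p)).
  apply/subset_leq_card/fintype.subsetP => _ /imsetP[i + ->]; rewrite !inE lE; exact.
right; apply: leq_trans h _; rewrite -(card_imset _ (@perm_inj _ p)).
by apply/subset_leq_card/fintype.subsetP => _ /imsetP[i + ->]; rewrite !inE lE; exact.
Qed.

End Criterion.

(** * A criterion for a configuration space to be the rotation cylinder *)

Section TotalMaps.
Variables (T : topologicalType) (A : set T) (a0 : set_type A).

(** [a0] is only a value for the arguments outside of [A]: formulas can then be
    written in the ambient space. *)
Definition to_elt (x : T) : set_type A :=
  if pselect (A x) is left Ax then exist (fun y => y \in A) x (mem_set Ax) else a0.

Lemma to_eltK x : A x -> set_val (to_elt x) = x.
Proof. by rewrite /to_elt; case: pselect. Qed.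

Lemma set_valK (v : set_type A) : to_elt (set_val v) = v.
Proof. by apply: val_inj; apply: to_eltK; exact: set_valP. Qed.

Lemma to_elt_continuous (S : topologicalType) (F : S -> T) :
  (forall s, A (F s)) -> continuous F -> continuous (fun s => to_elt (F s)).
Proof.
move=> AF cF; apply: continuous_set_type.
by rewrite (_ : (fun _ => _) = F)//; apply/funext => s; rewrite to_eltK.
Qed.

End TotalMaps.

Section ConfigurationSpace.
Variables (R : realType) (n N : nat).
Variable X : simplicial_complex 'I_N.
Hypothesis autX : forall p, p \in simplicial_aut X.
Local Notation E := (@embedding_space R n N X).
Hypothesis E_perm : forall x (p : {perm 'I_N}), E x -> E (x *m perm_mx p).
Variable x0 : set_type E.
Local Notation C := (@configuration_space R n N X).

Definition config (x : 'M[R]_(n, N)) : C :=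
  quotient_proj (@relabeling R n N X) (to_elt x0 x).

Lemma config_perm x (p : {perm 'I_N}) : E x -> config (x *m perm_mx p) = config x.
Proof.
move=> Ex; apply/esym/quotient_projP; apply: rst_step.
exists p^-1%g => //; rewrite -!set_valE !to_eltK//; last exact: E_perm.
by rewrite col_permE invgK.
Qed.

Lemma config_eq x y : E x -> E y -> config x = config y ->
  exists p : {perm 'I_N}, y = x *m perm_mx p.
Proof.
move=> Ex Ey /quotient_projP; rewrite -{2}(to_eltK x0 Ex) -{2}(to_eltK x0 Ey).
elim=> [v w [p _ vw]|v|v w _ [p ->]|v w z _ [p ->] _ [q ->]].
- by exists p^-1%g; rewrite set_valE vw col_permE.
- by exists 1%g; rewrite perm_mx1 mulmx1.
- by exists p^-1%g; rewrite -mulmxA -perm_mxM mulgV perm_mx1 mulmx1.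
by exists (p * q)%g; rewrite perm_mxM mulmxA.
Qed.

Lemma config_continuous (S : topologicalType) (F : S -> 'M[R]_(n, N)) :
  (forall s, E (F s)) -> continuous F -> continuous (fun s => config (F s)).
Proof.
move=> EF cF; have [cq _ _] := quotient_proj_map (@relabeling R n N X).
by apply: continuous_compose cq; exact: to_elt_continuous.
Qed.

Lemma mulmxr_continuous m p q (B : 'M[R]_(p, q)) :
  continuous (fun x : 'M[R]_(m, p) => x *m B).
Proof.
move=> x; apply: (@cvg_mulmx _ _ (nbhs x) _ _ _ _ id (fun=> B)) => //.
exact: cvg_cstmx.
Qed.

(** A closed set meeting every orbit of the relabelings carries the whole
    quotient topology, because there are finitely many relabelings. *)
Lemma config_domain_map (Cl : set 'M[R]_(n, N)) : closed Cl ->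
    (forall x, E x -> exists p : {perm 'I_N}, Cl (x *m perm_mx p)) ->
  quotient_map (fun v : set_type (E `&` Cl) => config (set_val v)).
Proof.
move=> Clc cover; split.
- apply: config_continuous => [v|]; first by have [] := set_valP v.
  exact: set_val_continuous.
- move=> y; rewrite -(quotient_reprK y); set x := quotient_repr y.
  have Ex : E (set_val x) by exact: set_valP.
  have [p Clp] := cover _ Ex.
  have Up : (E `&` Cl) (set_val x *m perm_mx p) by split => //; exact: E_perm.
  exists (exist (fun y => y \in (E `&` Cl)) _ (mem_set Up)).
  by rewrite [LHS](config_perm p Ex) /config set_valK.
move=> V [W oW WV]; have [_ _] := quotient_proj_map (@relabeling R n N X); apply.
(* The complement is the union of finitely many closed sets, one for each
   relabeling that may be needed to reach the domain. *)
rewrite -[X in open X]setCK; apply: closed_openC.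
have -> : ~` (quotient_proj (@relabeling R n N X) @^-1` V) =
    \bigcup_(p in [set: {perm 'I_N}])
      (fun x : set_type E => set_val x *m perm_mx p) @^-1` (Cl `&` ~` W).
  apply/seteqP; split=> [x|x [p _ [Clp nWp]]] /= xV.
    have Ex : E (set_val x) by exact: set_valP.
    have [p Clp] := cover _ Ex; exists p => //; split => // Wp; apply: xV.
    have Up : (E `&` Cl) (set_val x *m perm_mx p) by split => //; exact: E_perm.
    have : (set_val @^-1` W) (exist (fun y => y \in (E `&` Cl)) _ (mem_set Up)) by [].
    rewrite WV /=.
    by rewrite [config _](config_perm p Ex) /config set_valK.
  have Ex : E (set_val x) by exact: set_valP.
  apply: nWp; have Up : (E `&` Cl) (set_val x *m perm_mx p) by split => //; exact: E_perm.
  suff : (set_val @^-1` W) (exist (fun y => y \in (E `&` Cl)) _ (mem_set Up)) by [].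
  rewrite WV /=.
  by rewrite [config _](config_perm p Ex) /config set_valK.
apply: closed_bigcup => [|p _]; first exact: finite_finset.
have cp : continuous (fun x : set_type E => set_val x *m perm_mx p).
  by apply: continuous_compose (@mulmxr_continuous _ _ _ _); exact: set_val_continuous.
apply: ((continuous_closedP _).1 cp); apply: closedI => //.
exact: open_closedC.
Qed.

End ConfigurationSpace.

Section Classification.
Variables (R : realType) (n N : nat).
Hypothesis n_gt0 : (0 < n)%N.
Variables (i0 : 'I_n.+1) (c : R) (D : 'M[R]_(n, n.+1)).
Local Notation ones := (const_mx 1 : 'rV[R]_n.+1).
Hypothesis c_gt0 : 0 < c.
Hypothesis D_ones : D *m ones^T = 0.
Hypothesis DDt : D *m D^T = c%:M.
Hypothesis DtD : D^T *m D = c *: (1%:M - (n%:R + 1)^-1 *: (ones^T *m ones)).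

Variable X : simplicial_complex 'I_N.
Hypothesis autX : forall p, p \in simplicial_aut X.
Local Notation E := (@embedding_space R n N X).
Hypothesis E_perm : forall x (p : {perm 'I_N}), E x -> E (x *m perm_mx p).

Local Notation I := (@unit_interval R).
Local Notation dil := (@dilation R n i0).
Local Notation adm := (@admissible R n i0).
Local Notation shift := (shifted i0 D).
Local Notation rhoD := (rho c D).
Local Notation cyl := (rotation_cylinder D i0).

Lemma mul_Dt_rho (z : 'M[R]_(n, n.+1)) (T : 'M[R]_n.+1) : ones *m T = ones ->
  z *m T *m D^T = z *m D^T *m rhoD T.
Proof.
move=> T1; rewrite /rho -scalemxAr -!mulmxA (mulmxA D^T) DtD -scalemxAl -scalemxAr scalerA.
rewrite mulVf ?gt_eqF// scale1r mulmxBl mul1mx -scalemxAl -(mulmxA ones^T) (mulmxA ones).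
by rewrite T1 (ones_Dt D_ones) mulmx0 scaler0 subr0.
Qed.

Lemma mulmx_comb m p q (a b : R) (y z : 'M[R]_(m, p)) (T : 'M[R]_(p, q)) :
  (a *: y + b *: z) *m T = a *: (y *m T) + b *: (z *m T).
Proof. by rewrite mulmxDl -!scalemxAl. Qed.

Lemma orth_det_gt0 (h : 'M[R]_n) : h *m h^T = 1%:M -> 0 < \det h -> \det h = 1.
Proof.
move=> /(congr1 determinant); rewrite det_mulmx det_tr det1 => /eqP.
rewrite -expr2 sqrf_eq1 => /orP[/eqP//|/eqP ->].
by rewrite ltr0N1.
Qed.

(** The dilation by [k] is the square of the dilation by the root of [k]. *)
Lemma det_rho_dilation_gt0 (k : R) : 0 < k -> 0 < \det (rhoD (dil k)).
Proof.
move=> k0; have s0 : 0 < Num.sqrt k by rewrite sqrtr_gt0.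
have ss : Num.sqrt k * Num.sqrt k = k by rewrite -expr2 sqr_sqrtr// ltW.
have dM := rhoM c_gt0 D_ones DtD; have od := @ones_dilation R n n_gt0 i0.
rewrite -ss -dilationM dM// det_mulmx -expr2 lt_neqAle sqr_ge0 andbT eq_sym sqrf_eq0.
apply/eqP => d0; have /(congr1 determinant) := dM (dil (Num.sqrt k)) (dil (Num.sqrt k)^-1) (od _).
rewrite dilationM divff ?gt_eqF// dilation1 (rho1 c_gt0 DDt) det1 det_mulmx d0 mul0r.
by move/eqP; rewrite oner_eq0.
Qed.

Lemma SO1 : @SO R n 1%:M.
Proof. by split; rewrite ?trmx1 ?mulmx1// det1. Qed.

Definition cyl_point (q : 'M[R]_n) (t : R) : cyl :=
  cylinder_point (alt_facet D i0) (alt_simplex D) (sym_facet D i0)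
    (to_elt (exist (fun y => y \in @SO R n) _ (mem_set SO1)) q, to_elt (I0 R) t).

Let HHl : alt_facet D i0 `<=` alt_simplex D := @alt_facet_simplex _ _ _ _.
Let HHr : alt_facet D i0 `<=` sym_facet D i0 :=
  alt_facet_sym_facet n_gt0 c_gt0 D_ones DDt DtD.

Lemma SO_mul q h : @SO R n q -> SO h -> SO (q *m h).
Proof.
move=> [qq q1] [hh h1]; split; last by rewrite det_mulmx q1 h1 mulr1.
by rewrite trmx_mul mulmxA -(mulmxA q) hh mulmx1.
Qed.

Lemma SO_unit q : @SO R n q -> q \in unitmx.
Proof. by move=> [_ q1]; rewrite unitmxE q1 unitr1. Qed.

Lemma cyl_pointK p :
  cyl_point (set_val p.1) (set_val p.2) = cylinder_point _ _ _ p :> cyl.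
Proof. by rewrite /cyl_point !set_valK; case: p. Qed.

Lemma cyl_point_group q (t : R) h : SO q -> 0 <= t <= 1 -> height_group i0 D t h ->
  cyl_point (q *m h) t = cyl_point q t.
Proof.
move=> soq t01 hh; have soh := height_group_SO hh; have soqh := SO_mul soq soh.
have tI : @unit_interval R t by rewrite /unit_interval/= in_itv.
set a0 := exist (fun y => y \in @SO R n) _ (mem_set SO1).
have coset A : A h -> quotient_proj (@same_coset R n A) (to_elt a0 (q *m h)) =
    quotient_proj (@same_coset R n A) (to_elt a0 q).
  move=> Ah; apply/esym/quotient_projP; apply: rst_step.
  rewrite /same_coset -!set_valE !to_eltK// mulmxA mulVmx ?mul1mx//.
  exact: SO_unit.
have t0E : to_elt (I0 R) 0 = I0 R.
  by apply: val_inj; rewrite -set_valE to_eltK// /unit_interval/= in_itv/= lexx ler01.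
have t1E : to_elt (I0 R) 1 = I1 R.
  by apply: val_inj; rewrite -set_valE to_eltK// /unit_interval/= in_itv/= lexx ler01.
rewrite /cyl_point -/a0; case: hh => [hF|[t0 hS]|[t1 hF]].
- by congr quotient_proj; congr (cylinder_mid _ _ _ _); exact: coset.
- by rewrite t0 t0E !(cylinder_point0 _ HHl) coset.
by rewrite t1 t1E !(cylinder_point1 _ HHr) coset.
Qed.

Lemma cyl_point_eq (Y : Type) (G : 'M[R]_n -> R -> Y) :
    (forall q (t : R) h, SO q -> 0 <= t <= 1 -> height_group i0 D t h ->
       G (q *m h) t = G q t) ->
  forall p p' : set_type (@SO R n) * I,
    cylinder_point (alt_facet D i0) (alt_simplex D) (sym_facet D i0) p =
    cylinder_point (alt_facet D i0) (alt_simplex D) (sym_facet D i0) p' ->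
  G (set_val p.1) (set_val p.2) = G (set_val p'.1) (set_val p'.2).
Proof.
move=> GG; apply: (cylinder_point_eq HHl HHr (G := fun p => G (set_val p.1) (set_val p.2))).
- move=> q q' t qq' /=; have := GG (set_val q) (set_val t) (invmx (val q) *m val q').
  rewrite mulmxA mulmxV ?mul1mx; last exact: SO_unit (set_valP q).
  move=> <- //; [exact: set_valP|exact: unit_intervalP|by constructor 1].
- move=> q q' qq' /=; have := GG (set_val q) (set_val (I0 R)) (invmx (val q) *m val q').
  rewrite mulmxA mulmxV ?mul1mx; last exact: SO_unit (set_valP q).
  move=> <- //; [exact: set_valP|exact: unit_intervalP|by constructor 2].
- move=> q q' qq' /=; have := GG (set_val q) (set_val (I1 R)) (invmx (val q) *m val q').
  rewrite mulmxA mulmxV ?mul1mx; last exact: SO_unit (set_valP q).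
  move=> <- //; [exact: set_valP|exact: unit_intervalP|by constructor 3].
Qed.

Lemma cyl_point_continuous (S : topologicalType) (F : S -> 'M[R]_n) (t : S -> R) :
  (forall s, SO (F s)) -> (forall s, 0 <= t s <= 1) -> continuous F -> continuous t ->
  continuous (fun s => cyl_point (F s) (t s)).
Proof.
move=> soF t01 cF ct; have [cq _ _] := cylinder_point_map HHl HHr.
apply: continuous_compose cq; apply: continuous_pairing.
  exact: to_elt_continuous.
by apply: to_elt_continuous => // s; rewrite /unit_interval/= in_itv/= t01.
Qed.

(** [dep_mx t] writes the vertices of the embedding at height [t] as affine
    combinations of those of a nondegenerate simplex; [domain] is a closed
    domain for the relabelings, on which [height] and [simplex] are the
    coordinates of an embedding. *)
Variable dep_mx : R -> 'M[R]_(n.+1, N).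
Hypothesis dep_mx_continuous : continuous dep_mx.
Hypothesis dep_mx_embedding : forall (z : 'M[R]_(n, n.+1)) (t : R),
  0 <= t <= 1 -> 0 < \det (z *m D^T) -> E (z *m dep_mx t).

Variables (domain : set 'M[R]_(n, N)) (height : 'M[R]_(n, N) -> R).
Variable simplex : 'M[R]_(n, N) -> 'M[R]_(n, n.+1).
Local Notation U := (E `&` domain).
Hypothesis domain_closed : closed domain.
Hypothesis domain_cover :
  forall x, E x -> exists p : {perm 'I_N}, domain (x *m perm_mx p).
Hypothesis height_continuous : forall x, U x -> height y @[y --> x] --> height x.
Hypothesis simplex_continuous : forall x, U x -> simplex y @[y --> x] --> simplex x.
Hypothesis height01 : forall x, U x -> 0 <= height x <= 1.
Hypothesis simplex_det : forall x, U x -> 0 < \det (simplex x *m D^T).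
Hypothesis path_embedding : forall x (s : R), U x -> 0 <= s <= 1 ->
  E ((1 - s) *: x + s *: (simplex x *m dep_mx (height x))).
Hypothesis relabel : forall x (p : {perm 'I_N}), U x -> U (x *m perm_mx p) ->
  exists T, [/\ adm (height x) T, height (x *m perm_mx p) = height x,
    simplex (x *m perm_mx p) = simplex x *m T &
    T *m dep_mx (height x) = dep_mx (height x) *m perm_mx p].
Hypothesis dep_mx_adm : forall (t : R) T, 0 <= t <= 1 -> adm t T ->
  exists p : {perm 'I_N}, T *m dep_mx t = dep_mx t *m perm_mx p.

(** The models themselves have coordinates that need not be the given height
    and the given simplex. The height only has to be correct at the two ends,
    and the simplex up to a dilation; the latter must be trivial at height 0,
    where the symmetries do not preserve the vertex [i0]. *)
Local Notation model q t := (q *m shift t *m dep_mx t).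
Hypothesis model_domain : forall q (t : R), SO q -> 0 <= t <= 1 -> domain (model q t).
Hypothesis model_height0 : forall q, SO q -> height (model q 0) = 0.
Hypothesis model_height1 : forall q, SO q -> height (model q 1) = 1.
Variable ratio : R -> R -> R.
Hypothesis ratio_continuous : continuous (fun p : R * R => ratio p.1 p.2).
Hypothesis ratio_gt0 : forall q (t : R), SO q -> 0 <= t <= 1 ->
  0 < ratio t (height (model q t)).
Hypothesis ratio0 : ratio 0 0 = 1.
Hypothesis model_simplex : forall q (t : R), SO q -> 0 <= t <= 1 ->
  simplex (model q t) *m D^T =
  q *m (D *m dil (ratio t (height (model q t))) *m D^T).

Local Notation gs Y := (gram_schmidt Y).
Let frame x := gs (simplex x *m D^T).

Lemma frame_SO x : U x -> SO (frame x).
Proof.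
move=> Ux; have Y0 := simplex_det Ux; split; first by rewrite gram_schmidt_orth ?gt_eqF.
by rewrite gram_schmidt_det ?gt_eqF.
Qed.

Lemma frame_relabel x (p : {perm 'I_N}) T : U x -> U (x *m perm_mx p) ->
    adm (height x) T -> simplex (x *m perm_mx p) = simplex x *m T ->
  height_group i0 D (height x) (rhoD T) /\ frame (x *m perm_mx p) = frame x *m rhoD T.
Proof.
move=> Ux Uxp aT sT; have Y0 := simplex_det Ux; have Y'0 := simplex_det Uxp.
have T1 := admissible_ones n_gt0 aT.
have orT := rho_orth n_gt0 c_gt0 D_ones DDt DtD aT.
split; last by rewrite /frame sT mul_Dt_rho// gram_schmidt_mulmxr.
apply: (admissible_height_group n_gt0 c_gt0 D_ones DDt DtD) => //; apply: orth_det_gt0 => //.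
by move: Y'0; rewrite sT mul_Dt_rho// det_mulmx pmulr_rgt0.
Qed.

Lemma model_embedding q (t : R) : SO q -> 0 <= t <= 1 -> E (model q t).
Proof.
move=> [_ q1] t01; apply: dep_mx_embedding => //.
by rewrite -mulmxA (shifted_Dt _ D_ones DDt) det_mulmx q1 mul1r det_scalar exprn_gt0.
Qed.

Lemma continuous_domain (Z : topologicalType) (F : 'M[R]_(n, N) -> Z) :
  (forall x, U x -> F y @[y --> x] --> F x) ->
  continuous (fun v : set_type U => F (set_val v)).
Proof.
move=> cF v; apply: (@continuous_comp _ _ _ (@set_val _ U) F).
  exact: set_val_continuous.
exact: cF (set_valP v).
Qed.

Lemma continuous_frame : continuous (fun v : set_type U => frame (set_val v)).
Proof.
apply: continuous_domain => x Ux; rewrite /frame.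
apply: (@cvg_gram_schmidt _ _ _ (nbhs x) _ (fun y => simplex y *m D^T)).
  by rewrite gt_eqF// simplex_det.
by apply: cvg_mulmx; [exact: simplex_continuous|exact: cvg_cstmx].
Qed.

Lemma continuous_shift : continuous shift.
Proof.
apply: continuous_addmx; first exact: cst_continuous.
apply: continuous_scalemx; last exact: cst_continuous.
by move=> t; apply: cvgM; [exact: cvg_id|exact: cvg_cst].
Qed.

Lemma continuous_model (S : topologicalType) (q : S -> 'M[R]_n) (t : S -> R) :
  continuous q -> continuous t -> continuous (fun s => model (q s) (t s)).
Proof.
move=> cq ct; apply: continuous_mulmx; last exact: continuous_compose dep_mx_continuous.
by apply: continuous_mulmx => //; exact: continuous_compose continuous_shift.
Qed.

Lemma gs_path_det (Y : 'M[R]_n) (a b : R) : 0 < \det Y -> 0 <= a -> 0 <= b -> 0 < a + b ->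
  0 < \det (a *: Y + b *: gs Y).
Proof.
move=> Y0 a0 b0 ab; have Yn0 : \det Y != 0 by rewrite gt_eqF.
have [d d0 ->] := gram_schmidt_path_det Yn0 a0 b0 ab.
by rewrite gram_schmidt_det// mulr1.
Qed.

Lemma model_U q (t : R) : SO q -> 0 <= t <= 1 -> U (model q t).
Proof. by move=> soq t01; split; [exact: model_embedding|exact: model_domain]. Qed.

Lemma segment01 (s : R) : 0 <= s <= 1 -> 0 <= 1 - s <= 1.
Proof. by move=> /andP[s0 s1]; rewrite subr_ge0 s1 lerBlDr lerDl. Qed.

Lemma segment_mix (s t r : R) : 0 <= s <= 1 -> 0 <= t <= 1 -> 0 <= r <= 1 ->
  0 <= (1 - s) * r + s * t <= 1.
Proof.
move=> /andP[s0 s1] /andP[t0 t1] /andP[r0 r1]; apply/andP; split.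
  by rewrite addr_ge0 ?mulr_ge0 ?subr_ge0.
have : (1 - s) * r + s * t <= (1 - s) * 1 + s * 1.
  by rewrite lerD ?ler_wpM2l ?subr_ge0.
by rewrite !mulr1 subrK.
Qed.

Lemma model_group x0 q (t : R) h : SO q -> 0 <= t <= 1 -> height_group i0 D t h ->
  exists2 p : {perm 'I_N}, model (q *m h) t = model q t *m perm_mx p &
    config x0 (model (q *m h) t) = config (X := X) x0 (model q t).
Proof.
move=> soq t01 hh.
have [T [aT hT]] := height_group_admissible n_gt0 c_gt0 D_ones DDt DtD hh.
have [p TA] := dep_mx_adm t01 aT.
have E1 : model (q *m h) t = model q t *m perm_mx p.
  by rewrite -(mulmxA q) hT -!mulmxA TA.
exists p => //; rewrite E1 config_perm//; exact: model_embedding.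
Qed.

(** The dilations are scalings along the axis of the facet, which is preserved
    at every positive height. *)
Lemma height_group_dilation (t : R) h k : height_group i0 D t h -> (t = 0 -> k = 1) ->
  h *m (D *m dil k *m D^T) = D *m dil k *m D^T *m h.
Proof.
move=> hh tk; have cdil : D *m dil k *m D^T = c *: rhoD (dil k).
  by rewrite /rho scalerA divff ?scale1r// gt_eqF.
have [T [aT hT]] := height_group_admissible n_gt0 c_gt0 D_ones DDt DtD hh.
have T1 := admissible_ones n_gt0 aT.
have dM := rhoM c_gt0 D_ones DtD.
have -> : h = rhoD T by apply: shifted_rho hT.
rewrite cdil -scalemxAr -scalemxAl; congr (_ *: _).
rewrite -!dM ?ones_dilation//; congr (rhoD _).
case: aT => [[s si [->|[_ ->]]]|[/tk -> _]].
- by rewrite perm_dilation.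
- rewrite -mulmxA dilationM mulrC -dilationM mulmxA perm_dilation//.
  by rewrite mulmxA.
by rewrite dilation1 mulmx1 mul1mx.
Qed.

(** The map to the cylinder is given by the orthonormalized simplex and the
    height, the map back by the model. All the maps and homotopies are defined
    on the domain, respectively on rotations times the interval, and descend to
    the quotients because of the equivariance of their ingredients. *)
Theorem configuration_space_equivalent :
  homotopy_equivalent R (configuration_space R n X) cyl.
Proof.
have b0 : 0 <= (0 : R) <= 1 by rewrite lexx ler01.
have b1 : 0 <= (1 : R) <= 1 by rewrite lexx ler01.
pose x0 : set_type E := exist (fun y => y \in E) _ (mem_set (model_embedding SO1 b0)).
pose e (v : set_type U) := config x0 (set_val v).
have eQ : quotient_map e := config_domain_map autX E_perm x0 domain_closed domain_cover.
have Uval (v : set_type U) : U (set_val v) := set_valP v.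
have SOval (q : set_type (@SO R n)) : SO (set_val q) := set_valP q.
have Ival (t : I) : 0 <= set_val t <= 1 := unit_intervalP t.
have e_eq (v w : set_type U) : e v = e w ->
    exists p : {perm 'I_N}, set_val w = set_val v *m perm_mx p.
  by apply: config_eq; [have [] := Uval v|have [] := Uval w].
have prQ := cylinder_point_map HHl HHr.
set pr := cylinder_point _ _ _ in prQ.
pose ft (v : set_type U) := cyl_point (frame (set_val v)) (height (set_val v)).
have cft : continuous ft.
  apply: cyl_point_continuous => [v|v||]; [exact: frame_SO|exact: height01| |].
    exact: continuous_frame.
  exact: continuous_domain height_continuous.
have ft_eq v w : e v = e w -> ft v = ft w.
  move=> /e_eq[p vw]; have := Uval w; rewrite /ft vw => Uw.
  have [T [aT hT sT TA]] := relabel (Uval v) Uw.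
  have [grp ->] := frame_relabel (Uval v) Uw aT sT.
  by rewrite hT cyl_point_group//; [exact: frame_SO|exact: height01].
have [f cf fE] := quotient_map_descend eQ cft ft_eq.
pose gt (p : set_type (@SO R n) * I) := config x0 (model (set_val p.1) (set_val p.2)).
have c1 : continuous (fun p : set_type (@SO R n) * I => set_val p.1).
  by apply: continuous_compose (@set_val_continuous _ _); exact: fst_continuous.
have c2 (Z : topologicalType) : continuous (fun p : Z * I => set_val p.2).
  by apply: continuous_compose (@set_val_continuous _ _); exact: snd_continuous.
have cgt : continuous gt.
  apply: config_continuous => [p|]; first exact: model_embedding.
  exact: (continuous_model c1 (@c2 _)).
have gt_eq p p' : pr p = pr p' -> gt p = gt p'.
  apply: (cyl_point_eq (G := fun q t => config x0 (model q t))) => q t h soq t01 hh.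
  by have [_ _ ->] := model_group x0 soq t01 hh.
have [g cg gE] := quotient_map_descend prQ cgt gt_eq.
have gcyl q t : SO q -> 0 <= t <= 1 -> g (cyl_point q t) = config x0 (model q t).
  move=> soq t01; rewrite /cyl_point gE /gt /=.
  have tI : @unit_interval R t by rewrite /unit_interval/= in_itv.
  by rewrite (to_eltK _ soq) (to_eltK _ tI).
have fconfig x : U x -> f (config x0 x) = cyl_point (frame x) (height x).
  move=> Ux; pose v : set_type U := exist (fun y => y \in U) x (mem_set Ux).
  exact: (fE v).
exists f, g; split => //.
  have cval : continuous (fun p : set_type U * I => set_val p.1).
    by apply: continuous_compose (@set_val_continuous _ _); exact: fst_continuous.
  have cs : continuous (fun p : set_type U * I => set_val p.2 : R) by exact: c2.
  have cs' : continuous (fun p : set_type U * I => 1 - set_val p.2 : R).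
    by move=> p; apply: cvgB; [exact: cvg_cst|exact: cs].
  have cdom (Z : topologicalType) (F : 'M[R]_(n, N) -> Z) :
      (forall x, U x -> F y @[y --> x] --> F x) ->
      continuous (fun p : set_type U * I => F (set_val p.1)).
    move=> /continuous_domain cF.
    exact: (continuous_compose (@fst_continuous _ _) cF).
  have cdep : continuous (fun p : set_type U * I => dep_mx (height (set_val p.1))).
    by apply: continuous_compose dep_mx_continuous; apply: cdom; exact: height_continuous.
  have csim : continuous (fun p : set_type U * I => simplex (set_val p.1)).
    by apply: cdom; exact: simplex_continuous.
  have Ezz x : U x -> E (simplex x *m dep_mx (height x)).
    by move=> Ux; apply: dep_mx_embedding; [exact: height01|exact: simplex_det].
  (* The homotopy to the identity passes through the embeddings in standard
     position over the simplex. *)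
  pose kt (v : set_type U) := config x0 (simplex (set_val v) *m dep_mx (height (set_val v))).
  have ckt : continuous kt.
    apply: config_continuous => [v|]; first exact: Ezz.
    apply: continuous_mulmx; first exact: continuous_domain.
    apply: continuous_compose dep_mx_continuous; exact: continuous_domain.
  have kt_eq v w : e v = e w -> kt v = kt w.
    move=> /e_eq[p vw]; have := Uval w; rewrite /kt vw => Uw.
    have [T [aT hT sT TA]] := relabel (Uval v) Uw.
    by rewrite hT sT -mulmxA TA mulmxA config_perm//; exact: Ezz.
  have [k ck kE] := quotient_map_descend eQ ckt kt_eq.
  apply: (homotopic_trans (g := k)).
    pose H (p : set_type U * I) := config x0
      ((set_val p.2 *: simplex (set_val p.1) +
        (1 - set_val p.2) *: (frame (set_val p.1) *m shift (height (set_val p.1)))) *m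
       dep_mx (height (set_val p.1))).
    have EH (p : set_type U * I) : E ((set_val p.2 *: simplex (set_val p.1) +
        (1 - set_val p.2) *: (frame (set_val p.1) *m shift (height (set_val p.1)))) *m
       dep_mx (height (set_val p.1))).
      have /andP[s0 s1] := Ival p.2.
      apply: dep_mx_embedding; first exact: height01.
      rewrite mulmxDl -!scalemxAl -mulmxA (shifted_Dt _ D_ones DDt).
      rewrite mul_mx_scalar scalerA; apply: gs_path_det => //; first exact: simplex_det.
        by rewrite mulr_ge0 ?subr_ge0// ltW.
      have [->|s_neq0] := eqVneq (set_val p.2) 0; first by rewrite subr0 mul1r add0r.
      by rewrite ltr_pwDl ?mulr_ge0 ?subr_ge0// ?ltW// lt_neqAle eq_sym s_neq0.
    apply: (homotopic_descend (H := H) eQ).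
    - apply: config_continuous => //; apply: continuous_mulmx => //.
      apply: continuous_addmx; first exact: continuous_scalemx.
      apply: continuous_scalemx => //; apply: continuous_mulmx.
        exact: (continuous_compose (@fst_continuous _ _) continuous_frame).
      by apply: continuous_compose continuous_shift; apply: cdom; exact: height_continuous.
    - move=> v w s /e_eq[p vw]; have := Uval w; have := EH (v, s); rewrite /H /= vw => Ev Uw.
      have [T [aT hT sT TA]] := relabel (Uval v) Uw.
      have [grp ->] := frame_relabel (Uval v) Uw aT sT.
      rewrite hT sT -(mulmxA (frame _)) (admissible_shifted n_gt0 c_gt0 D_ones DtD aT).
      by rewrite mulmxA -(mulmx_comb _ _ (simplex _)) -mulmxA TA mulmxA config_perm.
    - move=> v; rewrite /H /= fE /ft gcyl; [|exact: frame_SO|exact: height01].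
      by rewrite scale0r add0r subr0 scale1r.
    - by move=> v; rewrite /H /= kE /kt subrr scale0r addr0 scale1r.
  pose H (p : set_type U * I) := config x0
    ((1 - (1 - set_val p.2)) *: set_val p.1 +
     (1 - set_val p.2) *: (simplex (set_val p.1) *m dep_mx (height (set_val p.1)))).
  have EH (p : set_type U * I) : E ((1 - (1 - set_val p.2)) *: set_val p.1 +
     (1 - set_val p.2) *: (simplex (set_val p.1) *m dep_mx (height (set_val p.1)))).
    by apply: path_embedding => //; exact: segment01.
  apply: (homotopic_descend (H := H) eQ).
  - apply: config_continuous => //; apply: continuous_addmx.
      apply: continuous_scalemx => // p.
      by apply: cvgB; [exact: cvg_cst|exact: cs'].
    by apply: continuous_scalemx => //; exact: continuous_mulmx.
  - move=> v w s /e_eq[p vw]; have := Uval w; have := EH (v, s); rewrite /H /= vw => Ev Uw.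
    have [T [aT hT sT TA]] := relabel (Uval v) Uw.
    rewrite hT sT -(mulmxA (simplex _)) TA mulmxA.
    by rewrite -mulmx_comb config_perm.
  - by move=> v; rewrite /H /= kE /kt subr0 subrr scale0r add0r scale1r.
  - by move=> v; rewrite /H /= !subrr subr0 scale0r scale1r addr0.
(* In the other direction the height moves linearly from the height of the
   model, and the simplex by dilations from the simplex of the model. *)
pose tau q t := height (model q t).
have tau01 q (t : R) : SO q -> 0 <= t <= 1 -> 0 <= tau q t <= 1.
  by move=> soq t01; apply: height01; exact: model_U.
pose stretch q t s : 'M[R]_n :=
  q *m (D *m dil ((1 - s) * ratio t (tau q t) + s) *m D^T).
have stretch_det q (t s : R) : SO q -> 0 <= t <= 1 -> 0 <= s <= 1 -> 0 < \det (stretch q t s).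
  move=> soq t01 /andP[s0 s1]; have [_ q1] := soq; rewrite det_mulmx q1 mul1r.
  have rt0 := ratio_gt0 soq t01.
  have -> : forall k, D *m dil k *m D^T = c *: rhoD (dil k).
    by move=> k; rewrite /rho scalerA divff ?scale1r// gt_eqF.
  rewrite detZ mulr_gt0 ?exprn_gt0//; apply: det_rho_dilation_gt0.
  have [->|s_neq0] := eqVneq s 0; first by rewrite subr0 mul1r addr0.
  by rewrite ltr_wpDl ?mulr_ge0 ?subr_ge0// ?ltW// lt_neqAle eq_sym s_neq0.
pose K (p : set_type (@SO R n) * I * I) := cyl_point
  (gs (stretch (set_val p.1.1) (set_val p.1.2) (set_val p.2)))
  ((1 - set_val p.2) * tau (set_val p.1.1) (set_val p.1.2) + set_val p.2 * set_val p.1.2).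
have cp1 : continuous (fun p : set_type (@SO R n) * I * I => p.1) by exact: fst_continuous.
have cq : continuous (fun p : set_type (@SO R n) * I * I => set_val p.1.1).
  exact: (continuous_compose cp1 c1).
have ct : continuous (fun p : set_type (@SO R n) * I * I => set_val p.1.2 : R).
  exact: (continuous_compose cp1 (@c2 _)).
have cs : continuous (fun p : set_type (@SO R n) * I * I => set_val p.2 : R) by exact: c2.
have cs' : continuous (fun p : set_type (@SO R n) * I * I => 1 - set_val p.2 : R).
  by move=> p; apply: cvgB; [exact: cvg_cst|exact: cs].
have ctau : continuous (fun p : set_type (@SO R n) * I * I =>
    tau (set_val p.1.1) (set_val p.1.2)).
  move=> p; apply: (@continuous_comp _ _ _
    (fun p : set_type (@SO R n) * I * I => model (set_val p.1.1) (set_val p.1.2)) height).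
    exact: continuous_model.
  by apply: height_continuous; exact: model_U.
have cstretch : continuous (fun p : set_type (@SO R n) * I * I =>
    stretch (set_val p.1.1) (set_val p.1.2) (set_val p.2)).
  apply: continuous_mulmx => //; apply: continuous_mulmx; last exact: cst_continuous.
  apply: continuous_mulmx; first exact: cst_continuous.
  apply: continuous_addmx; first exact: cst_continuous.
  apply: continuous_scalemx; last exact: cst_continuous.
  move=> p; apply: cvgB; first exact: cvg_cst.
  apply: cvgD; last exact: cs.
  apply: cvgM; first exact: cs'.
  apply: (@continuous_comp _ _ _ (fun p : set_type (@SO R n) * I * I =>
    (set_val p.1.2 : R, tau (set_val p.1.1) (set_val p.1.2))) (fun p : R * R => ratio p.1 p.2)).
    exact: continuous_pairing.
  exact: ratio_continuous.
apply: (homotopic_descend (H := K) prQ).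
- apply: cyl_point_continuous => [p|p||].
  + have d0 := stretch_det _ _ _ (SOval p.1.1) (Ival p.1.2) (Ival p.2).
    by split; [rewrite gram_schmidt_orth ?gt_eqF|rewrite gram_schmidt_det ?gt_eqF].
  + by apply: segment_mix => //; exact: tau01.
  + move=> p; apply: cvg_gram_schmidt; last exact: cstretch.
    by rewrite gt_eqF// stretch_det.
  move=> p; apply: cvgD; apply: cvgM; [exact: cs'|exact: ctau|exact: cs|exact: ct].
- move=> p p' s pp'; rewrite /K /=.
  apply: (cyl_point_eq (G := fun q t => cyl_point (gs (stretch q t (set_val s)))
    ((1 - set_val s) * tau q t + set_val s * t))) => // q t h soq t01 hh.
  have soh := height_group_SO hh; have soqh := SO_mul soq soh.
  have [pp qh _] := model_group x0 soq t01 hh.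
  have tauE : tau (q *m h) t = tau q t.
    rewrite /tau qh; have Um := model_U soq t01; have Um' := model_U soqh t01.
    by rewrite qh in Um'; have [T []] := relabel Um Um'.
  have -> : stretch (q *m h) t (set_val s) = stretch q t (set_val s) *m h.
    rewrite /stretch tauE -mulmxA (height_group_dilation hh); first by rewrite mulmxA.
    by move=> t0; rewrite t0 /tau model_height0// ratio0 mulr1 subrK.
  rewrite gram_schmidt_mulmxr; last by case: soh.
  rewrite tauE cyl_point_group//.
  + have d0 := stretch_det _ _ _ soq t01 (Ival s).
    by split; [rewrite gram_schmidt_orth ?gt_eqF|rewrite gram_schmidt_det ?gt_eqF].
  + by apply: segment_mix => //; exact: tau01.
  case: hh => [hF|[t0 hS]|[t1 hF]]; [by constructor 1| |].
    by constructor 2; split=> //; rewrite t0 /tau model_height0// !mulr0 addr0.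
  by constructor 3; split=> //; rewrite t1 /tau model_height1// !mulr1 subrK.
- move=> p; rewrite /K /= gE /gt fconfig; last exact: model_U.
  by rewrite !subr0 !mul1r mul0r !addr0 /stretch subr0 mul1r addr0 /frame model_simplex.
move=> p; rewrite /K /= subrr !mul0r !mul1r !add0r /stretch subrr mul0r add0r dilation1.
rewrite mulmx1 DDt mul_mx_scalar gram_schmidt_scale_orth//; last by case: (SOval p.1).
by rewrite cyl_pointK; case: p.
Qed.

End Classification.

(** * The Gram matrix of a configuration and its adjugate *)

Section Gram.
Variables (R : realType) (n N : nat).
Local Notation ones := (const_mx 1 : 'rV[R]_N).

(** Homogeneous coordinates: the affine dependencies of the columns of [x] are
    the linear ones of [homog x]. *)
Definition homog (x : 'M[R]_(n, N)) : 'M[R]_(1 + n, N) := col_mx ones x.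

Lemma homog_dependency x l : affine_dependency x l <-> homog x *m l = 0.
Proof.
rewrite /homog mul_col_mx; split=> [[-> ->]|]; first by rewrite col_mx0.
by rewrite -[0]col_mx0 => /eq_col_mx[].
Qed.

Lemma dependency_sum (x : 'M[R]_(n, N)) l : affine_dependency x l -> \sum_k l k 0 = 0.
Proof.
move=> [_ /matrixP/(_ 0 0)]; rewrite [LHS]mxE [RHS]mxE => l0; rewrite -[RHS]l0.
by apply: eq_bigr => k _; rewrite mxE mul1r.
Qed.

(** Its kernel is the space of affine dependencies ([gram_dependency]), but as a
    square matrix it has an adjugate. *)
Definition gram (x : 'M[R]_(n, N)) : 'M[R]_N := (homog x)^T *m homog x.

Lemma gram_sym x : (gram x)^T = gram x.
Proof. by rewrite /gram trmx_mul trmxK. Qed.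

Lemma gram_dependency x l : affine_dependency x l <-> gram x *m l = 0.
Proof.
rewrite homog_dependency; split=> [Hl|Gl]; first by rewrite /gram -mulmxA Hl mulmx0.
have : sqlen (homog x *m l) = 0.
  by rewrite /sqlen trmx_mul mulmxA -(mulmxA l^T) -/(gram x) -mulmxA Gl mulmx0 mxE.
rewrite sqlen_sum => /eqP; rewrite psumr_eq0 => [/allP H0|i _]; last exact: sqr_ge0.
apply/colP => i; rewrite [RHS]mxE; have := H0 i (mem_index_enum i).
by rewrite /= sqrf_eq0 => /eqP.
Qed.

Lemma gramE x : gram x = ones^T *m ones + x^T *m x.
Proof. by rewrite /gram /homog tr_col_mx mul_row_col. Qed.

Lemma gram_perm x (p : {perm 'I_N}) :
  gram (x *m perm_mx p) = (perm_mx p)^T *m gram x *m perm_mx p.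
Proof.
have E : homog (x *m perm_mx p) = homog x *m perm_mx p.
  rewrite /homog mul_col_mx; congr (col_mx _ _).
  apply/rowP => j; rewrite mxE [RHS]mxE (bigD1 (p^-1%g j))//= big1 ?addr0.
    by rewrite !mxE permKV eqxx mulr1.
  move=> i ij; rewrite !mxE (_ : p i == j = false) ?mulr0//; apply/eqP => pij.
  by rewrite -pij permK eqxx in ij.
by rewrite /gram E trmx_mul !mulmxA.
Qed.

Lemma gram_orth x (h : 'M[R]_n) : h *m h^T = 1%:M -> gram (h *m x) = gram x.
Proof. by move=> /mulmx1C hh; rewrite !gramE trmx_mul mulmxA -(mulmxA x^T) hh mulmx1. Qed.

End Gram.

Section CorankOne.
Variables (F : fieldType) (m : nat).

(** A vector killed by the matrix without row [i] and column [j] extends by zero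
    to a vector that [A] maps to a multiple of the [i]-th basis vector, hence to
    zero because of [r]; but no nonzero multiple of [l] vanishes at [j]. *)
Lemma cofactor_kernel_neq0 (A : 'M[F]_m) (l : 'cV[F]_m) (r : 'rV[F]_m) i j :
    (forall v : 'cV_m, A *m v = 0 -> exists a, v = a *: l) ->
    r *m A = 0 -> r 0 i != 0 -> l j 0 != 0 ->
  cofactor A i j != 0.
Proof.
move=> ker rA ri lj; rewrite /cofactor mulf_neq0 ?signr_eq0// -det_tr.
apply/negP => /det0P[w w0 wA]; move/negP: w0; apply; apply/eqP.
set B := row' i (col' j A) in wA.
have Bw : B *m w^T = 0 by rewrite -[LHS]trmxK trmx_mul trmxK wA trmx0.
pose v : 'cV[F]_m := \col_k if unlift j k is Some k' then w 0 k' else 0.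
have vl k' : v (lift j k') 0 = w 0 k' by rewrite mxE liftK.
have vj : v j 0 = 0 by rewrite mxE unlift_none.
have Av k : k != i -> (A *m v) k 0 = 0.
  rewrite eq_sym => ki; have [k' kE _] := unlift_some ki.
  transitivity ((B *m w^T) k' 0); last by rewrite Bw mxE.
  rewrite [LHS]mxE [RHS]mxE (bigD1_ord j)//= vj mulr0 add0r.
  by apply: eq_bigr => a _; rewrite vl !mxE kE.
have Avi : A *m v = (A *m v) i 0 *: delta_mx i 0.
  apply/colP => k; rewrite [RHS]mxE [delta_mx _ _ _ _]mxE eqxx andbT.
  have [->|ki] := eqVneq k i; first by rewrite mulr1.
  by rewrite mulr0 Av.
have Av0 : A *m v = 0.
  have : r *m (A *m v) = 0 by rewrite mulmxA rA mul0mx.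
  rewrite Avi -scalemxAr -colE => /matrixP/(_ 0 0).
  rewrite [LHS]mxE [X in _ * X]mxE [RHS]mxE => /eqP.
  by rewrite mulf_eq0 (negPf ri) orbF => /eqP ->; rewrite scale0r.
have [a va] := ker _ Av0.
have a0 : a = 0.
  by move/eqP: vj; rewrite va mxE mulf_eq0 (negPf lj) orbF => /eqP.
by apply/rowP => k; rewrite -vl va a0 scale0r !mxE.
Qed.

(** The columns of the adjugate are in the kernel, and so are its rows by
    symmetry. *)
Lemma adj_corank1 (G : 'M[F]_m) (l : 'cV[F]_m) : G^T = G ->
    (forall v : 'cV_m, G *m v = 0 -> exists a, v = a *: l) ->
    G *m l = 0 -> l != 0 ->
  exists2 k, k != 0 & forall i j, (\adj G) i j = k * (l i 0 * l j 0).
Proof.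
move=> Gs ker Gl l0.
have detG : \det G = 0.
  apply/eqP; rewrite -det_tr; apply/det0P; exists l^T.
    by rewrite -trmx0 (inj_eq trmx_inj).
  by rewrite -trmx_mul Gl trmx0.
have [j lj] : exists j, l j 0 != 0.
  apply/existsP; rewrite -negb_forall; apply: contra l0 => /forallP lz.
  by apply/eqP/colP => k; rewrite (eqP (lz k)) mxE.
have cols k : exists a, forall i, (\adj G) i k = a * l i 0.
  have : G *m col k (\adj G) = 0.
    by rewrite colE mulmxA mul_mx_adj detG mul_scalar_mx scale0r.
  move=> /ker[a aE]; exists a => i.
  by have /colP/(_ i) := aE; rewrite !mxE.
have [a aE] := choice cols.
have sym i k : (\adj G) i k = (\adj G) k i by rewrite -[in LHS]Gs -trmx_adj mxE.
exists (a j / l j 0).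
  have := cofactor_kernel_neq0 (i := j) (j := j) (r := l^T) ker.
  rewrite -[X in X *m G]trmxK -[G in _ *m G]Gs -trmx_mul trmxK Gl trmx0 mxE => /(_ erefl lj lj).
  have -> : cofactor G j j = (\adj G) j j by rewrite mxE.
  by rewrite aE mulf_eq0 negb_or => /andP[aj _]; rewrite mulf_neq0 ?invr_eq0.
move=> i k; rewrite aE; have : a k * l j 0 = a j * l k 0 by rewrite -aE sym aE.
move=> /(canRL (mulfK lj)) ->.
rewrite -!mulrA; congr (_ * _); rewrite mulrCA; congr (_ * _); exact: mulrC.
Qed.

(** Principal cofactors are first-order variations of the determinant. *)
Lemma principal_cofactor (A : 'M[F]_m) j :
  cofactor A j j = \det (A + delta_mx j j) - \det A.
Proof.
rewrite (expand_det_col (A + delta_mx j j) j) (expand_det_col A j).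
have cof i : cofactor (A + delta_mx j j) i j = cofactor A i j.
  rewrite /cofactor; congr (_ * \det _); apply/matrixP => a b; rewrite !mxE.
  by rewrite [lift j b == j]eq_sym (negPf (neq_lift _ _)) andbF addr0.
under eq_bigr do rewrite cof mxE mulrDl.
rewrite big_split /= addrAC subrr add0r (bigD1 j)//= big1 ?addr0.
  by rewrite mxE eqxx mul1r.
by move=> i ij; rewrite mxE (negPf ij) mul0r.
Qed.

End CorankOne.

(** * Configurations with one more vertex than the dimension *)

Section SimplexSkeleton.
Variables (R : realType) (n : nat).
Hypothesis n_gt2 : (2 < n)%N.
Local Notation X := (skeleton (n - 2) (full_simplex 'I_n.+1)).
Local Notation E := (@embedding_space R n n.+1 X).

Let n_gt0 : (0 < n)%N. Proof. exact: ltn_trans n_gt2. Qed.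

Definition inner_vertex (x : 'M[R]_(n, n.+1)) (i : 'I_n.+1) (l : 'cV[R]_n.+1) : Prop :=
  [/\ affine_dependency x l, l i 0 < 0, forall k, k != i -> 0 < l k 0 &
      forall v, affine_dependency x v -> exists a, v = a *: l].

Lemma det_gram (x : 'M[R]_(n, n.+1)) :
  \det (gram x) = \det (homog x : 'M[R]_n.+1) ^+ 2.
Proof. by rewrite /gram det_mulmx det_tr expr2. Qed.

Lemma nondegenerate_dependency (x : 'M[R]_(n, n.+1)) l : \det (gram x) != 0 ->
  affine_dependency x l -> l = 0.
Proof.
move=> G0 /gram_dependency Gl; have uG : gram x \in unitmx by rewrite unitmxE unitfE.
by rewrite -[l](mulKmx uG) Gl mulmx0.
Qed.

(** Among [n + 1] coefficients that sum to zero, at least [n] of the same strict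
    sign leave a single one of the other sign. *)
Lemma embedding_dependency_sign (x : 'M[R]_(n, n.+1)) l : E x -> affine_dependency x l ->
  l != 0 -> exists i, (forall k, k != i -> 0 < l k 0) \/ (forall k, k != i -> l k 0 < 0).
Proof.
move=> /(embedding_criterion n_gt2) crit dep l0.
have single (A : {set 'I_n.+1}) : (n <= #|A|)%N -> exists i, forall k, k != i -> k \in A.
  move=> nA; have cA : (#|~: A| <= 1)%N.
    by rewrite -(leq_add2l #|A|) cardsC card_ord addn1 ltnS.
  have [A0|/set0Pn[i iA]] := eqVneq (~: A) finset.set0.
    exists ord0 => k _; have : k \notin ~: A by rewrite A0 inE.
    by rewrite inE negbK.
  exists i => k; apply: contraR => kA.
  by have /card_le1P/(_ i iA k) := cA; rewrite !inE kA => /esym.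
have [/single[i iP]|/single[i iP]] := crit _ dep l0; exists i.
  by left=> k /iP; rewrite inE.
by right=> k /iP; rewrite inE.
Qed.

Lemma other_vertex (i : 'I_n.+1) : exists k, k != i.
Proof.
have [->|i0] := eqVneq i ord0; last by exists ord0; rewrite eq_sym.
by exists ord_max; rewrite -val_eqE /= -lt0n.
Qed.

Lemma third_vertex (i j : 'I_n.+1) : exists2 k, k != i & k != j.
Proof.
have /card_gt0P[k] : (0 < #|~: [set i; j]%SET|)%N.
  by rewrite cardsCs finset.setCK card_ord cards2 subn_gt0; case: (i != j) => //; exact: ltnW.
by rewrite !inE negb_or => /andP[ki kj]; exists k.
Qed.

(** By [embedding_dependency_sign] a dependency puts one vertex in the interior of
    the simplex spanned by the others. An independent one would have a nonzero
    combination with it that vanishes at this vertex, all of whose other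
    coefficients would have the same sign. *)
Lemma degenerate_inner_vertex (x : 'M[R]_(n, n.+1)) : E x -> \det (gram x) = 0 ->
  exists i l, inner_vertex x i l.
Proof.
move=> Ex G0.
have [l l0 dep] : exists2 l : 'cV[R]_n.+1, l != 0 & affine_dependency x l.
  have /eqP/det0P[v v0 vG] := G0; exists v^T.
    by rewrite -trmx0 (inj_eq trmx_inj).
  by apply/gram_dependency; rewrite -[gram x]gram_sym -trmx_mul vG trmx0.
have sum_split i v : affine_dependency x v -> v i 0 = - \sum_(k | k != i) v k 0.
  by move=> /dependency_sum/eqP; rewrite (bigD1 i)//= addr_eq0 => /eqP.
have other := other_vertex.
have pos_sum i (v : 'cV[R]_n.+1) :
    (forall k, k != i -> 0 < v k 0) -> 0 < \sum_(k | k != i) v k 0.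
  move=> vp; have [k ki] := other i; rewrite (bigD1 k)//= ltr_pwDl ?vp//.
  by apply: sumr_ge0 => a /andP[ai _]; exact: ltW (vp a ai).
have uniq i : (forall k, k != i -> 0 < l k 0) \/ (forall k, k != i -> l k 0 < 0) ->
    forall v, affine_dependency x v -> exists a, v = a *: l.
  move=> lsgn v vdep; have li0 : l i 0 != 0.
    case: lsgn => lp; rewrite (sum_split _ _ dep) oppr_eq0; first by rewrite gt_eqF ?pos_sum.
    rewrite -oppr_eq0 -sumrN gt_eqF//.
    have := @pos_sum i (- l); rewrite (eq_bigr (fun k => - l k 0)) => [|k _]; last by rewrite mxE.
    by apply=> k ki; rewrite mxE oppr_gt0 lp.
  exists (v i 0 / l i 0); apply/eqP; rewrite -subr_eq0; apply/negPn/negP => w0.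
  set w := v - _ in w0; have wi : w i 0 = 0 by rewrite !mxE divfK// subrr.
  have wdep : affine_dependency x w.
    case: vdep dep => [xv ov] [xl ol].
    by split; rewrite /w mulmxBr -scalemxAr ?xv ?xl ?ov ?ol scaler0 subr0.
  have [j wj] := embedding_dependency_sign Ex wdep w0.
  have ji : j = i.
    apply/eqP; rewrite eq_sym; apply/negPn/negP => ij.
    by case: wj => /(_ i ij); rewrite wi ltxx.
  have ws : \sum_(k | k != i) w k 0 = 0.
    by apply/eqP; rewrite -oppr_eq0 -(sum_split i w wdep) wi.
  rewrite {}ji in wj; case: wj => wj; first by have := pos_sum i w wj; rewrite ws ltxx.
  have := @pos_sum i (- w); rewrite (eq_bigr (fun k => - w k 0)) => [|k _]; last by rewrite mxE.
  rewrite sumrN ws oppr0 ltxx => h.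
  by suff : false by []; apply: h => k ki; rewrite mxE oppr_gt0 wj.
have [i lsgn] := embedding_dependency_sign Ex dep l0; exists i.
have ker := uniq i lsgn; case: lsgn => lp.
  exists l; split => //; rewrite (sum_split _ _ dep) oppr_lt0; exact: pos_sum.
have Nl k : (- l) k 0 = - l k 0 by rewrite mxE.
have Ndep : affine_dependency x (- l) by case: dep => xl ol; split; rewrite mulmxN ?xl ?ol oppr0.
have Np k : k != i -> 0 < (- l) k 0 by move=> ki; rewrite Nl oppr_gt0 lp.
exists (- l); split => //; first by rewrite (sum_split _ _ Ndep) oppr_lt0; exact: pos_sum.
by move=> v /ker[a ->]; exists (- a); rewrite scaleNr scalerN opprK.
Qed.

Definition facet_sq (x : 'M[R]_(n, n.+1)) (j : 'I_n.+1) : R :=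
  cofactor (gram x) j j ^+ 2.

(** A continuous function that vanishes on an embedding exactly when it is
    degenerate with inner vertex [i]. Indeed in the degenerate case [facet_sq x j] is
    proportional to the fourth power of the coefficient of [j] in the
    dependency, so that it is largest at the inner vertex only. *)
Definition offset (x : 'M[R]_(n, n.+1)) (i : 'I_n.+1) : R :=
  \det (gram x) ^+ 2 + \sum_j Num.max 0 (facet_sq x j - facet_sq x i).

Lemma offset_ge0 (x : 'M[R]_(n, n.+1)) i : 0 <= offset x i.
Proof. by rewrite addr_ge0 ?sqr_ge0// sumr_ge0// => j _; rewrite le_max lexx. Qed.

Lemma nondegenerate_offset (x : 'M[R]_(n, n.+1)) i : \det (gram x) != 0 -> 0 < offset x i.
Proof.
move=> G0; rewrite ltr_pwDl//; last by rewrite sumr_ge0// => j _; rewrite le_max lexx.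
by rewrite lt_neqAle eq_sym sqrf_eq0 G0 sqr_ge0.
Qed.

Lemma inner_vertex_det (x : 'M[R]_(n, n.+1)) i l : inner_vertex x i l -> \det (gram x) = 0.
Proof.
move=> [dep li _ _]; apply/eqP/negPn/negP => /nondegenerate_dependency/(_ dep) l0.
by move: li; rewrite l0 mxE ltxx.
Qed.

Lemma inner_vertex_offset (x : 'M[R]_(n, n.+1)) i l : inner_vertex x i l ->
  offset x i = 0 /\ forall j, j != i -> 0 < offset x j.
Proof.
move=> inn; have G0 := inner_vertex_det inn; have [dep li lp ker] := inn.
have l0 : l != 0 by apply/eqP => l0; move: li; rewrite l0 mxE ltxx.
have [k k0 adjE] : exists2 k, k != 0 & forall i j, (\adj (gram x)) i j = k * (l i 0 * l j 0).
  apply: adj_corank1 => //; first exact: gram_sym.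
    by move=> v /gram_dependency; exact: ker.
  exact/gram_dependency.
have VE j : facet_sq x j = k ^+ 2 * (l j 0 ^+ 2) ^+ 2.
  rewrite /facet_sq (_ : cofactor _ _ _ = (\adj (gram x)) j j); last by rewrite mxE.
  by rewrite adjE exprMn expr2.
have k2 : 0 < k ^+ 2 by rewrite lt_neqAle eq_sym sqrf_eq0 k0 sqr_ge0.
have lE : - l i 0 = \sum_(a | a != i) l a 0.
  have := dependency_sum dep; rewrite (bigD1 i)//= => /eqP.
  by rewrite addrC addr_eq0 => /eqP ->.
have l_lt j : j != i -> l j 0 < - l i 0.
  move=> ji; rewrite lE (bigD1 j)//= ltrDl.
  have [a ai aj] := third_vertex i j.
  rewrite (bigD1 a) /=; last by rewrite ai aj.
  by rewrite ltr_pwDl ?lp// sumr_ge0// => b /andP[/andP[bi _] _]; rewrite ltW// lp.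
have V_lt j : j != i -> facet_sq x j < facet_sq x i.
  move=> ji; rewrite !VE ltr_pM2l// ltr_pXn2r ?nnegrE ?sqr_ge0//.
  by rewrite -[l i 0 ^+ 2]sqrrN ltr_pXn2r ?nnegrE ?ltW ?lp ?oppr_gt0 ?l_lt.
split=> [|j ji].
  rewrite /offset G0 expr0n add0r big1// => j _; apply/max_idPl; rewrite subr_le0.
  by have [->|/V_lt/ltW] := eqVneq j i.
rewrite /offset G0 expr0n add0r (bigD1 i)//= ltr_pwDl//.
  by rewrite lt_max subr_gt0 V_lt// orbT.
by rewrite sumr_ge0// => a _; rewrite le_max lexx.
Qed.

Lemma offsetD_gt0 (x : 'M[R]_(n, n.+1)) j k : E x -> j != k -> 0 < offset x j + offset x k.
Proof.
move=> Ex jk; have [G0|G0] := eqVneq (\det (gram x)) 0; last first.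
  by rewrite addr_gt0// nondegenerate_offset.
have [i [l /inner_vertex_offset[_ inn]]] := degenerate_inner_vertex Ex G0.
have [ji|ji] := eqVneq j i.
  by rewrite ltr_wpDl ?offset_ge0// inn// -ji eq_sym.
by rewrite ltr_pwDl ?offset_ge0// inn.
Qed.

Definition collapse_num (x : 'M[R]_(n, n.+1)) (k : 'I_n.+1) : R :=
  \prod_(j | j != k) Num.max 0 (offset x j - offset x k).

Definition collapse_den (x : 'M[R]_(n, n.+1)) (k : 'I_n.+1) : R :=
  \prod_(j | j != k) (offset x j + offset x k).

(** A continuous function that is 1 when [k] is the inner vertex and is nonzero
    for at most one [k], the one with the least [offset]: all the factors of the
    numerator are positive only there. *)
Definition collapse (x : 'M[R]_(n, n.+1)) (k : 'I_n.+1) : R :=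
  collapse_num x k / collapse_den x k.

Lemma collapse_den_gt0 (x : 'M[R]_(n, n.+1)) k : E x -> 0 < collapse_den x k.
Proof. by move=> Ex; apply: prodr_gt0 => j jk; exact: offsetD_gt0. Qed.

Lemma collapse_factor (x : 'M[R]_(n, n.+1)) j k :
  Num.max 0 (offset x j - offset x k) <= offset x j + offset x k.
Proof.
rewrite ge_max addr_ge0 ?offset_ge0//= lerD2l.
by rewrite (le_trans _ (offset_ge0 x k))// oppr_le0 offset_ge0.
Qed.

Lemma collapse01 (x : 'M[R]_(n, n.+1)) k : E x -> 0 <= collapse x k <= 1.
Proof.
move=> Ex; have d0 := collapse_den_gt0 k Ex.
apply/andP; split.
  by apply: divr_ge0; [apply: prodr_ge0 => j _; rewrite le_max lexx|exact: ltW].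
rewrite /collapse ler_pdivrMr// mul1r.
by apply: ler_prod => j _; rewrite le_max lexx /= collapse_factor.
Qed.

Lemma collapse_eq0 (x : 'M[R]_(n, n.+1)) k : E x -> (collapse x k == 0) = (collapse_num x k == 0).
Proof. by move=> Ex; rewrite mulf_eq0 invr_eq0 (gt_eqF (collapse_den_gt0 k Ex)) orbF. Qed.

Lemma collapse_neq0 (x : 'M[R]_(n, n.+1)) k : collapse_num x k != 0 ->
  forall j, j != k -> collapse_num x j = 0.
Proof.
move=> /prodf_neq0 ck j jk; have /ck : j != k by [].
rewrite /collapse_num (bigD1 k) 1?eq_sym//= => h.
rewrite (_ : Num.max _ _ = 0) ?mul0r//; apply/max_idPl.
move: h; rewrite subr_le0; have [//|] := leP (offset x k) (offset x j).
by move=> /ltW; rewrite -subr_le0 => /max_idPl ->; rewrite eqxx.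
Qed.

Lemma inner_vertex_collapse (x : 'M[R]_(n, n.+1)) i l : E x -> inner_vertex x i l -> collapse x i = 1.
Proof.
move=> Ex /inner_vertex_offset[mi mj]; rewrite /collapse.
have -> : collapse_num x i = collapse_den x i.
  by apply: eq_bigr => j ji; rewrite mi subr0 addr0; apply/max_idPr/ltW/mj.
by rewrite divff// gt_eqF// collapse_den_gt0.
Qed.

Lemma nondegenerate_collapse (x : 'M[R]_(n, n.+1)) k : E x -> \det (gram x) != 0 -> collapse x k < 1.
Proof.
move=> Ex G0; have d0 := collapse_den_gt0 k Ex.
rewrite /collapse ltr_pdivrMr// mul1r /collapse_num /collapse_den.
have mp j : 0 < offset x j := nondegenerate_offset j G0.
have [j jk] := other_vertex k.
rewrite (bigD1 j)//= [X in _ < X](bigD1 j)//=.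
apply: (@le_lt_trans _ _ (Num.max 0 (offset x j - offset x k) *
   \prod_(i | (i != k) && (i != j)) (offset x i + offset x k))).
  rewrite ler_wpM2l ?le_max ?lexx//.
  by apply: ler_prod => i _; rewrite le_max lexx /= collapse_factor.
rewrite ltr_pM2r; last by apply: prodr_gt0 => i _; rewrite addr_gt0.
by rewrite gt_max addr_gt0//= ltrD2l (lt_trans _ (mp k))// oppr_lt0.
Qed.

End SimplexSkeleton.

(** * Height and orientation for n + 1 points *)

Section SimplexSkeletonConfigurations.
Variables (R : realType) (n : nat).
Hypothesis n_gt2 : (2 < n)%N.
Local Notation X := (skeleton (n - 2) (full_simplex 'I_n.+1)).
Local Notation E := (@embedding_space R n n.+1 X).
Local Notation ones := (const_mx 1 : 'rV[R]_n.+1).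
Let n_gt0 : (0 < n)%N. Proof. exact: ltn_trans n_gt2. Qed.

Variables (i0 : 'I_n.+1) (c : R) (D : 'M[R]_(n, n.+1)).
Hypothesis c_gt0 : 0 < c.
Hypothesis D_ones : D *m ones^T = 0.
Hypothesis DDt : D *m D^T = c%:M.
Hypothesis DtD : D^T *m D = c *: (1%:M - (n%:R + 1)^-1 *: (ones^T *m ones)).
Local Notation e0 := (delta_mx 0 i0 : 'rV[R]_n.+1).
Local Notation dil := (@dilation R n i0).
Local Notation adm := (@admissible R n i0).
Local Notation rhoD := (rho c D).

(** Up to a constant the oriented volume of a simplex is the same in homogeneous
    coordinates as with respect to [D]. *)
Lemma orientation (z : 'M[R]_(n, n.+1)) :
  \det (homog z : 'M[R]_n.+1) * \det (homog D : 'M[R]_n.+1) =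
  (n%:R + 1) * \det (z *m D^T).
Proof.
have HE : homog z *m (homog D)^T =
    block_mx (n%:R + 1)%:M 0 (z *m ones^T) (z *m D^T) :> 'M[R]_(1 + n).
  by rewrite /homog tr_col_mx mul_col_row (ones_Dt D_ones) onesT.
rewrite -[RHS](_ : \det (homog z *m (homog D)^T) = _).
  by rewrite -[in LHS](det_tr (homog D : 'M[R]_n.+1)) -det_mulmx.
by rewrite HE det_lblock det_scalar1.
Qed.

Lemma orientation_neq0 : \det (homog D : 'M[R]_n.+1) != 0.
Proof.
apply/eqP => d0; have := orientation D; rewrite d0 mulr0 DDt det_scalar => /esym/eqP.
by rewrite mulf_eq0 expf_eq0 (gt_eqF c_gt0) andbF orbF (negPf (nS_neq0 _ _)).
Qed.

Lemma homog_perm (z : 'M[R]_(n, n.+1)) (s : {perm 'I_n.+1}) :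
  homog (z *m perm_mx s) = homog z *m perm_mx s.
Proof. by rewrite /homog mul_col_mx ones_perm. Qed.

Lemma det_perm_Dt (z : 'M[R]_(n, n.+1)) (s : {perm 'I_n.+1}) :
  \det (z *m perm_mx s *m D^T) = (-1) ^+ s * \det (z *m D^T).
Proof.
apply: (mulfI (nS_neq0 R n)); rewrite -orientation homog_perm det_mulmx det_perm.
by rewrite [RHS]mulrCA -orientation [RHS]mulrCA mulrA.
Qed.

Lemma det_gram_eq0 (x : 'M[R]_(n, n.+1)) :
  (\det (gram x) == 0) = (\det (x *m D^T) == 0).
Proof.
rewrite det_gram sqrf_eq0 -(mulIr_eq0 _ (mulIf orientation_neq0)) orientation.
by rewrite mulf_eq0 (negPf (nS_neq0 _ _)).
Qed.

(** The gradient of the oriented volume [\det (x *m D^T)] as a function of the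
    position of the vertex [i0] ([facet_normal_spec]); the coefficient in front
    of the cofactor is that of [orientation]. *)
Definition facet_normal (x : 'M[R]_(n, n.+1)) : 'cV[R]_n :=
  \col_a (\det (homog D : 'M[R]_n.+1) / (n%:R + 1) *
          cofactor (homog x : 'M[R]_n.+1) (rshift 1 a) i0).

Lemma homog_update (x : 'M[R]_(n, n.+1)) k (w : 'cV[R]_n) b j :
  homog (x *m dil k + w *m e0) b j =
  homog (x *m dil k) b j + (col_mx (0 : 'M[R]_1) w) b 0 * (j == i0)%:R.
Proof.
rewrite /homog !mxE; case: splitP => b' _; rewrite !mxE; first by rewrite mul0r addr0.
by congr (_ + _); rewrite big_ord1 !mxE eqxx /=.
Qed.

(** The cofactors of a column do not involve that column. *)
Lemma cofactor_update (x : 'M[R]_(n, n.+1)) k (w : 'cV[R]_n) a :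
  cofactor (homog (x *m dil k + w *m e0) : 'M[R]_n.+1) a i0 =
  cofactor (homog x : 'M[R]_n.+1) a i0.
Proof.
rewrite /cofactor; congr (_ * \det _); apply/matrixP => b j.
rewrite mxE [LHS]mxE homog_update ![in RHS]mxE.
rewrite [lift i0 j == i0]eq_sym (negPf (neq_lift _ _)) mulr0 addr0.
rewrite /homog !mxE; case: splitP => b' _; rewrite !mxE//.
have li : lift i0 j != i0 by rewrite eq_sym neq_lift.
by have /colP/(_ b') := col_dilation x k li; rewrite !mxE.
Qed.

Lemma facet_normal_spec (x : 'M[R]_(n, n.+1)) k (w : 'cV[R]_n) :
  \det ((x *m dil k + w *m e0) *m D^T) =
  \det (x *m dil k *m D^T) + ((facet_normal x)^T *m w) 0 0.
Proof.
have nS := nS_neq0 R n.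
have ME k' w' : (n%:R + 1) * \det ((x *m dil k' + w' *m e0) *m D^T) =
    \det (homog D : 'M[R]_n.+1) *
    \sum_(a < n.+1) (homog (x *m dil k') a i0 + (col_mx (0 : 'M[R]_1) w' : 'cV[R]_n.+1) a 0) *
      cofactor (homog x : 'M[R]_n.+1) a i0.
  rewrite -orientation mulrC; congr (_ * _); rewrite (expand_det_col _ i0).
  apply: eq_bigr => a _.
  by rewrite cofactor_update homog_update eqxx mulr1.
have M0 := ME k 0; rewrite mul0mx addr0 in M0.
apply: (mulfI nS); rewrite mulrDr ME M0.
have -> : (n%:R + 1) * ((facet_normal x)^T *m w) 0 0 = \det (homog D : 'M[R]_n.+1) *
    \sum_(a < 1 + n) (col_mx (0 : 'M[R]_1) w) a 0 * cofactor (homog x : 'M[R]_n.+1) a i0.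
  rewrite big_split_ord /= big_ord1 col_mxEu [in RHS]mxE mul0r add0r [in LHS]mxE !mulr_sumr.
  apply: eq_bigr => a _; rewrite col_mxEd !mxE.
  by move: (cofactor _ _ _) (w a 0) => C1 C2; field.
rewrite -mulrDr -big_split /=; congr (_ * _); apply: eq_bigr => a _.
rewrite -mulrDl; congr (_ * _); rewrite col_mx0 [X in _ + X + _]mxE addr0//.
Qed.

Lemma dot_inj (v v' : 'cV[R]_n) :
  (forall w : 'cV_n, (v^T *m w) 0 0 = (v'^T *m w) 0 0) -> v = v'.
Proof.
move=> vv'; apply/colP => a; have := vv' (delta_mx a 0).
by rewrite -!colE !mxE.
Qed.

Lemma facet_normal_perm (x : 'M[R]_(n, n.+1)) (p : {perm 'I_n.+1}) : p i0 = i0 ->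
  facet_normal (x *m perm_mx p) = (-1) ^+ p *: facet_normal x.
Proof.
move=> pi; apply: dot_inj => w.
have E1 := facet_normal_spec (x *m perm_mx p) 0 w; have E2 := facet_normal_spec x 0 w.
have xp : x *m perm_mx p *m dil 0 = x *m dil 0 *m perm_mx p.
  by rewrite -!mulmxA perm_dilation.
rewrite xp -[w *m e0 in LHS](_ : w *m e0 *m perm_mx p = _) in E1; last first.
  by rewrite -mulmxA e0_perm pi.
rewrite -mulmxDl !det_perm_Dt E2 mulrDr in E1.
move/addrI: E1 => <-; rewrite [in RHS]linearZ /= -scalemxAl [RHS]mxE//.
Qed.

Lemma facet_sq_perm (x : 'M[R]_(n, n.+1)) (p : {perm 'I_n.+1}) j :
  facet_sq (x *m perm_mx p) j = facet_sq x (p^-1%g j).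
Proof.
rewrite /facet_sq !principal_cofactor gram_perm; congr (_ ^+ 2).
have detP (A : 'M[R]_n.+1) : \det ((perm_mx p)^T *m A *m perm_mx p) = \det A.
  by rewrite !det_mulmx det_tr mulrAC det_perm -expr2 sqrr_sign mul1r.
have dE : delta_mx j j = (perm_mx p)^T *m delta_mx (p^-1%g j) (p^-1%g j) *m perm_mx p :> 'M[R]_n.+1.
  have dd k : delta_mx k k = (delta_mx 0 k : 'rV[R]_n.+1)^T *m delta_mx 0 k.
    by rewrite trmx_delta mul_delta_mx.
  by rewrite (dd (p^-1%g j)) mulmxA -trmx_mul -mulmxA e0_perm permKV -dd.
by rewrite dE -mulmxDl -mulmxDr !detP.
Qed.

Lemma offset_perm (x : 'M[R]_(n, n.+1)) (p : {perm 'I_n.+1}) j :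
  offset (x *m perm_mx p) j = offset x (p^-1%g j).
Proof.
rewrite /offset gram_perm; congr (_ + _).
  by rewrite !det_mulmx det_tr mulrAC det_perm -expr2 sqrr_sign mul1r.
rewrite [RHS](reindex_inj (@perm_inj _ p^-1)); apply: eq_bigr => k _.
by rewrite !facet_sq_perm.
Qed.

Lemma collapse_num_perm (x : 'M[R]_(n, n.+1)) (p : {perm 'I_n.+1}) k :
  collapse_num (x *m perm_mx p) k = collapse_num x (p^-1%g k).
Proof.
rewrite /collapse_num [RHS](reindex_inj (@perm_inj _ p^-1)).
apply: eq_big => j; first by rewrite (inj_eq perm_inj).
by rewrite !offset_perm.
Qed.

Lemma collapse_perm (x : 'M[R]_(n, n.+1)) (p : {perm 'I_n.+1}) k :
  collapse (x *m perm_mx p) k = collapse x (p^-1%g k).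
Proof.
rewrite /collapse collapse_num_perm; congr (_ / _).
rewrite /collapse_den [RHS](reindex_inj (@perm_inj _ p^-1)).
apply: eq_big => j; first by rewrite (inj_eq perm_inj).
by rewrite !offset_perm.
Qed.

Lemma offset_orth (x : 'M[R]_(n, n.+1)) (h : 'M[R]_n) j : h *m h^T = 1%:M ->
  offset (h *m x) j = offset x j.
Proof. by move=> hh; rewrite /offset /facet_sq gram_orth. Qed.

(** Pushing the vertex [i0] towards the barycenter of the opposite facet, even
    until it reaches it, preserves embeddings: a dependency [l] of the image
    differs from the dependency [dilation k *m l] of [x] by a multiple of [eta],
    whose coefficients away from [i0] all have the same sign. *)
Lemma dilation_embedding (x : 'M[R]_(n, n.+1)) (mu : 'cV[R]_n.+1) (k : R) : 0 <= k <= 1 ->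
    (forall v, affine_dependency x v -> exists a, v = a *: mu) ->
    mu = 0 \/ (mu i0 0 < 0 /\ forall j, j != i0 -> 0 < mu j 0) ->
  E (x *m dil k).
Proof.
move=> /andP[k0 k1] ker mu_sgn; apply/(embedding_criterion n_gt2) => l [xl ol] l0.
have cardN0 : #|[set~ i0]%SET| = n by rewrite cardsC1 card_ord.
have pos_case (v : 'cV[R]_n.+1) : (forall j, j != i0 -> 0 < v j 0) ->
    (n <= #|pos_part_set v|)%N.
  move=> vp; rewrite -[X in (X <= _)%N]cardN0; apply/subset_leq_card/fintype.subsetP => j.
  by rewrite !inE => /vp.
have neg_case (v : 'cV[R]_n.+1) : (forall j, j != i0 -> v j 0 < 0) ->
    (n <= #|neg_part_set v|)%N.
  move=> vp; rewrite -[X in (X <= _)%N]cardN0; apply/subset_leq_card/fintype.subsetP => j.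
  by rewrite !inE => /vp.
have dep : affine_dependency x (dil k *m l).
  by split; rewrite mulmxA// ones_dilation.
have [a aE] := ker _ dep.
have lE j : (dil k *m l) j 0 = l j 0 + (1 - k) * l i0 0 * eta R i0 j 0.
  rewrite /dilation mulmxDl mul1mx -scalemxAl -mulmxA -rowE.
  rewrite (_ : row i0 l = (l i0 0)%:M) ?mul_mx_scalar; last first.
    by apply/matrixP => i i'; rewrite !ord1 !mxE mulr1n.
  by rewrite scalerA [LHS]mxE [X in _ + X]mxE.
have li0 : k * l i0 0 = a * mu i0 0.
  have := lE i0; rewrite aE mxE => ->; rewrite mxE eqxx; ring.
have lj j : j != i0 -> l j 0 = a * mu j 0 - (1 - k) * l i0 0 / n%:R.
  move=> ji; have := lE j; rewrite aE mxE => ->; rewrite mxE (negPf ji); ring.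
have nR : 0 < n%:R :> R by rewrite ltr0n.
have [li|li|li] := ltgtP (l i0 0) 0.
- left; apply: pos_case => j ji; rewrite lj//.
  have q0 : 0 <= - ((1 - k) * l i0 0 / n%:R).
    rewrite oppr_ge0 -mulrA mulr_ge0_le0 ?subr_ge0//.
    by rewrite mulr_le0_ge0 ?invr_ge0 ?ler0n// ltW.
  have [mu0|[mi mp]] := mu_sgn.
    move: li0; rewrite mu0 !mxE !mulr0 => /eqP; rewrite mulf_eq0 (lt_eqF li) orbF => /eqP kz.
    by rewrite add0r kz subr0 mul1r -mulNr divr_gt0// oppr_gt0.
  have [kz|kz] := eqVneq k 0.
    move: li0; rewrite kz mul0r => /esym/eqP; rewrite mulf_eq0 (lt_eqF mi) orbF => /eqP ->.
    by rewrite mul0r add0r subr0 mul1r -mulNr divr_gt0// oppr_gt0.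
  have kgt : 0 < k by rewrite lt_neqAle eq_sym kz.
  rewrite ltr_pwDl// mulr_gt0// ?mp//.
  have : a * mu i0 0 < 0 by rewrite -li0 pmulr_rlt0.
  by rewrite nmulr_llt0.
- right; apply: neg_case => j ji; rewrite lj//.
  have q0 : - ((1 - k) * l i0 0 / n%:R) <= 0.
    by rewrite oppr_le0 divr_ge0 ?mulr_ge0 ?subr_ge0// ltW.
  have [mu0|[mi mp]] := mu_sgn.
    move: li0; rewrite mu0 !mxE !mulr0 => /eqP; rewrite mulf_eq0 (gt_eqF li) orbF => /eqP kz.
    by rewrite add0r kz subr0 mul1r oppr_lt0 divr_gt0.
  have [kz|kz] := eqVneq k 0.
    move: li0; rewrite kz mul0r => /esym/eqP; rewrite mulf_eq0 (lt_eqF mi) orbF => /eqP ->.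
    by rewrite mul0r add0r subr0 mul1r oppr_lt0 divr_gt0.
  have kgt : 0 < k by rewrite lt_neqAle eq_sym kz.
  rewrite ltr_wnDr// pmulr_llt0 ?mp//.
  have : 0 < a * mu i0 0 by rewrite -li0 pmulr_rgt0.
  by rewrite nmulr_lgt0.
case/negP: l0; apply/eqP/colP => j; rewrite [RHS]mxE.
have [->//|ji] := eqVneq j i0.
rewrite lj// li mulr0 mul0r subr0; move: li0; rewrite li mulr0 => /esym/eqP.
rewrite mulf_eq0; case: mu_sgn => [->|[mi _]]; first by rewrite !mxE mulr0.
by rewrite (lt_eqF mi) orbF => /eqP ->; rewrite mul0r.
Qed.

Lemma nondegenerate_embedding (z : 'M[R]_(n, n.+1)) k : 0 <= k <= 1 ->
  \det (z *m D^T) != 0 -> E (z *m dil k).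
Proof.
move=> k01; rewrite -det_gram_eq0 => G0; apply: (@dilation_embedding _ 0) => //; last by left.
by move=> v /(nondegenerate_dependency G0) ->; exists 0; rewrite scale0r.
Qed.

(** For the embeddings in this set [i0] is the only vertex that can have a nonzero
    [collapse], and in particular the only one that can be an inner vertex. *)
Definition oriented_domain : set 'M[R]_(n, n.+1) :=
  [set x | 0 <= \det (x *m D^T)] `&`
  \bigcap_(k in [set k | k != i0]) [set x | collapse_num x k = 0].

Local Notation U := (E `&` oriented_domain).

(** The vertex [i0] is pushed into the opposite facet as far as [collapse]
    tells, and at the same time moved away from it along the normal vector, so
    that the result is nondegenerate ([oriented_simplex_det]) even if [x] is
    not. *)
Definition oriented_simplex (x : 'M[R]_(n, n.+1)) : 'M[R]_(n, n.+1) :=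
  x *m dil (1 - collapse x i0) + collapse x i0 *: (facet_normal x *m e0).

Lemma oriented_degenerate x : U x -> \det (x *m D^T) = 0 ->
  collapse x i0 = 1 /\ exists l, inner_vertex x i0 l.
Proof.
move=> [Ex [_ dx]] Y0.
have G0 : \det (gram x) = 0 by apply/eqP; rewrite det_gram_eq0 Y0.
have [i [l inn]] := degenerate_inner_vertex n_gt2 Ex G0.
have ci := inner_vertex_collapse n_gt2 Ex inn.
suff ii0 : i = i0 by rewrite -ii0; split => //; exists l.
apply/eqP/negPn/negP => ii0; have := dx i ii0 => /eqP; rewrite -(collapse_eq0 n_gt2)// ci.
by rewrite oner_eq0.
Qed.

Lemma oriented_nondegenerate x : U x -> \det (x *m D^T) != 0 ->
  0 < \det (x *m D^T) /\ collapse x i0 < 1.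
Proof.
move=> [Ex [dx _]] Y0; split; first by rewrite lt_neqAle eq_sym Y0.
by apply: (nondegenerate_collapse n_gt2) => //; rewrite det_gram_eq0.
Qed.

Lemma det_dilation_Dt (x : 'M[R]_(n, n.+1)) k :
  \det (x *m dil k *m D^T) = \det (x *m D^T) * \det (rhoD (dil k)).
Proof. by rewrite (mul_Dt_rho c_gt0 D_ones DtD) ?det_mulmx// ones_dilation. Qed.

Lemma facet_normal_sq (x : 'M[R]_(n, n.+1)) (a : R) :
  ((facet_normal x)^T *m (a *: facet_normal x)) 0 0 = a * sqlen (facet_normal x).
Proof. by rewrite -scalemxAr mxE. Qed.

Lemma sqlen_ge0 m (v : 'cV[R]_m) : 0 <= sqlen v.
Proof. by rewrite sqlen_sum sumr_ge0// => i _; exact: sqr_ge0. Qed.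

Lemma sqlen_eq0 m (v : 'cV[R]_m) : (sqlen v == 0) = (v == 0).
Proof.
rewrite sqlen_sum; apply/eqP/eqP => [/eqP|->].
  rewrite psumr_eq0 => [/allP v0|i _]; last exact: sqr_ge0.
  apply/colP => i; rewrite [RHS]mxE; have := v0 i (mem_index_enum i).
  by rewrite /= sqrf_eq0 => /eqP.
by rewrite big1// => i _; rewrite mxE expr0n.
Qed.

(** The facet opposite to the inner vertex is not degenerate, since the only
    affine dependency involves that vertex. *)
Lemma inner_vertex_normal x l : inner_vertex x i0 l -> facet_normal x != 0.
Proof.
move=> inn; have [dep li lp ker] := inn; have G0 := inner_vertex_det inn.
have H0 : \det (homog x : 'M[R]_n.+1) == 0 by move/eqP: G0; rewrite det_gram sqrf_eq0.
have /det0P[r r0 rH] := H0.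
have [m rm] : exists m, r 0 m != 0.
  apply/existsP; rewrite -negb_forall; apply: contra r0 => /forallP rz.
  by apply/eqP/rowP => m; rewrite (eqP (rz m)) mxE.
have cof_neq0 : cofactor (homog x : 'M[R]_n.+1) m i0 != 0.
  apply: (cofactor_kernel_neq0 (l := l) _ rH rm); last by rewrite lt_eqF.
  by move=> v Hv; apply: ker; rewrite homog_dependency; exact: Hv.
apply/eqP => nu0.
have cof0 (a : 'I_n) : cofactor (homog x : 'M[R]_n.+1) (rshift 1 a) i0 = 0.
  have /colP/(_ a) := nu0; rewrite !mxE => /eqP; rewrite mulf_eq0 [X in X || _]mulf_eq0 invr_eq0.
  by rewrite (negPf orientation_neq0) (negPf (nS_neq0 _ _)) /= => /eqP.
have : \det (homog (x *m dil 0 + 0 *m e0) : 'M[R]_n.+1) = 0.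
  rewrite mul0mx addr0 (_ : homog (x *m dil 0) = homog x *m dil 0).
    by rewrite det_mulmx (eqP H0) mul0r.
  by rewrite /homog mul_col_mx ones_dilation.
rewrite (expand_det_col _ i0); under eq_bigr do rewrite cofactor_update.
move=> sum0; have [m' mE|mE] := unliftP ord0 m.
  by move: cof_neq0; rewrite mE -rshift1 cof0 eqxx.
move: sum0; rewrite big_ord_recl [X in _ + X]big1 => [|a _]; last by rewrite -rshift1 cof0 mulr0.
rewrite addr0 => /eqP; rewrite mulf_eq0 -[X in cofactor _ X _]mE (negPf cof_neq0) orbF.
have -> : ord0 = lshift n 0 :> 'I_(1 + n) by apply: val_inj.
rewrite homog_update /homog !col_mxEu !mxE mul0r addr0 => /eqP.
by apply/eqP; rewrite oner_eq0.
Qed.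

Lemma oriented_simplex_det x : U x -> 0 < \det (oriented_simplex x *m D^T).
Proof.
move=> Ux; have [Ex _] := Ux; have /andP[t0 t1] := collapse01 n_gt2 i0 Ex.
rewrite /oriented_simplex scalemxAl facet_normal_spec det_dilation_Dt facet_normal_sq.
have [Y0|Y0] := eqVneq (\det (x *m D^T)) 0.
  have [-> [l inn]] := oriented_degenerate Ux Y0.
  rewrite Y0 mul0r add0r mul1r lt_neqAle eq_sym sqlen_eq0 sqlen_ge0 andbT.
  exact: inner_vertex_normal inn.
have [Ygt t_lt1] := oriented_nondegenerate Ux Y0.
apply: ltr_pwDl; last by rewrite mulr_ge0 ?sqlen_ge0.
apply: mulr_gt0 => //.
by apply: (det_rho_dilation_gt0 n_gt0 i0 c_gt0 D_ones DDt DtD); rewrite subr_gt0.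
Qed.

Lemma mulmx_dilation_mix (x : 'M[R]_(n, n.+1)) (s k : R) :
  x *m dil (1 - s + s * k) = (1 - s) *: x + s *: (x *m dil k).
Proof.
have -> : dil (1 - s + s * k) = (1 - s) *: 1%:M + s *: dil k.
  by apply/matrixP => i j; rewrite !mxE; ring.
by rewrite mulmxDr -!scalemxAr mulmx1.
Qed.

(** The path only moves the vertex [i0], by a dilation and a nonnegative multiple
    of the normal vector. *)
Lemma oriented_path x (s : R) : U x -> 0 <= s <= 1 ->
  E ((1 - s) *: x + s *: (oriented_simplex x *m dil (1 - collapse x i0))).
Proof.
move=> Ux /andP[s0 s1]; have [Ex _] := Ux; have /andP[t0 t1] := collapse01 n_gt2 i0 Ex.
set t := collapse x i0 in t0 t1 *.
have -> : (1 - s) *: x + s *: (oriented_simplex x *m dil (1 - t)) =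
    x *m dil (1 - s + s * ((1 - t) * (1 - t))) +
    (s * (t * (1 - t)) *: facet_normal x) *m e0.
  rewrite mulmx_dilation_mix /oriented_simplex -/t mulmxDl -(mulmxA x) dilationM.
  rewrite scalerDr addrA; congr (_ + _).
  rewrite -scalemxAl -(mulmxA (facet_normal x)) e0_dilation -scalemxAr !scalerA -scalemxAl.
  by congr (_ *: _); ring.
have [Y0|Y0] := eqVneq (\det (x *m D^T)) 0.
  have [tE [l inn]] := oriented_degenerate Ux Y0.
  have -> : t = 1 by [].
  rewrite subrr !mulr0 scale0r mul0mx addr0 addr0.
  have [dep li lp ker] := inn.
  apply: (dilation_embedding (mu := l)) => //; last by right.
  by rewrite subr_ge0 s1 lerBlDr lerDl.
have [Ygt t_lt1] := oriented_nondegenerate Ux Y0.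
rewrite -[X in E X]mulmx1 -(dilation1 R i0).
apply: nondegenerate_embedding; first by rewrite ler01 lexx.
rewrite facet_normal_spec det_dilation_Dt facet_normal_sq gt_eqF//.
have t'0 : 0 < 1 - t by rewrite subr_gt0.
have stt : 0 <= s * (t * (1 - t)) by rewrite mulr_ge0// mulr_ge0// ltW.
apply: ltr_pwDl; last by rewrite mulr_ge0 ?sqlen_ge0.
apply: mulr_gt0 => //.
apply: (det_rho_dilation_gt0 n_gt0 i0 c_gt0 D_ones DDt DtD).
have [->|sn0] := eqVneq s 0; first by rewrite mul0r addr0 subr0.
by rewrite ltr_wpDl ?subr_ge0// mulr_gt0 ?mulr_gt0// lt_neqAle eq_sym sn0.
Qed.

(** If a relabeling [p] moves [i0] then [collapse] vanishes on both sides. If it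
    fixes [i0] and is odd, both embeddings are degenerate, and the normal vector
    changes its sign: the simplices differ by a reflection in the facet. *)
Lemma oriented_relabel x (p : {perm 'I_n.+1}) : U x -> U (x *m perm_mx p) ->
  exists T, [/\ adm (collapse x i0) T, collapse (x *m perm_mx p) i0 = collapse x i0,
    oriented_simplex (x *m perm_mx p) = oriented_simplex x *m T &
    T *m dil (1 - collapse x i0) = dil (1 - collapse x i0) *m perm_mx p].
Proof.
move=> Ux Uxp; have [Ex [dx cx]] := Ux; have [Exp [dxp cxp]] := Uxp.
have c0 k y : E y -> collapse_num y k = 0 -> collapse y k = 0.
  by move=> Ey ck; apply/eqP; rewrite (collapse_eq0 n_gt2)// ck.
have [pi|pi] := eqVneq (p i0) i0; last first.
  have pVi : p^-1%g i0 != i0 by apply: contra pi => /eqP pVi; rewrite -{1}pVi permKV.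
  have tp : collapse (x *m perm_mx p) i0 = 0.
    by rewrite collapse_perm; apply: c0 => //; exact: cx.
  have t0 : collapse x i0 = 0.
    by rewrite -[i0](permK p) -collapse_perm; apply: c0 => //; exact: cxp.
  exists (perm_mx p); rewrite t0 tp subr0 dilation1 mulmx1 mul1mx; split => //.
    by right; split => //; exists p.
  by rewrite /oriented_simplex tp t0 !subr0 dilation1 !mulmx1 !scale0r !addr0.
have pVi : p^-1%g i0 = i0 by rewrite -{1}pi permK.
have tp : collapse (x *m perm_mx p) i0 = collapse x i0 by rewrite collapse_perm pVi.
have e0p : e0 *m perm_mx p = e0 by rewrite e0_perm pi.
have [odd_p|even_p] := boolP (odd_perm p); last first.
  exists (perm_mx p); rewrite tp perm_dilation//; split => //.
    by left; exists p => //; left.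
  rewrite /oriented_simplex tp facet_normal_perm// (negPf even_p) expr0 scale1r.
  by rewrite mulmxDl -!mulmxA perm_dilation// -scalemxAl -mulmxA e0p.
have Y0 : \det (x *m D^T) = 0.
  apply/eqP; rewrite eq_le dx andbT -oppr_ge0 -mulN1r.
  by have := dxp; rewrite /= det_perm_Dt odd_p expr1.
have [tE _] := oriented_degenerate Ux Y0.
exists (perm_mx p *m dil (-1)); rewrite tp tE subrr; split => //.
- by left; exists p => //; right.
- rewrite /oriented_simplex tp tE subrr facet_normal_perm// odd_p expr1 !scale1r scaleN1r.
  rewrite perm_dilation// (mulmxA _ (dil (-1))) mulmxDl -(mulmxA x (dil 0)) dilationM mul0r.
  rewrite -(mulmxA (facet_normal x)) e0_dilation scaleN1r mulmxN mulmxDl.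
  rewrite -(mulmxA x (dil 0)) -perm_dilation// mulmxA; congr (_ + _).
  by rewrite !mulNmx -mulmxA e0p.
by rewrite -mulmxA dilationM mulr0 perm_dilation.
Qed.

Lemma oriented_cover x : E x -> exists p : {perm 'I_n.+1}, oriented_domain (x *m perm_mx p).
Proof.
move=> Ex.
have [i iP] : exists i, forall k, k != i -> collapse_num x k = 0.
  have [/existsP[i ci]|/existsPn c0] := boolP [exists i, collapse_num x i != 0].
    by exists i => k; exact: collapse_neq0.
  by exists i0 => k _; apply/eqP; rewrite -[_ == _]negbK c0.
pose y := x *m perm_mx (tperm i i0).
have yP k : k != i0 -> collapse_num y k = 0.
  move=> ki; rewrite collapse_num_perm tpermV iP//.
  by apply: contra ki => /eqP ki; rewrite -[k](tpermK i i0) ki tpermL.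
have [dy|dy] := leP 0 (\det (y *m D^T)).
  by exists (tperm i i0); split => // k /yP.
have [a ai] := other_vertex n_gt2 i0; have [b ba bi] := third_vertex n_gt2 a i0.
exists (tperm i i0 * tperm a b)%g; rewrite perm_mxM mulmxA -/y; split => /=.
  by rewrite det_perm_Dt odd_tperm eq_sym ba expr1 mulN1r oppr_ge0 ltW.
move=> k /= ki; rewrite collapse_num_perm tpermV yP//.
apply: contra ki => /eqP ki; rewrite -[k](tpermK a b) ki tpermD//; by rewrite eq_sym.
Qed.

End SimplexSkeletonConfigurations.

(** * The homotopy equivalence for n + 1 points *)

Section SimplexSkeletonEquivalence.
Variables (R : realType) (n : nat).
Hypothesis n_gt2 : (2 < n)%N.
Local Notation X := (skeleton (n - 2) (full_simplex 'I_n.+1)).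
Local Notation E := (@embedding_space R n n.+1 X).
Local Notation ones := (const_mx 1 : 'rV[R]_n.+1).
Let n_gt0 : (0 < n)%N. Proof. exact: ltn_trans n_gt2. Qed.

Lemma cvg_gram N (T : Type) (F : set_system T) {FF : Filter F} (f : T -> 'M[R]_(n, N)) x :
  f y @[y --> F] --> x -> gram (f y) @[y --> F] --> gram x.
Proof.
move=> fx; have fh : homog (f y) @[y --> F] --> homog x.
  by apply: cvg_col_mx => //; exact: cvg_cstmx.
by apply: cvg_mulmx => //; exact: cvg_trmx.
Qed.

Lemma gram_continuous N (x : 'M[R]_(n, N)) : gram y @[y --> x] --> gram x.
Proof. by apply: (@cvg_gram N _ (nbhs x) _ id x). Qed.

Lemma facet_sq_continuous j : continuous (fun x : 'M[R]_(n, n.+1) => facet_sq x j).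
Proof.
move=> x; have cg := @gram_continuous _ x.
have cc : cofactor (gram y) j j @[y --> x] --> cofactor (gram x) j j.
  exact: (@cvg_cofactor R _ (nbhs x) _ n.+1 (fun y => gram y) (gram x) j j cg).
exact: (cvgM cc cc).
Qed.

Lemma offset_continuous j : continuous (fun x : 'M[R]_(n, n.+1) => offset x j).
Proof.
move=> x; have cg := @gram_continuous _ x.
have cd : \det (gram y) @[y --> x] --> \det (gram x).
  exact: (@cvg_det R _ (nbhs x) _ n.+1 (fun y => gram y) (gram x) cg).
have cd2 : \det (gram y) ^+ 2 @[y --> x] --> \det (gram x) ^+ 2 by exact: (cvgM cd cd).
apply: (cvgD cd2).
apply: cvg_sumr => k _; apply: cvg_maxr; first exact: cvg_cst.
by apply: cvgB; exact: facet_sq_continuous.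
Qed.

Lemma collapse_num_continuous k : continuous (fun x : 'M[R]_(n, n.+1) => collapse_num x k).
Proof.
move=> x; apply: (@cvg_prodr _ _ (nbhs x) _) => j _; apply: cvg_maxr; first exact: cvg_cst.
by apply: cvgB; exact: offset_continuous.
Qed.

Lemma collapse_continuous k x : E x -> collapse y k @[y --> x] --> collapse x k.
Proof.
move=> Ex; have cn := @collapse_num_continuous k x; apply: (cvgM cn).
apply: cvgV; first by rewrite gt_eqF// (collapse_den_gt0 n_gt2).
by apply: (@cvg_prodr _ _ (nbhs x) _) => j _; apply: cvgD; exact: offset_continuous.
Qed.

Variables (i0 : 'I_n.+1) (c : R) (D : 'M[R]_(n, n.+1)).
Hypothesis c_gt0 : 0 < c.
Hypothesis D_ones : D *m ones^T = 0.
Hypothesis DDt : D *m D^T = c%:M.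
Hypothesis DtD : D^T *m D = c *: (1%:M - (n%:R + 1)^-1 *: (ones^T *m ones)).
Local Notation e0 := (delta_mx 0 i0 : 'rV[R]_n.+1).
Local Notation dil := (@dilation R n i0).
Local Notation adm := (@admissible R n i0).
Local Notation shift := (shifted i0 D).
Local Notation rhoD := (rho c D).
Local Notation u := (col i0 D).
Local Notation normal := (facet_normal i0 D).
Local Notation domain := (oriented_domain i0 D).
Local Notation U := (E `&` domain).

Lemma facet_normal_continuous : continuous (normal : 'M[R]_(n, n.+1) -> 'cV[R]_n).
Proof.
move=> x; apply/(@cvg_mxP _ _ (nbhs x) _) => a j; rewrite mxE.
under eq_cvg do rewrite mxE.
apply: (@cvgM _ _ (nbhs x) _); first exact: cvg_cst.
apply: (@cvg_cofactor R _ (nbhs x) _ n.+1 (fun y => homog y : 'M[R]_n.+1)).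
apply: (@cvg_col_mx _ _ (nbhs x) _ _ _ _ (fun=> ones) id); first exact: cvg_cstmx.
exact: cvg_id.
Qed.

Lemma oriented_simplex_continuous x : E x ->
  oriented_simplex i0 D y @[y --> x] --> oriented_simplex i0 D x.
Proof.
move=> Ex; have cc := collapse_continuous (k := i0) Ex.
apply: (@cvg_addmx _ _ (nbhs x) _).
  apply: (@cvg_mulmx _ _ (nbhs x) _ _ _ _ id); first exact: cvg_id.
  apply: (@cvg_addmx _ _ (nbhs x) _); first exact: cvg_cstmx.
  apply: (@cvg_scalemx _ _ (nbhs x) _); last exact: cvg_cstmx.
  by apply: cvgB; [exact: cvg_cst|apply: cvgB => //; exact: cvg_cst].
apply: (@cvg_scalemx _ _ (nbhs x) _) => //; apply: (@cvg_mulmx _ _ (nbhs x) _); last exact: cvg_cstmx.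
exact: facet_normal_continuous.
Qed.

Lemma det_mulmx_continuous m (B : 'M[R]_(m, n)) :
  continuous (fun x : 'M[R]_(n, m) => \det (x *m B)).
Proof.
move=> x; apply: (@cvg_det _ _ (nbhs x) _ _ (fun x => x *m B)).
apply: (@cvg_mulmx _ _ (nbhs x) _ _ _ _ id); first exact: cvg_id.
exact: cvg_cstmx.
Qed.

Lemma oriented_domain_closed : closed domain.
Proof.
apply: closedI.
  have cd := @det_mulmx_continuous _ D^T.
  exact: ((continuous_closedP _).1 cd [set r | 0 <= r] (@closed_ge _ _)).
apply: closed_bigI => k _.
exact: ((continuous_closedP _).1 (@collapse_num_continuous k) [set r | r = 0] (@closed_eq _ _)).
Qed.

Local Notation simplex := (oriented_simplex i0 D).
Local Notation model q t := (q *m shift t *m dil (1 - t)).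
Local Notation uut := (u *m u^T).

Lemma dilation_continuous : continuous (fun t : R => dil (1 - t)).
Proof.
move=> t; apply: (@cvg_addmx _ _ (nbhs t) _); first exact: cvg_cstmx.
apply: (@cvg_scalemx _ _ (nbhs t) _); last exact: cvg_cstmx.
apply: (@cvgB _ _ _ (nbhs t)); first exact: cvg_cst.
by apply: (@cvgB _ _ _ (nbhs t)); [exact: cvg_cst|exact: cvg_id].
Qed.

Lemma dilation_adm (t : R) T : adm t T ->
  exists p : {perm 'I_n.+1}, T *m dil (1 - t) = dil (1 - t) *m perm_mx p.
Proof.
case=> [[s si [->|[-> ->]]]|[-> [s ->]]]; exists s.
- exact: perm_dilation.
- by rewrite subrr -mulmxA dilationM mulr0 perm_dilation.
- by rewrite subr0 dilation1 mulmx1 mul1mx.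
Qed.

Lemma sqlen_u_gt0 : 0 < sqlen u.
Proof.
by rewrite (sqlen_u i0 DtD) divr_gt0 ?mulr_gt0 ?natr1 ?ltr0n.
Qed.

Lemma det_scale_gt0 (A : 'M[R]_n) (a : R) : 0 < a -> 0 < \det A -> 0 < \det (a *: A).
Proof. by move=> a0 A0; rewrite detZ mulr_gt0// exprn_gt0. Qed.

Lemma D_dilation_Dt k : D *m dil k *m D^T = c *: rhoD (dil k).
Proof. by rewrite /rho scalerA divff ?scale1r// gt_eqF. Qed.

Lemma D_dilation_Dt_rank1 k :
  D *m dil k *m D^T = c%:M - ((1 - k) * (n%:R + 1) / n%:R) *: uut.
Proof.
rewrite D_dilation_Dt (rho_dilation n_gt0 i0 c_gt0 D_ones DDt) scalerBr scale_scalar_mx mulr1.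
by rewrite scalerA; congr (_ - _ *: _); field; rewrite n_neq0// gt_eqF.
Qed.

Lemma det_rho_dilation0 : \det (rhoD (dil 0)) = 0.
Proof.
have h := rho_dilation_u n_gt0 i0 c_gt0 D_ones DtD 0; rewrite scale0r in h.
apply/eqP; rewrite -det_tr; apply/det0P; exists u^T.
  rewrite -trmx0 (inj_eq trmx_inj); apply/eqP => u0.
  by have := sqlen_u_gt0; rewrite u0 /sqlen mulmx0 mxE ltxx.
by rewrite -trmx_mul h trmx0.
Qed.

Lemma model_Dt (q : 'M[R]_n) (t : R) k : q *m shift t *m dil k *m D^T = q *m (D *m dil k *m D^T).
Proof. by rewrite -(mulmxA q) -(mulmxA q) (shifted_mul_Dt _ D_ones) ?ones_dilation. Qed.

Lemma model_det (q : 'M[R]_n) (t : R) : SO q ->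
  \det (model q t *m D^T) = c ^+ n * \det (rhoD (dil (1 - t))).
Proof. by move=> [_ q1]; rewrite model_Dt det_mulmx q1 mul1r D_dilation_Dt detZ. Qed.

Lemma model_E (q : 'M[R]_n) (t : R) : SO q -> 0 <= t <= 1 -> E (model q t).
Proof.
move=> soq t01; have t'01 : 0 <= 1 - t <= 1 by apply: segment01.
apply: (nondegenerate_embedding n_gt2 i0 c_gt0 D_ones DDt) => //.
rewrite -[q *m _]mulmx1 -(dilation1 R i0) model_Dt det_mulmx dilation1 mulmx1 DDt.
by case: soq => _ ->; rewrite mul1r det_scalar expf_neq0// gt_eqF.
Qed.

(** A symmetry of the model is both a relabeling and a rotation, and rotations
    do not change the offsets. *)
Lemma model_offset (q : 'M[R]_n) (t : R) (s : {perm 'I_n.+1}) j : SO q -> s i0 = i0 \/ t = 0 ->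
  offset (model q t) (s j) = offset (model q t) j.
Proof.
move=> [qq _] st; have sh : shift t *m perm_mx s = rhoD (perm_mx s) *m shift t.
  apply/esym/(admissible_shifted n_gt0 c_gt0 D_ones DtD).
  by case: st => [si|->]; [left; exists s => //; left|right; split => //; exists s].
have sd : dil (1 - t) *m perm_mx s = perm_mx s *m dil (1 - t).
  case: st => [si|->]; first by rewrite perm_dilation.
  by rewrite subr0 dilation1 mulmx1 mul1mx.
have qtq := mulmx1C qq.
pose h := q *m rhoD (perm_mx s) *m q^T.
have hh : h *m h^T = 1%:M.
  rewrite /h !trmx_mul trmxK -!mulmxA (mulmxA q^T) qtq mul1mx.
  rewrite (mulmxA (rhoD _)) (rho_perm_orth c_gt0 D_ones DDt DtD) mul1mx.
  exact: qq.
have xs : model q t *m perm_mx s = h *m model q t.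
  rewrite /h -!mulmxA (mulmxA q^T) qtq mul1mx sd (mulmxA (shift t)) sh.
  by rewrite !mulmxA.
by have := offset_perm (model q t) s (s j); rewrite permK xs offset_orth.
Qed.

Lemma collapse_num_offset (x : 'M[R]_(n, n.+1)) k l : l != k ->
  offset x l = offset x k -> collapse_num x k = 0.
Proof.
move=> lk lE; rewrite /collapse_num (bigD1 l)//= lE subrr maxxx mul0r.
by [].
Qed.

Lemma model_domain (q : 'M[R]_n) (t : R) : SO q -> 0 <= t <= 1 -> domain (model q t).
Proof.
move=> soq /andP[t0 t1]; split.
  rewrite /= model_det// mulr_ge0 ?exprn_ge0 ?(ltW c_gt0)//.
  have [->|tn1] := eqVneq t 1; first by rewrite subrr det_rho_dilation0.
  apply/ltW/(det_rho_dilation_gt0 n_gt0 i0 c_gt0 D_ones DDt DtD).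
  by rewrite subr_gt0 lt_neqAle tn1.
move=> k /= ki.
have [l li lk] := third_vertex n_gt2 i0 k.
apply: (collapse_num_offset lk).
rewrite -{1}(tpermL k l); apply: model_offset => //; left.
by rewrite tpermD// eq_sym.
Qed.

Lemma model_height0 (q : 'M[R]_n) : SO q -> collapse (model q 0) i0 = 0.
Proof.
move=> soq; have b0 : 0 <= (0 : R) <= 1 by rewrite lexx ler01.
have Em : E (model q 0) by exact: model_E.
apply/eqP; rewrite (collapse_eq0 n_gt2)//.
have [l li] := other_vertex n_gt2 i0.
apply/eqP; apply: (collapse_num_offset li).
by rewrite -{1}(tpermL i0 l); apply: model_offset => //; right.
Qed.

Lemma model_height1 (q : 'M[R]_n) : SO q -> collapse (model q 1) i0 = 1.
Proof.
move=> soq; have b1 : 0 <= (1 : R) <= 1 by rewrite lexx ler01.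
have Um : U (model q 1) by split; [exact: model_E|exact: model_domain].
have d0 : \det (model q 1 *m D^T) = 0.
  by rewrite model_det// subrr det_rho_dilation0 mulr0.
by have [] := oriented_degenerate n_gt2 c_gt0 D_ones DDt Um d0.
Qed.

Lemma facet_normal_orth (q : 'M[R]_n) x : SO q -> normal (q *m x) = q *m normal x.
Proof.
move=> [qq q1]; apply: dot_inj => w; have qtq := mulmx1C qq.
have E1 := facet_normal_spec i0 D_ones (q *m x) 0 w.
have E2 := facet_normal_spec i0 D_ones x 0 (q^T *m w).
have e : q *m x *m dil 0 + w *m e0 = q *m (x *m dil 0 + q^T *m w *m e0).
  by rewrite mulmxDr !mulmxA qq mul1mx.
rewrite e -mulmxA det_mulmx q1 mul1r E2 -!(mulmxA q) det_mulmx q1 mul1r in E1.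
by move/addrI: E1 => <-; rewrite trmx_mul mulmxA.
Qed.

Lemma facet_normal_dilation x k : normal (x *m dil k) = normal x.
Proof.
apply: dot_inj => w; have := facet_normal_spec i0 D_ones (x *m dil k) 0 w.
by rewrite -(mulmxA x) dilationM mulr0 (facet_normal_spec _ D_ones) => /addrI.
Qed.

Lemma facet_normal_shift (t : R) : normal (shift t) = normal D.
Proof.
apply: dot_inj => w; have := facet_normal_spec i0 D_ones (shift t) 0 w.
rewrite mulmxDl (shifted_mul_Dt _ D_ones) ?ones_dilation// -mulmxDl.
by rewrite (facet_normal_spec _ D_ones) => /addrI.
Qed.

(** By [facet_normal_spec] it is enough to compute determinants of rank one
    perturbations of the projection to the facet: they vanish for perturbations
    parallel to the facet, and the one along [u] is a dilation. *)
Lemma facet_normal_D : exists2 k, 0 < k & normal D = k *: u.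
Proof.
have spec w : \det (c *: rhoD (dil 0) + w *m u^T) = ((normal D)^T *m w) 0 0.
  have := facet_normal_spec i0 D_ones D 0 w; rewrite mulmxDl -(mulmxA w) col_Dt.
  by rewrite D_dilation_Dt detZ det_rho_dilation0 mulr0 add0r.
have un0 : sqlen u != 0 by rewrite gt_eqF// sqlen_u_gt0.
have perp (y : 'cV[R]_n) : u^T *m y = 0 -> ((normal D)^T *m y) 0 0 = 0.
  move=> uy; rewrite -spec; set S0 := c *: _.
  have Sy : S0 *m y = c *: y.
    rewrite /S0 -D_dilation_Dt D_dilation_Dt_rank1 mulmxBl mul_scalar_mx -scalemxAl.
    by rewrite -(mulmxA u) uy mulmx0 scaler0 subr0.
  have -> : S0 + y *m u^T = S0 *m (1%:M + c^-1 *: (y *m u^T)).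
    rewrite mulmxDr mulmx1 -scalemxAr mulmxA Sy -scalemxAl scalerA mulVf ?scale1r//.
    by rewrite gt_eqF.
  by rewrite det_mulmx /S0 detZ det_rho_dilation0 mulr0 mul0r.
pose nu := ((normal D)^T *m u) 0 0.
have nu_gt0 : 0 < nu.
  rewrite /nu -spec.
  have -> : c *: rhoD (dil 0) + uut = c *: rhoD (dil (n%:R / (n%:R + 1))).
    rewrite -!D_dilation_Dt !D_dilation_Dt_rank1 -addrA; congr (_ + _).
    rewrite -!(scaleNr _ uut) -[X in _ + X = _]scale1r -scalerDl; congr (_ *: _).
    by field; rewrite n_neq0// nS_neq0.
  apply: det_scale_gt0 => //.
  apply: (det_rho_dilation_gt0 n_gt0 i0 c_gt0 D_ones DDt DtD).
  by rewrite natr1 divr_gt0 ?ltr0n.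
exists (nu / sqlen u); first by rewrite divr_gt0// sqlen_u_gt0.
apply: dot_inj => w; set a := (u^T *m w) 0 0.
have wE : w = (a / sqlen u) *: u + (w - (a / sqlen u) *: u) by rewrite addrC subrK.
have uw0 : u^T *m (w - (a / sqlen u) *: u) = 0.
  apply/matrixP => i j; rewrite !ord1 mulmxBr -scalemxAr [RHS]mxE.
  have e : (u^T *m u) = (sqlen u)%:M by rewrite [LHS]mx11_scalar.
  have e' : (u^T *m w) = a%:M by rewrite [LHS]mx11_scalar.
  by rewrite e e' scale_scalar_mx divfK// subrr mxE.
rewrite {1}wE mulmxDr [LHS]mxE (perp _ uw0) addr0 -scalemxAr [LHS]mxE -/nu.
rewrite linearZ /= -scalemxAl [RHS]mxE -/a.
by rewrite mulrAC [RHS]mulrAC [a * nu]mulrC.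
Qed.

(** The shape of the model simplices is governed by one number, the distance of
    the vertex [i0] from the opposite facet. *)
Lemma model_simplex_ratio : exists2 k, 0 < k &
  forall (q : 'M[R]_n) (t : R), SO q ->
    simplex (model q t) *m D^T =
    q *m (D *m dil ((1 - t) * (1 - collapse (model q t) i0) +
                    collapse (model q t) i0 * k) *m D^T).
Proof.
have [k k0 nu] := facet_normal_D.
exists (k * n%:R / (n%:R + 1)); first by rewrite divr_gt0 ?mulr_gt0 ?natr1 ?ltr0n.
move=> q t soq; rewrite /oriented_simplex facet_normal_dilation facet_normal_orth//.
rewrite facet_normal_shift nu; move: (collapse _ _) => r.
rewrite mulmxDl -(mulmxA (q *m _)) dilationM model_Dt.
have -> : r *: (q *m (k *: u) *m e0) *m D^T = q *m ((r * k) *: uut).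
  by rewrite -scalemxAl -(mulmxA _ e0) col_Dt -scalemxAr -scalemxAl scalerA -mulmxA scalemxAr.
rewrite -mulmxDr !D_dilation_Dt_rank1; congr (_ *m _).
rewrite -addrA; congr (_ + _); rewrite -!(scaleNr _ uut) -scalerDl; congr (_ *: _).
by field; rewrite n_neq0// nS_neq0.
Qed.

Theorem simplex_skeleton_equivalence :
  homotopy_equivalent R (configuration_space R n X) (rotation_cylinder D i0).
Proof.
have [k k0 kE] := model_simplex_ratio.
apply: (@configuration_space_equivalent R n n.+1 n_gt0 i0 c D c_gt0 D_ones DDt DtD X
  (skeleton_aut n_gt2) (@embedding_perm R n n.+1 n_gt2)
  (fun t => dil (1 - t)) dilation_continuous _ domain (fun x => collapse x i0) simplex
  oriented_domain_closed _ _ _ _ _ _ _ _ _ model_height0 model_height1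
  (fun t r => (1 - t) * (1 - r) + r * k)).
- move=> z t t01 dz; apply: (nondegenerate_embedding n_gt2 i0 c_gt0 D_ones DDt).
    exact: segment01.
  by rewrite gt_eqF.
- exact: oriented_cover.
- by move=> x [Ex _]; exact: collapse_continuous.
- by move=> x [Ex _]; exact: oriented_simplex_continuous.
- by move=> x [Ex _]; exact: collapse01.
- exact: (oriented_simplex_det n_gt2 c_gt0 D_ones DDt DtD).
- exact: (oriented_path n_gt2 c_gt0 D_ones DDt DtD).
- exact: (oriented_relabel n_gt2 c_gt0 D_ones DDt).
- by move=> t T _; exact: dilation_adm.
- exact: model_domain.
- move=> p; apply: (@cvgD _ _ _ (nbhs p)); last first.
    by apply: (@cvgM _ _ (nbhs p)); [exact: snd_continuous|exact: cvg_cst].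
  apply: (@cvgM _ _ (nbhs p)); apply: (@cvgB _ _ _ (nbhs p)).
  + exact: cvg_cst.
  + exact: fst_continuous.
  + exact: cvg_cst.
  + exact: snd_continuous.
- move=> q t soq t01; have Em := model_E soq t01.
  have /andP[r0 r1] := collapse01 n_gt2 i0 Em; have /andP[t0 t1] := t01.
  have [rz|rn] := eqVneq (collapse (model q t) i0) 0.
    rewrite rz mul0r addr0 subr0 mulr1 subr_gt0 lt_neqAle t1 andbT.
    apply/eqP => tE; move: rz; rewrite tE model_height1// => /eqP.
    by rewrite oner_eq0.
  by rewrite ltr_wpDl ?mulr_ge0 ?subr_ge0// mulr_gt0// lt_neqAle eq_sym rn.
- by rewrite !subr0 mulr1 mul0r addr0.
- by move=> q t soq _; exact: kE.
Qed.

End SimplexSkeletonEquivalence.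

(** * Configurations with two more vertices than the dimension *)

Section DependencyLine.
Variables (R : realType) (n : nat).
Hypothesis n_gt2 : (2 < n)%N.
Local Notation X := (skeleton (n - 2) (full_simplex 'I_(1 + n.+1))).
Local Notation E := (@embedding_space R n (1 + n.+1) X).

Lemma dependency_comb N (x : 'M[R]_(n, N)) a b (s t : R) :
  affine_dependency x a -> affine_dependency x b -> affine_dependency x (s *: a + t *: b).
Proof.
by move=> [xa oa] [xb ob]; split; rewrite mulmxDr -!scalemxAr ?xa ?xb ?oa ?ob !scaler0 addr0.
Qed.

Lemma pos_part_setN N (l : 'cV[R]_N) : pos_part_set (- l) = neg_part_set l.
Proof. by apply/setP => i; rewrite !inE mxE oppr_gt0. Qed.

Lemma neg_part_setN N (l : 'cV[R]_N) : neg_part_set (- l) = pos_part_set l.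
Proof. by apply/setP => i; rewrite !inE mxE oppr_lt0. Qed.

Lemma part_sets_card N (l : 'cV[R]_N) : (#|pos_part_set l| + #|neg_part_set l| <= N)%N.
Proof.
rewrite -cardsUI (_ : _ :&: _ = finset.set0) ?cards0 ?addn0.
  by rewrite -[X in (_ <= X)%N](card_ord N) max_card.
by apply/setP => i; rewrite !inE; case: ltgtP.
Qed.

(** A segment from a dependency with many positive coefficients to one with many
    negative coefficients has to pass through 0: some coefficient changes sign,
    and cutting the segment where it vanishes reduces the number of sign
    changes. *)
Lemma no_sign_change x (a b : 'cV[R]_(1 + n.+1)) : E x ->
    affine_dependency x a -> affine_dependency x b ->
    (n <= #|pos_part_set a|)%N -> (n <= #|neg_part_set b|)%N ->
  exists s t, [/\ 0 < s, 0 < t & s *: a + t *: b = 0].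
Proof.
move=> /(embedding_criterion n_gt2) crit.
have [k] := ubnP #|pos_part_set a :&: neg_part_set b|%SET.
elim: k a b => // k IHk a b; rewrite ltnS => abk da db pa nb.
have [i] : exists i, i \in (pos_part_set a :&: neg_part_set b)%SET.
  apply/card_gt0P; have := cardsUI (pos_part_set a) (neg_part_set b).
  have : (#|pos_part_set a :|: neg_part_set b|%SET <= 1 + n.+1)%N.
    by rewrite -[X in (_ <= X)%N](card_ord (1 + n.+1)) max_card.
  move: n_gt2 pa nb; move: #|_ :|: _| #|_ :&: _| #|_| #|_| => p q r s; lia.
rewrite !inE => /andP[ai bi].
pose v := - b i 0 *: a + a i 0 *: b.
have vi : v i 0 = 0 by rewrite !mxE; ring.
have nbi : 0 < - b i 0 by rewrite oppr_gt0.
have dv : affine_dependency x v by exact: dependency_comb.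
have [v0|v0] := eqVneq v 0; first by exists (- b i 0), (a i 0).
have [pv|nv] := crit _ dv v0.
  have vbk : (#|pos_part_set v :&: neg_part_set b|%SET < k)%N.
    apply: leq_trans abk; apply/proper_card/properP; split.
      apply/fintype.subsetP => j; rewrite !inE => /andP[vj bj]; rewrite bj andbT.
      move: vj; rewrite !mxE => vj; rewrite -(pmulr_rgt0 _ nbi).
      by rewrite (lt_le_trans vj)// gerDl mulr_ge0_le0 ?ltW.
    by exists i; rewrite !inE ?ai ?bi// vi ltxx.
  have [s [t [s0 t0 st]]] := IHk v b vbk dv db pv nb.
  exists (s * - b i 0), (s * a i 0 + t); split; [exact: mulr_gt0|by rewrite addr_gt0 ?mulr_gt0|].
  by rewrite -st scalerDr !scalerA scalerDl addrA.
have avk : (#|pos_part_set a :&: neg_part_set v|%SET < k)%N.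
  apply: leq_trans abk; apply/proper_card/properP; split.
    apply/fintype.subsetP => j; rewrite !inE => /andP[aj vj]; rewrite aj /=.
    move: vj; rewrite !mxE => vj; rewrite -(pmulr_rlt0 _ ai).
    by rewrite (le_lt_trans _ vj)// lerDr mulr_ge0 ?ltW.
  by exists i; rewrite !inE ?ai ?bi// vi ltxx andbF.
have [s [t [s0 t0 st]]] := IHk a v avk da dv pa nv.
exists (s + t * - b i 0), (t * a i 0); split; [by rewrite addr_gt0 ?mulr_gt0|exact: mulr_gt0|].
by rewrite -st scalerDr !scalerA scalerDl addrA.
Qed.

(** Of two dependencies that are not proportional, suitable multiples would
    contradict [no_sign_change]. *)
Lemma embedding_dependency x : E x -> exists l : 'cV[R]_(1 + n.+1),
  [/\ affine_dependency x l, (n <= #|pos_part_set l|)%N &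
      forall v, affine_dependency x v -> exists a, v = a *: l].
Proof.
move=> Ex; have crit := (embedding_criterion n_gt2 x).1 Ex.
have [l l0 dl] : exists2 l : 'cV[R]_(1 + n.+1), l != 0 & affine_dependency x l.
  have : kermx (homog x)^T != 0.
    rewrite -mxrank_eq0 mxrank_ker subn_eq0 -ltnNge.
    by apply: leq_ltn_trans (rank_leq_col _) _.
  case/rowV0Pn => v /sub_kermxP vh v0; exists v^T.
    by rewrite -trmx0 (inj_eq trmx_inj).
  by apply/homog_dependency; rewrite -[homog x]trmxK -trmx_mul vh trmx0.
have [m [dm pm m0]] : exists m : 'cV[R]_(1 + n.+1),
    [/\ affine_dependency x m, (n <= #|pos_part_set m|)%N & m != 0].
  have [pl|nl] := crit _ dl l0; first by exists l.
  exists (- l); rewrite pos_part_setN oppr_eq0; split => //.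
  by have := dependency_comb (-1) 0 dl dl; rewrite scale0r addr0 scaleN1r.
exists m; split => // v dv.
have [->|v0] := eqVneq v 0; first by exists 0; rewrite scale0r.
have [pv|nv] := crit _ dv v0.
  have dNv : affine_dependency x (- v).
    by have := dependency_comb (-1) 0 dv dv; rewrite scale0r addr0 scaleN1r.
  have nNv : (n <= #|neg_part_set (- v)|)%N by rewrite neg_part_setN.
  have [s [t [s0 t0 /eqP]]] := no_sign_change Ex dm dNv pm nNv.
  rewrite scalerN subr_eq0 => /eqP st; exists (s / t).
  by rewrite mulrC -scalerA st scalerA mulVf ?gt_eqF// scale1r.
have [s [t [s0 t0 /eqP]]] := no_sign_change Ex dm dv pm nv.
rewrite addrC addr_eq0 => /eqP st; exists (- (s / t)).
by rewrite scaleNr mulrC -scalerA -scalerN -st scalerA mulVf ?gt_eqF// scale1r.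
Qed.

Definition adj_sq N (x : 'M[R]_(n, N)) : 'M[R]_N := \adj (gram x) *m \adj (gram x).

(** The products of the coefficients of the dependency are continuous functions
    of the embedding, although the dependency is only defined up to a factor. *)
Lemma adj_sqE N (x : 'M[R]_(n, N)) l : affine_dependency x l -> l != 0 ->
    (forall v, affine_dependency x v -> exists a, v = a *: l) ->
  exists2 k, 0 < k & forall i j, adj_sq x i j = k * (l i 0 * l j 0).
Proof.
move=> dl l0 ker.
have [k k0 adjE] : exists2 k, k != 0 & forall i j, (\adj (gram x)) i j = k * (l i 0 * l j 0).
  apply: adj_corank1 => //; first exact: gram_sym.
    by move=> v /gram_dependency; exact: ker.
  exact/gram_dependency.
exists (k ^+ 2 * sqlen l).
  rewrite mulr_gt0//; first by rewrite lt_neqAle eq_sym sqrf_eq0 k0 sqr_ge0.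
  by rewrite lt_neqAle eq_sym sqlen_eq0 l0 sqlen_ge0.
move=> i j; rewrite mxE; under eq_bigr do rewrite !adjE.
rewrite sqlen_sum mulr_sumr mulr_suml; apply: eq_bigr => a _.
ring.
Qed.

End DependencyLine.

(** * The homotopy equivalence for n + 2 points *)

Section ConeConfigurations.
Variables (R : realType) (n : nat).
Hypothesis n_gt2 : (2 < n)%N.
Local Notation X := (skeleton (n - 2) (full_simplex 'I_(1 + n.+1))).
Local Notation E := (@embedding_space R n (1 + n.+1) X).
Local Notation ones := (const_mx 1 : 'rV[R]_n.+1).
Let n_gt0 : (0 < n)%N. Proof. exact: ltn_trans n_gt2. Qed.
Local Notation apex := (lshift n.+1 (0 : 'I_1)).
Local Notation base := (@rshift 1 n.+1).

Variables (i0 : 'I_n.+1) (c : R) (D : 'M[R]_(n, n.+1)).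
Hypothesis c_gt0 : 0 < c.
Hypothesis D_ones : D *m ones^T = 0.
Hypothesis DDt : D *m D^T = c%:M.
Hypothesis DtD : D^T *m D = c *: (1%:M - (n%:R + 1)^-1 *: (ones^T *m ones)).
Local Notation e0 := (delta_mx 0 i0 : 'rV[R]_n.+1).
Local Notation eta := (@eta R n i0).
Local Notation dil := (@dilation R n i0).
Local Notation adm := (@admissible R n i0).
Local Notation shift := (shifted i0 D).

(** [n + 2] points of which the last [n + 1] are affinely independent are given
    by these and by the barycentric coordinates of the first one. *)
Definition cone (z : 'M[R]_(n, n.+1)) (mu : 'cV[R]_n.+1) : 'M[R]_(n, 1 + n.+1) :=
  row_mx (z *m mu) z.

Definition cone_dep (mu : 'cV[R]_n.+1) : 'cV[R]_(1 + n.+1) := col_mx (- 1%:M : 'M[R]_1) mu.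

Lemma cone_dep_apex mu : cone_dep mu apex 0 = -1.
Proof. by rewrite /cone_dep col_mxEu !mxE eqxx. Qed.

Lemma cone_dep_base mu k : cone_dep mu (base k) 0 = mu k 0.
Proof. by rewrite /cone_dep col_mxEd. Qed.

Lemma ones_split (l : 'cV[R]_(1 + n.+1)) :
  (const_mx 1 : 'rV[R]_(1 + n.+1)) *m l =
  usubmx (l : 'cV_(1 + n.+1)) + ones *m dsubmx (l : 'cV_(1 + n.+1)).
Proof.
rewrite -{1}[l](@vsubmxK _ 1 n.+1) -[const_mx 1]/(const_mx 1 : 'rV[R]_(1 + n.+1)).
rewrite -row_mx_const mul_row_col; congr (_ + _).
by apply/matrixP => i j; rewrite !ord1 !mxE big_ord1 !mxE mul1r.
Qed.

Lemma cone_dependency z mu : ones *m mu = 1%:M -> affine_dependency (cone z mu) (cone_dep mu).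
Proof.
move=> mu1; split.
  by rewrite /cone /cone_dep (@mul_row_col _ n 1 n.+1 1) mulmxN mulmx1 addNr.
by rewrite ones_split /cone_dep col_mxKu col_mxKd mu1 addNr.
Qed.

(** Eliminating the first point turns a dependency into one of the others. *)
Lemma cone_dependency_line z mu : ones *m mu = 1%:M -> \det (z *m D^T) != 0 ->
  forall l, affine_dependency (cone z mu) l -> exists a, l = a *: cone_dep mu.
Proof.
move=> mu1 z0 l [xl ol]; pose l0 := usubmx (l : 'cV[R]_(1 + n.+1)).
pose l1 := dsubmx (l : 'cV[R]_(1 + n.+1)).
have lE : l = col_mx l0 l1 by rewrite /l0 /l1 vsubmxK.
rewrite ones_split -/l0 -/l1 in ol.
rewrite /cone lE (@mul_row_col _ n 1 n.+1 1) -mulmxA -mulmxDr in xl.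
have dep : affine_dependency z (mu *m l0 + l1).
  by split => //; rewrite mulmxDr mulmxA mu1 mul1mx.
have G0 : \det (gram z) != 0 by rewrite (det_gram_eq0 c_gt0 D_ones DDt).
have /eqP := nondegenerate_dependency G0 dep; rewrite addrC addr_eq0 => /eqP l1E.
exists (- l0 0 0); rewrite lE l1E [l0]mx11_scalar /cone_dep scale_col_mx mul_mx_scalar scaleNr.
by rewrite scalerN scaleNr opprK scale_scalar_mx mulr1 !mxE eqxx mulr1n.
Qed.

Lemma cone_dep_pos (mu : 'cV[R]_n.+1) : (#|pos_part_set mu| <= #|pos_part_set (cone_dep mu)|)%N.
Proof.
rewrite -(card_imset _ (@rshift_inj 1 n.+1)); apply/subset_leq_card/fintype.subsetP.
by move=> _ /imsetP[k + ->]; rewrite !inE cone_dep_base.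
Qed.

Lemma pos_cone_dep (mu : 'cV[R]_n.+1) : (#|pos_part_set (cone_dep mu)| <= #|pos_part_set mu|)%N.
Proof.
rewrite -[X in (_ <= X)%N](card_imset _ (@rshift_inj 1 n.+1)); apply/subset_leq_card/fintype.subsetP.
move=> i; rewrite inE -[i](@splitK 1 n.+1); case: (fintype.split _) => k /=.
  by rewrite ord1 cone_dep_apex ltr0N1.
by rewrite cone_dep_base => kp; apply/imsetP; exists k; rewrite ?inE.
Qed.

Lemma cone_embedding z mu : ones *m mu = 1%:M -> \det (z *m D^T) != 0 ->
  (n <= #|pos_part_set mu|)%N -> E (cone z mu).
Proof.
move=> mu1 z0 mup; apply/(embedding_criterion n_gt2) => l dl l0.
have mup' := leq_trans mup (cone_dep_pos mu).
have [a lE] := cone_dependency_line mu1 z0 dl.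
have [a0|a0|a0] := ltgtP a 0.
- right; apply: leq_trans mup' _; apply/subset_leq_card/fintype.subsetP => k.
  by rewrite !inE lE => kp; rewrite mxE nmulr_rlt0.
- left; apply: leq_trans mup' _; apply/subset_leq_card/fintype.subsetP => k.
  by rewrite !inE lE => kp; rewrite mxE mulr_gt0.
by move: l0; rewrite lE a0 scale0r eqxx.
Qed.

Lemma pos_off_card (mu : 'cV[R]_n.+1) : (forall k, k != i0 -> 0 < mu k 0) ->
  (n <= #|pos_part_set mu|)%N.
Proof.
move=> mup; have cardN0 : #|[set~ i0]%SET| = n by rewrite cardsC1 card_ord.
rewrite -[X in (X <= _)%N]cardN0; apply/subset_leq_card/fintype.subsetP => k.
by rewrite !inE => /mup.
Qed.

(** The barycentric coordinates of the model at height [t]: they move from the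
    barycenter of the simplex to the reflection of the vertex [i0] in the
    opposite facet. *)
Definition cone_weight (t : R) : 'cV[R]_n.+1 :=
  (n%:R + 1)^-1 *: ones^T + (t * (n%:R + 2) / (n%:R + 1)) *: eta.

Lemma ones_cone_weight t : ones *m cone_weight t = 1%:M.
Proof.
rewrite mulmxDr -!scalemxAr (@ones_eta R n n_gt0 i0) scaler0 addr0 (onesT R n) scale_scalar_mx.
by rewrite mulVf// nS_neq0.
Qed.

Lemma cone_weight_i0 t : cone_weight t i0 0 = (1 - t * (n%:R + 2)) / (n%:R + 1).
Proof. by rewrite !mxE eqxx; field; rewrite nS_neq0. Qed.

Lemma cone_weight_off t k : k != i0 ->
  cone_weight t k 0 = (1 + t * (n%:R + 2) / n%:R) / (n%:R + 1).
Proof. by move=> ki; rewrite !mxE (negPf ki); field; rewrite n_neq0// nS_neq0. Qed.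

Lemma cone_weight_gt0 t k : 0 <= t -> k != i0 -> 0 < cone_weight t k 0.
Proof.
move=> t0 ki; rewrite cone_weight_off//; apply: divr_gt0; last by rewrite natr1 ltr0n.
by rewrite ltr_pwDl// divr_ge0 ?mulr_ge0 ?addr_ge0 ?ler0n.
Qed.

Lemma cone_weight1 : cone_weight 1 = e0^T + 2 *: eta.
Proof.
apply/colP => k; rewrite !mxE eqxx /=; case: eqP => _ /=;
  by field; rewrite ?n_neq0// nS_neq0.
Qed.

Definition cone_mx (t : R) : 'M[R]_(n.+1, 1 + n.+1) := row_mx (cone_weight t) 1%:M.

Lemma mul_cone_mx (z : 'M[R]_(n, n.+1)) t : z *m cone_mx t = cone z (cone_weight t).
Proof. by rewrite /cone_mx (@mul_mx_row _ n n.+1 1 n.+1) mulmx1. Qed.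

Lemma cone_mx_embedding (z : 'M[R]_(n, n.+1)) (t : R) :
  0 <= t <= 1 -> 0 < \det (z *m D^T) -> E (z *m cone_mx t).
Proof.
move=> /andP[t0 _] z0; rewrite mul_cone_mx; apply: cone_embedding.
- exact: ones_cone_weight.
- by rewrite gt_eqF.
by apply: pos_off_card => k; exact: cone_weight_gt0.
Qed.

Lemma cone_mx_continuous : continuous cone_mx.
Proof.
move=> t; apply: (@cvg_row_mx _ _ (nbhs t) _); last exact: cvg_cstmx.
apply: (@cvg_addmx _ _ (nbhs t) _); first exact: cvg_cstmx.
apply: (@cvg_scalemx _ _ (nbhs t) _); last exact: cvg_cstmx.
apply: (@cvgM _ _ (nbhs t)); last exact: cvg_cst.
by apply: (@cvgM _ _ (nbhs t)); [exact: cvg_id|exact: cvg_cst].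
Qed.

Lemma fix_apex_lift (p : {perm 'I_(1 + n.+1)}) : p apex = apex ->
  exists s : {perm 'I_n.+1}, p = lift0_perm s.
Proof.
move=> p0; have apex0 : apex = 0 by apply: val_inj.
rewrite apex0 in p0.
have ex k : exists k', p (lift 0 k) = lift 0 k'.
  have : p (lift 0 k) != 0 by rewrite -{2}p0 (inj_eq perm_inj) eq_sym neq_lift.
  by rewrite eq_sym => /unlift_some[k' kE _]; exists k'.
have [f fE] := choice ex.
have finj : injective f.
  by move=> k k' fk; apply: (@lift_inj _ 0); apply: (@perm_inj _ p); rewrite !fE fk.
exists (perm finj); apply/permP => k; have [k' ->|->] := unliftP 0 k.
  by rewrite lift0_perm_lift fE permE.
by rewrite lift0_perm0.
Qed.

Lemma row_mx_lift_perm m (a : 'M[R]_(m, 1)) (b : 'M[R]_(m, n.+1)) (s : {perm 'I_n.+1}) :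
  row_mx a b *m perm_mx (lift0_perm s) = row_mx a (b *m perm_mx s).
Proof.
rewrite -lift0_mx_perm /lift0_mx (@mul_row_block _ m 1 n.+1 1 n.+1).
by rewrite mulmx1 !mulmx0 addr0 add0r.
Qed.

Local Notation swap := (tperm apex (base i0)).

Lemma row_mx_swap m (a : 'M[R]_(m, 1)) (b : 'M[R]_(m, n.+1)) :
  row_mx a b *m perm_mx swap = row_mx (b *m e0^T) (b + (a - b *m e0^T) *m e0).
Proof.
have sV : swap = (swap)^-1%g by rewrite tpermV.
rewrite sV -col_permE; apply/matrixP => i k; rewrite mxE.
rewrite -[k](@splitK 1 n.+1); case: (fintype.split k) => k' /=.
  by rewrite ord1 tpermL row_mxEl row_mxEr trmx_delta -colE mxE.
have [->|ki] := eqVneq k' i0.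
  rewrite tpermR row_mxEl row_mxEr trmx_delta -colE [RHS]mxE [X in _ + X]mxE big_ord1.
  by rewrite !mxE !eqxx mulr1 addrC subrK.
rewrite tpermD ?(inj_eq (@rshift_inj 1 n.+1)) 1?eq_sym// ?eq_rlshift//.
rewrite !row_mxEr [RHS]mxE [X in _ + X]mxE big_ord1 [delta_mx _ _ _ _]mxE.
by rewrite (negPf ki) andbF mulr0 addr0.
Qed.

Lemma perm_cone_weight (s : {perm 'I_n.+1}) (t : R) : s i0 = i0 \/ t = 0 ->
  perm_mx s *m cone_weight t = cone_weight t.
Proof.
move=> st; rewrite /cone_weight mulmxDr -!scalemxAr perm_ones; case: st => [si|->].
  by rewrite perm_eta.
by rewrite !mul0r !scale0r !addr0.
Qed.

Lemma mul_row_mx_cone (T : 'M[R]_n.+1) (t : R) : T *m cone_mx t = row_mx (T *m cone_weight t) T.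
Proof. by rewrite /cone_mx (@mul_mx_row _ n.+1 n.+1 1 n.+1) mulmx1. Qed.

Lemma cone_mx_perm (s : {perm 'I_n.+1}) (t : R) : s i0 = i0 \/ t = 0 ->
  perm_mx s *m cone_mx t = cone_mx t *m perm_mx (lift0_perm s).
Proof.
by move=> st; rewrite mul_row_mx_cone perm_cone_weight// row_mx_lift_perm mul1mx.
Qed.

(** At the end of the model the first point is the reflection of the vertex
    [i0], so that the reflection exchanges two points. *)
Lemma cone_mx_swap : dil (-1) *m cone_mx 1 = cone_mx 1 *m perm_mx swap.
Proof.
rewrite mul_row_mx_cone row_mx_swap !mul1mx; congr row_mx.
  rewrite cone_weight1 /dilation mulmxDl mul1mx -scalemxAl -mulmxA mulmxDr -scalemxAr e0_eta.
  rewrite trmx_delta mul_delta_mx (_ : delta_mx 0 0 = 1%:M) ?mulmxDr ?mulmx1; last first.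
    by apply/matrixP => i j; rewrite !ord1 !mxE.
  rewrite scalerN mulmxN -scalemxAr mulmx1 opprK.
  by apply/matrixP => i j; rewrite !mxE; ring.
rewrite cone_weight1 /dilation addrAC subrr add0r -scalemxAl opprK.
by rewrite addrC.
Qed.

Lemma cone_mx_adm (t : R) T : adm t T ->
  exists p : {perm 'I_(1 + n.+1)}, T *m cone_mx t = cone_mx t *m perm_mx p.
Proof.
case=> [[s si [->|[-> ->]]]|[-> [s ->]]].
- by exists (lift0_perm s); apply: cone_mx_perm; left.
- exists (lift0_perm s * swap)%g.
  by rewrite -mulmxA cone_mx_swap mulmxA cone_mx_perm ?perm_mxM ?mulmxA//; left.
- by exists (lift0_perm s); apply: cone_mx_perm; right.
Qed.

Definition weight (x : 'M[R]_(n, 1 + n.+1)) : 'cV[R]_n.+1 :=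
  \col_k (- adj_sq x apex (base k) / adj_sq x apex apex).

(** The first point has the least coefficient in the dependency, and only [i0]
    can have another negative one. The products of the coefficients are
    continuous, and so these conditions are stated by multiplying them with the
    other coefficients, which are then nonnegative ([leading_pairP]). *)
Definition leading_pair : set 'M[R]_(n, 1 + n.+1) :=
  \bigcap_(k in [set k | k != i0])
    ([set x | adj_sq x apex (base k) <= 0] `&`
     [set x | adj_sq x apex (base k) <= adj_sq x (base i0) (base k)]).

Definition cone_domain : set 'M[R]_(n, 1 + n.+1) :=
  leading_pair `&` [set x | 0 <= \det (rsubmx x *m D^T)].

Local Notation U := (E `&` cone_domain).

Definition dependency_line (x : 'M[R]_(n, 1 + n.+1)) (l : 'cV[R]_(1 + n.+1)) : Prop :=
  [/\ affine_dependency x l, l != 0 & forall v, affine_dependency x v -> exists a, v = a *: l].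

Lemma weight_dependency x l k : dependency_line x l -> l apex 0 != 0 ->
  weight x k 0 = - l (base k) 0 / l apex 0.
Proof.
move=> [dl l0 ker] la; have [a a0 aE] := adj_sqE dl l0 ker.
by rewrite mxE !aE; field; rewrite la gt_eqF.
Qed.

Lemma leading_pairP x l : dependency_line x l -> leading_pair x <->
  forall k, k != i0 -> l apex 0 * l (base k) 0 <= 0 /\
    l apex 0 * l (base k) 0 <= l (base i0) 0 * l (base k) 0.
Proof.
move=> [dl l0 ker]; have [a a0 aE] := adj_sqE dl l0 ker.
split=> lx k ki.
  have [h1 h2] := lx k ki; move: h1 h2; rewrite /= !aE => h1 h2.
  by split; [rewrite -(pmulr_rle0 _ a0)|rewrite -(ler_pM2l a0)].
have [h1 h2] := lx k ki; split; rewrite /= !aE.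
  by rewrite (pmulr_rle0 _ a0).
by rewrite (ler_pM2l a0).
Qed.

Lemma cone_line z mu : ones *m mu = 1%:M -> \det (z *m D^T) != 0 ->
  dependency_line (cone z mu) (cone_dep mu).
Proof.
move=> mu1 z0; split; [exact: cone_dependency| |exact: cone_dependency_line].
apply/eqP => /colP/(_ apex); rewrite cone_dep_apex mxE => /eqP.
by rewrite oppr_eq0 oner_eq0.
Qed.

Lemma weight_cone z mu : ones *m mu = 1%:M -> \det (z *m D^T) != 0 ->
  weight (cone z mu) = mu.
Proof.
move=> mu1 z0; apply/colP => k; rewrite (weight_dependency k (cone_line mu1 z0)).
  by rewrite cone_dep_apex cone_dep_base invrN invr1 mulrN1 opprK.
by rewrite cone_dep_apex oppr_eq0 oner_eq0.
Qed.

(** The coordinates of the embeddings in the domain ([oriented_coneP]). *)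
Definition oriented_cone (z : 'M[R]_(n, n.+1)) (mu : 'cV[R]_n.+1) : Prop :=
  [/\ ones *m mu = 1%:M, 0 < \det (z *m D^T), (n <= #|pos_part_set mu|)%N,
      forall k, k != i0 -> 0 <= mu k 0 & -1 <= mu i0 0].

Lemma cone_oriented z mu : oriented_cone z mu -> U (cone z mu).
Proof.
move=> [mu1 z0 mup muk mui]; have zn0 : \det (z *m D^T) != 0 by rewrite gt_eqF.
split; first exact: cone_embedding.
split; last by rewrite /= /cone row_mxKr ltW.
apply/(leading_pairP (cone_line mu1 zn0)) => k ki.
rewrite cone_dep_apex !cone_dep_base mulN1r oppr_le0 muk//; split => //.
by rewrite -subr_ge0 opprK -{2}[mu k 0]mul1r -mulrDl mulr_ge0 ?muk// addrC -lerBlDl sub0r.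
Qed.

(** This bounds the number of coefficients of the rarer sign by two. *)
Lemma three_nonpos (l : 'cV[R]_(1 + n.+1)) i j k : i != j -> i != k -> j != k ->
  l i 0 <= 0 -> l j 0 <= 0 -> l k 0 <= 0 -> (#|pos_part_set l| < n)%N.
Proof.
move=> ij ik jk li lj lk; have : (#|pos_part_set l :|: [set i; j; k]%SET| <= 1 + n.+1)%N.
  by rewrite -[X in (_ <= X)%N](card_ord (1 + n.+1)) max_card.
have := cardsUI (pos_part_set l) [set i; j; k]%SET.
rewrite (_ : pos_part_set l :&: _ = finset.set0); last first.
  by apply/setP => a; rewrite !inE; apply/negP => /andP[] /[swap] /orP[/orP[]|] /eqP ->;
    rewrite ltNge ?li ?lj ?lk.
have -> : #|[set i; j; k]%SET| = 3.
  by rewrite finset.setUC cardsU1 cards2 !inE ij negb_or eq_sym ik eq_sym jk.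
by rewrite cards0; lia.
Qed.

Lemma negative_coef (x : 'M[R]_(n, 1 + n.+1)) l : dependency_line x l -> exists i, l i 0 < 0.
Proof.
move=> [dl l0 _]; apply/existsP; rewrite -[X in is_true X]negbK negb_exists.
apply/negP => /forallP lp; case/eqP: l0; apply/colP => i; rewrite mxE.
have := dependency_sum dl => /eqP; rewrite psumr_eq0 => [/allP/(_ i (mem_index_enum i))/eqP //|j _].
by rewrite leNgt lp.
Qed.

(** The first coefficient is negative: if it vanished, the conditions of
    [leading_pair] would make it, the coefficient of [i0] and some negative
    coefficient three nonpositive ones. It can be normalized to [-1]. *)
Lemma oriented_coneP x : U x <-> exists z mu, oriented_cone z mu /\ x = cone z mu.
Proof.
split=> [[Ex [lx dx]]|[z [mu [zmu ->]]]]; last exact: cone_oriented.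
have [l [dl pl ker]] := embedding_dependency n_gt2 Ex.
have l0 : l != 0.
  apply/eqP => l0; have p0 : pos_part_set l = finset.set0.
    by apply/setP => i; rewrite !inE l0 mxE ltxx.
  by move: pl; rewrite p0 cards0 leqNgt n_gt0.
have line : dependency_line x l by [].
have {}lx := (leading_pairP line).1 lx.
have [k1 k1i k1p] : exists2 k, k != i0 & 0 < l (base k) 0.
  have : ~~ (pos_part_set l \subset [set apex; base i0]%SET).
    apply/negP => /subset_leq_card; rewrite cards2 => h.
    by have := leq_trans pl h; rewrite leqNgt; case: eqP => _; rewrite /= ?n_gt2 // (ltn_trans _ n_gt2).
  case/subsetPn => i; rewrite !inE -[i](@splitK 1 n.+1); case: (fintype.split i) => k /=.
    by rewrite ord1 eqxx.
  by move=> kp ki; exists k => //; apply: contra ki => /eqP ->; rewrite ?eqxx ?orbT.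
have la_le0 : l apex 0 <= 0 by have [] := lx _ k1i; rewrite pmulr_lle0.
have la_lj : l apex 0 <= l (base i0) 0 by have [_] := lx _ k1i; rewrite ler_pM2r.
have la : l apex 0 < 0.
  rewrite lt_neqAle la_le0 andbT; apply/eqP => la0; rewrite la0 in la_lj.
  have [i li] := negative_coef line; move: li.
  rewrite -[i](@splitK 1 n.+1); case: (fintype.split i) => k /= lk.
    by move: lk; rewrite ord1 la0 ltxx.
  have ki : k != i0 by apply/eqP => ki; move: lk; rewrite ki ltNge la_lj.
  have lj0 : l (base i0) 0 <= 0 by have [_] := lx _ ki; rewrite la0 mul0r nmulr_lge0.
  have := three_nonpos (l := l) (i := apex) (j := base i0) (k := base k).
  rewrite eq_lrshift eq_lrshift (inj_eq (@rshift_inj 1 n.+1)) eq_sym ki la0 lj0 (ltW lk) lexx.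
  by move=> /(_ isT isT isT isT isT isT); rewrite ltnNge pl.
have lk_ge0 k : k != i0 -> 0 <= l (base k) 0.
  by move=> ki; have [] := lx _ ki; rewrite nmulr_rle0.
pose mu : 'cV[R]_n.+1 := (- l apex 0)^-1 *: dsubmx l.
have muE k : mu k 0 = (- l apex 0)^-1 * l (base k) 0 by rewrite !mxE.
have inv_gt0 : 0 < (- l apex 0)^-1 by rewrite invr_gt0 oppr_gt0.
have usubE : usubmx l = (l apex 0)%:M by rewrite [LHS]mx11_scalar mxE.
have [xl ol] := dl.
have mu1 : ones *m mu = 1%:M.
  move: ol; rewrite ones_split usubE => /eqP; rewrite addrC addr_eq0 => /eqP od.
  by rewrite -scalemxAr od scalerN -scaleNr invrN opprK scale_scalar_mx mulVf// lt_eqF.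
have xE : x = cone (rsubmx x) mu.
  rewrite -[LHS]hsubmxK /cone; congr row_mx.
  move: xl; rewrite -{1}[x]hsubmxK -{1}[l]vsubmxK (@mul_row_col _ n 1 n.+1 1) usubE.
  rewrite mul_mx_scalar => /eqP; rewrite addrC addr_eq0 => /eqP xd.
  by rewrite -scalemxAr xd scalerN -scaleNr invrN opprK scalerA mulVf ?scale1r// lt_eqF.
have lE : l = (- l apex 0) *: cone_dep mu.
  rewrite -{1}[l]vsubmxK /cone_dep scale_col_mx usubE scalerA divff ?oppr_eq0 ?lt_eqF// scale1r.
  by rewrite scalerN scaleNr opprK scale_scalar_mx mulr1.
exists (rsubmx x), mu; split => //; split => //.
- rewrite lt_neqAle eq_sym dx andbT -(det_gram_eq0 c_gt0 D_ones DDt).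
  apply/negP => /det0P[v v0 vG].
  have dv : affine_dependency (rsubmx x) v^T.
    by apply/gram_dependency; rewrite -[gram _]gram_sym -trmx_mul vG trmx0.
  have dep : affine_dependency x (col_mx (0 : 'M[R]_1) v^T).
    case: dv => xv ov; split; first by rewrite xE /cone (@mul_row_col _ n 1 n.+1 1) mulmx0 add0r.
    by rewrite ones_split col_mxKu col_mxKd add0r.
  have [a aE] := ker _ dep.
  have /colP/(_ apex) := aE; rewrite col_mxEu mxE mxE => /esym/eqP.
  rewrite mulf_eq0 (lt_eqF la) orbF => /eqP a0; case/eqP: v0.
  apply/trmx_inj; rewrite trmx0; apply/colP => k.
  by have /colP/(_ (base k)) := aE; rewrite col_mxEd a0 scale0r => ->; rewrite !mxE.
- apply: leq_trans pl _; apply: leq_trans (pos_cone_dep mu).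
  apply/subset_leq_card/fintype.subsetP => i; rewrite !inE {1}lE mxE.
  by rewrite pmulr_rgt0// oppr_gt0.
- by move=> k ki; rewrite muE mulr_ge0 ?lk_ge0// ltW.
by rewrite muE mulrC ler_pdivlMr ?oppr_gt0// mulN1r opprK.
Qed.

Definition cone_height (mu : 'cV[R]_n.+1) : R := Num.max 0 (- mu i0 0).

(** The failure of [mu] to belong to the family [cone_weight]. *)
Definition skew (mu : 'cV[R]_n.+1) : 'cV[R]_n.+1 :=
  mu - e0^T - eta + mu i0 0 *: eta.

(** The vertex [i0] is moved parallel to the opposite facet in such a way that at
    height 1 the segment between it and the first point crosses the facet at the
    barycenter. *)
Definition centered_cone (z : 'M[R]_(n, n.+1)) (mu : 'cV[R]_n.+1) : 'M[R]_(n, n.+1) :=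
  z *m (1%:M - (cone_height mu / 2) *: (skew mu *m e0)).

Local Notation height x := (cone_height (weight x)).
Local Notation simplex x := (centered_cone (rsubmx x) (weight x)).

Lemma skew_i0 mu : e0 *m skew mu = 0.
Proof.
by apply/matrixP => i j; rewrite -rowE !ord1 !mxE !eqxx /= mulrN1 opprK subrK subrr.
Qed.

Lemma ones_skew mu : ones *m mu = 1%:M -> ones *m skew mu = 0.
Proof.
move=> mu1; rewrite mulmxDr !mulmxBr -scalemxAr (@ones_eta R n n_gt0 i0) mu1 scaler0 addr0 subr0.
have -> : ones *m e0^T = 1%:M by rewrite -[LHS]trmxK trmx_mul trmxK e0_ones trmx1.
by rewrite subrr.
Qed.

Lemma skew_off mu k : k != i0 -> skew mu k 0 = mu k 0 - (1 - mu i0 0) / n%:R.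
Proof. by move=> ki; rewrite !mxE (negPf ki) andbF subr0; ring. Qed.

(** The points of [z *m T] are affine combinations of the vertices of [z] other
    than [i0]. *)
Lemma det_collapsed (z : 'M[R]_(n, n.+1)) T : e0 *m T = 0 -> ones *m T = ones ->
  \det (z *m T *m D^T) = 0.
Proof.
move=> e0T oT; apply: (mulfI (nS_neq0 R n)); rewrite mulr0 -(orientation D_ones).
have -> : homog (z *m T) = homog z *m T by rewrite /homog mul_col_mx oT.
rewrite det_mulmx (_ : \det T = 0) ?mulr0 ?mul0r//.
apply/eqP/det0P; exists e0 => //; apply/eqP => /rowP/(_ i0).
by rewrite !mxE !eqxx => /eqP; rewrite oner_eq0.
Qed.

(** Moving the vertex [i0] parallel to the opposite facet does not change the
    volume. *)
Lemma shear_det (z : 'M[R]_(n, n.+1)) (v : 'cV[R]_n.+1) (a : R) : e0 *m v = 0 -> ones *m v = 0 ->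
  \det (z *m (1%:M - a *: (v *m e0)) *m D^T) = \det (z *m D^T).
Proof.
move=> e0v ov.
have flat b : \det ((z *m dil 0 + (z *m (b *: v)) *m e0) *m D^T) = 0.
  rewrite -mulmxA -mulmxDr det_collapsed//.
    by rewrite mulmxDr e0_dilation scale0r add0r mulmxA -scalemxAr e0v scaler0 mul0mx.
  by rewrite mulmxDr ones_dilation// mulmxA -scalemxAr ov scaler0 mul0mx addr0.
have := flat (- a); rewrite (facet_normal_spec _ D_ones).
have := flat 0; rewrite scale0r mulmx0 mul0mx addr0 => -> /eqP; rewrite add0r => /eqP nv.
have := facet_normal_spec i0 D_ones z 1 (z *m (- a *: v)).
rewrite nv addr0 dilation1 mulmx1 => <-; congr (\det (_ *m _)).
by rewrite mulmxBr mulmx1 scaleNr mulmxN mulNmx -!scalemxAr -scalemxAl mulmxA.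
Qed.

Lemma shear_mulmx (v w : 'cV[R]_n.+1) (a : R) :
  (1%:M - a *: (v *m e0)) *m w = w - (a * w i0 0) *: v.
Proof.
rewrite mulmxBl mul1mx -scalemxAl -mulmxA -rowE.
have -> : row i0 w = (w i0 0)%:M by apply/matrixP => i j; rewrite !ord1 !mxE mulr1n.
by rewrite mul_mx_scalar scalerA.
Qed.

Lemma cone_height01 (mu : 'cV[R]_n.+1) : -1 <= mu i0 0 -> 0 <= cone_height mu <= 1.
Proof. by move=> mui; rewrite /cone_height le_max lexx ge_max ler01 /= lerNl. Qed.

(** Written over the moving simplex, the barycentric coordinates of the first
    point are a convex combination up to a multiple [g] of [skew mu]; at positive
    height [g] is not positive, and too small for [g *: mu] to outweigh
    [(1 - s) *: mu]. *)
Lemma cone_path z mu (s : R) : oriented_cone z mu -> 0 <= s <= 1 ->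
  E ((1 - s) *: cone z mu + s *: (centered_cone z mu *m cone_mx (cone_height mu))).
Proof.
move=> [mu1 z0 mup muk mui] /andP[s0 s1].
have /andP[t0 t1] := cone_height01 mui.
have tE : cone_height mu = 0 \/ cone_height mu = - mu i0 0.
  by rewrite /cone_height; case: leP => _; [right|left].
set t := cone_height mu in t0 t1 tE *.
set b := skew mu; pose std := cone_weight t.
pose g := s * (1 - s) * (t / 2) * (mu i0 0 - std i0 0).
pose mus := (1 - s) *: mu + s *: std + g *: b.
pose zs := z *m (1%:M - (s * (t / 2)) *: (b *m e0)).
have b0 : b i0 0 = 0 by have /matrixP/(_ 0 0) := skew_i0 mu; rewrite -rowE !mxE.
have -> : (1 - s) *: cone z mu + s *: (centered_cone z mu *m cone_mx t) = cone zs mus.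
  rewrite mul_cone_mx /cone !scale_row_mx add_row_mx; congr row_mx; last first.
    rewrite /centered_cone -/t -/b /zs -{1}[z]mulmx1 !(scalemxAr _ z) -mulmxDr; congr (_ *m _).
    move: (b *m e0) => Q; apply/matrixP => i j; rewrite !mxE; ring.
  rewrite /zs /centered_cone -/t -/b -!mulmxA !shear_mulmx !(scalemxAr _ z) -mulmxDr; congr (_ *m _).
  have -> : mus i0 0 = (1 - s) * mu i0 0 + s * std i0 0.
    rewrite /mus mxE [X in _ + X]mxE b0 mulr0 addr0 mxE [X in X + _]mxE [X in _ + X]mxE.
    by [].
  rewrite -/std /mus /g; move: (std i0 0) (mu i0 0) => si mi.
  have comb (S M B : 'cV[R]_n.+1) : (1 - s) *: M + s *: (S - (t / 2 * si) *: B) =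
      (1 - s) *: M + s *: S + (s * (1 - s) * (t / 2) * (mi - si)) *: B -
      (s * (t / 2) * ((1 - s) * mi + s * si)) *: B.
    by apply/matrixP => i j; rewrite !mxE; ring.
  exact: comb.
have ob : ones *m b = 0 by exact: ones_skew.
apply: cone_embedding.
- rewrite /mus !mulmxDr -!scalemxAr mu1 ob ones_cone_weight scaler0 addr0 -scalerDl.
  by rewrite subrK scale1r.
- by rewrite /zs shear_det ?gt_eqF// skew_i0.
have [sz|sn0] := eqVneq s 0.
  apply: leq_trans mup _; apply/subset_leq_card/fintype.subsetP => k; rewrite !inE /mus /g sz.
  by rewrite !mul0r !scale0r subr0 scale1r !addr0.
have sp : 0 < s by rewrite lt_neqAle eq_sym sn0.
apply: pos_off_card => k ki.
have -> : mus k 0 = (1 - s) * mu k 0 + s * std k 0 + g * b k 0 by rewrite !mxE.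
have stdp : 0 < s * std k 0 by rewrite mulr_gt0// cone_weight_gt0.
have s1' : 0 <= 1 - s by rewrite subr_ge0.
case: tE => [tz|tE].
  by rewrite /g tz !(mul0r, mulr0) addr0 ltr_wpDl// mulr_ge0 ?muk.
have nR : 0 < n%:R :> R by rewrite ltr0n.
have n1R : 0 < n%:R + 1 :> R by rewrite natr1 ltr0n.
pose h := s * t * (1 - t) / (2 * (n%:R + 1)).
have gE : g = - ((1 - s) * h).
  rewrite /g /std cone_weight_i0 /h tE; move: (mu i0 0) => m; field.
  by rewrite gt_eqF.
have t1' : 0 <= 1 - t by rewrite subr_ge0.
have h0 : 0 <= h by rewrite /h divr_ge0 ?mulr_ge0// ltW.
have h1 : h <= 1.
  rewrite /h ler_pdivrMr ?mulr_gt0// mul1r; apply: (@le_trans _ _ 1).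
    by rewrite mulr_ile1 ?mulr_ge0// ?mulr_ile1// lerBlDr lerDl.
  by rewrite mulrDr mulr1 (le_trans (_ : 1 <= 2))// ?ler1n// lerDr mulr_ge0// ltW.
rewrite /b skew_off// gE -[mu i0 0]opprK -tE opprK.
have -> : (1 - s) * mu k 0 + s * std k 0 + - ((1 - s) * h) * (mu k 0 - (1 + t) / n%:R) =
    s * std k 0 + ((1 - s) * (1 - h) * mu k 0 + (1 - s) * h * ((1 + t) / n%:R)) by ring.
rewrite ltr_pwDl// addr_ge0 ?mulr_ge0 ?muk ?subr_ge0 ?addr_ge0// ?invr_ge0 ltW//.
Qed.

Lemma perm_dependency (x : 'M[R]_(n, 1 + n.+1)) (p : {perm 'I_(1 + n.+1)}) l :
  affine_dependency (x *m perm_mx p) l <-> affine_dependency x (perm_mx p *m l).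
Proof.
rewrite /affine_dependency !mulmxA.
by have -> : (const_mx 1 : 'rV[R]_(1 + n.+1)) *m perm_mx p = const_mx 1 by exact: ones_perm.
Qed.

(** A relabeling permutes the dependency; the sign of the factor is positive
    because the positive coefficients are the more numerous ones on both sides. *)
Lemma cone_perm_dep z mu z' mu' (p : {perm 'I_(1 + n.+1)}) :
    oriented_cone z mu -> oriented_cone z' mu' -> cone z mu *m perm_mx p = cone z' mu' ->
  exists2 a, 0 < a & forall i, cone_dep mu' (p i) 0 = a * cone_dep mu i 0.
Proof.
move=> [mu1 z0 mup _ _] [mu1' _ mup' _ _] pE.
have zn0 : \det (z *m D^T) != 0 by rewrite gt_eqF.
have := cone_dependency z' mu1'; rewrite -pE => /perm_dependency.
move=> /(cone_dependency_line mu1 zn0)[a aE].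
have {}aE i : cone_dep mu' (p i) 0 = a * cone_dep mu i 0.
  by rewrite -perm_mx_col aE mxE.
exists a => //; rewrite ltNge; apply/negP => a0.
have sub : pos_part_set (cone_dep mu') \subset [set p i | i in neg_part_set (cone_dep mu)]%SET.
  apply/fintype.subsetP => i; rewrite inE -[i](permKV p) aE => h.
  apply/imsetP; exists (p^-1%g i) => //; rewrite inE ltNge; apply/negP => h'.
  by move: h; rewrite ltNge mulr_le0_ge0.
have := subset_leq_card sub; rewrite card_imset; last exact: perm_inj.
have := part_sets_card (cone_dep mu).
have := leq_trans mup (cone_dep_pos mu); have := leq_trans mup' (cone_dep_pos mu').
by lia.
Qed.

Lemma perm_skew (s : {perm 'I_n.+1}) mu mu' : s i0 = i0 -> perm_mx s *m mu' = mu ->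
  perm_mx s *m skew mu' = skew mu.
Proof.
move=> si sE; have mui : mu' i0 0 = mu i0 0 by rewrite -sE -row_permE mxE si.
rewrite /skew !mulmxDr !mulmxN -scalemxAr perm_eta// sE mui; congr (_ - _ - _ + _).
by apply/colP => k; rewrite -row_permE !mxE -{1}si (inj_eq perm_inj).
Qed.

Lemma centered_perm z (s : {perm 'I_n.+1}) mu mu' : s i0 = i0 -> perm_mx s *m mu' = mu ->
  centered_cone (z *m perm_mx s) mu' = centered_cone z mu *m perm_mx s.
Proof.
move=> si sE; have mui : mu' i0 0 = mu i0 0 by rewrite -sE -row_permE mxE si.
rewrite /centered_cone /cone_height mui -!mulmxA; congr (_ *m _).
rewrite mulmxBr mulmxBl mulmx1 mul1mx -scalemxAr -scalemxAl; congr (_ - _ *: _).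
by rewrite mulmxA (perm_skew si sE) -mulmxA e0_perm si.
Qed.

(** When the weight of [i0] is [-1] the first point and the vertex [i0] are
    symmetric with respect to a point of the opposite facet, and exchanging them
    amounts to a reflection. *)
Lemma centered_swap (z : 'M[R]_(n, n.+1)) (mu : 'cV[R]_n.+1) : mu i0 0 = -1 ->
  centered_cone (z + (z *m mu - z *m e0^T) *m e0) mu = centered_cone z mu *m dil (-1).
Proof.
move=> mui; have tE : cone_height mu / 2 = 2^-1.
  by rewrite /cone_height mui opprK (max_idPr _) ?ler01// div1r.
have -> : z + (z *m mu - z *m e0^T) *m e0 = z *m (1%:M + (mu - e0^T) *m e0).
  by rewrite mulmxDr mulmx1 mulmxA mulmxBr.
rewrite /centered_cone tE -!mulmxA; congr (_ *m _).
have wE : mu - e0^T = skew mu + 2 *: eta.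
  by rewrite /skew mui scaleN1r scaler_nat mulr2n addrA subrK subrK.
rewrite wE; have := skew_i0 mu; move: (skew mu) => b b0.
rewrite mulmxDl mul1mx mulmxBr mulmx1 -scalemxAr -(mulmxA _ e0) (mulmxA e0) b0 mul0mx.
rewrite mulmx0 scaler0 subr0.
rewrite /dilation mulmxDr mulmx1 -scalemxAr mulmxBl mul1mx -scalemxAl -(mulmxA b) (mulmxA e0).
rewrite e0_eta mulNmx mul1mx mulmxN mulmxDl -scalemxAl.
by apply/matrixP => i j; rewrite !mxE; move: (\sum_j0 _) (\sum_j0 _) => S S'; field.
Qed.

(** A relabeling either fixes the first point, and then permutes the weights, or
    it exchanges the first point with [i0]. In the latter case both have the
    same coefficient, since each of the two embeddings has them in
    nondecreasing order, and the height is 1. *)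
Lemma cone_relabel z mu z' mu' (p : {perm 'I_(1 + n.+1)}) :
    oriented_cone z mu -> oriented_cone z' mu' -> cone z mu *m perm_mx p = cone z' mu' ->
  exists T, [/\ adm (cone_height mu) T, cone_height mu' = cone_height mu,
    centered_cone z' mu' = centered_cone z mu *m T &
    T *m cone_mx (cone_height mu) = cone_mx (cone_height mu) *m perm_mx p].
Proof.
move=> zmu zmu' pE; have [a a0 aE] := cone_perm_dep zmu zmu' pE.
have [mu1 z0 mup muk mui] := zmu; have [mu1' z0' mup' muk' mui'] := zmu'.
have [p0|p0] := eqVneq (p apex) apex.
  have a1 : a = 1.
    by have := aE apex; rewrite p0 !cone_dep_apex mulrN1 => /eqP; rewrite eqr_opp => /eqP.
  have [s ps] := fix_apex_lift p0.
  have pb k : p (base k) = base (s k) by rewrite ps !rshift1 lift0_perm_lift.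
  have sE k : mu' (s k) 0 = mu k 0.
    by have := aE (base k); rewrite pb !cone_dep_base a1 mul1r.
  have z'E : z' = z *m perm_mx s.
    by move: pE; rewrite /cone ps row_mx_lift_perm => /eq_row_mx[_ ->].
  have smu : perm_mx s *m mu' = mu by apply/colP => k; rewrite -row_permE mxE.
  have [mu_ge0|mu_lt0] := leP 0 (mu i0 0).
    have t0 : cone_height mu = 0 by rewrite /cone_height (max_idPl _)// oppr_le0.
    have t0' : cone_height mu' = 0.
      rewrite /cone_height (max_idPl _)// oppr_le0 -[i0](permKV s) sE.
      by have [->//|] := eqVneq (s^-1%g i0) i0; exact: muk.
    exists (perm_mx s); rewrite t0 t0' ps; split => //.
    - by right; split => //; exists s.
    - by rewrite /centered_cone t0 t0' mul0r !scale0r !subr0 !mulmx1.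
    by apply: cone_mx_perm; right.
  have si : s i0 = i0.
    apply/eqP/negPn/negP => si; have := muk' _ si; rewrite sE.
    by rewrite leNgt mu_lt0.
  exists (perm_mx s); split.
  - by left; exists s => //; left.
  - by rewrite /cone_height -(sE i0) si.
  - by rewrite z'E (centered_perm z si smu).
  by rewrite ps; apply: cone_mx_perm; left.
have base_inj := inj_eq (@rshift_inj 1 n.+1).
have [k kE] : exists k, p (base k) = apex.
  have := permKV p apex; rewrite -[(p^-1)%g apex](@splitK 1 n.+1).
  case: (fintype.split _) => k /=; last by exists k.
  by rewrite ord1 => /eqP; rewrite (negPf p0).
have ki : k = i0.
  apply/eqP/negPn/negP => ki; have := aE (base k); rewrite kE cone_dep_apex cone_dep_base => h.
  by have := mulr_ge0 (ltW a0) (muk _ ki); rewrite -h oppr_ge0 ler10.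
rewrite {k}ki in kE.
have [k' pk'] : exists k', p apex = base k'.
  move: p0; rewrite -[p apex](@splitK 1 n.+1); case: (fintype.split _) => k' /=.
    by rewrite ord1 eqxx.
  by exists k'.
have amu : a * mu i0 0 = -1.
  by have := aE (base i0); rewrite kE cone_dep_apex cone_dep_base => <-.
have amu' : mu' k' 0 = - a.
  by have := aE apex; rewrite pk' cone_dep_base cone_dep_apex mulrN1.
have k'i : k' = i0.
  by apply/eqP/negPn/negP => /muk'; rewrite amu' oppr_ge0 leNgt a0.
rewrite {k'}k'i in pk' amu'.
have a1 : a = 1.
  apply/eqP; rewrite eq_le; apply/andP; split; first by rewrite -lerN2 -amu'.
  have := ler_wpM2l (ltW a0) mui; rewrite amu mulrN1 lerN2.
  by [].
have mui1 : mu i0 0 = -1 by rewrite -amu a1 mul1r.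
have mui1' : mu' i0 0 = -1 by rewrite amu' a1.
have t1 : cone_height mu = 1 by rewrite /cone_height mui1 opprK (max_idPr _).
have t1' : cone_height mu' = 1 by rewrite /cone_height mui1' opprK (max_idPr _).
have q0 : (swap * p)%g apex = apex by rewrite permM tpermL kE.
have [s qs] := fix_apex_lift q0.
have ps : p = (swap * lift0_perm s)%g by rewrite -qs mulgA tperm2 mul1g.
have qb k : (swap * p)%g (base k) = base (s k) by rewrite qs !rshift1 lift0_perm_lift.
have si : s i0 = i0.
  by have := qb i0; rewrite permM tpermR pk' => /(@rshift_inj 1 n.+1).
have smu : perm_mx s *m mu' = mu.
  apply/colP => k; rewrite -row_permE mxE.
  have [->|ki] := eqVneq k i0; first by rewrite si mui1 mui1'.
  have := aE (base k); rewrite a1 mul1r cone_dep_base => <-.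
  rewrite -(cone_dep_base mu') -qb permM tpermD// ?base_inj 1?eq_sym//.
have z'E : z' = (z + (z *m mu - z *m e0^T) *m e0) *m perm_mx s.
  by move: pE; rewrite /cone ps perm_mxM mulmxA row_mx_swap row_mx_lift_perm => /eq_row_mx[_ ->].
exists (dil (-1) *m perm_mx s); rewrite t1 t1'; split => //.
- by left; exists s => //; right; split => //; rewrite perm_dilation.
- by rewrite z'E (centered_perm _ si smu) centered_swap// mulmxA.
by rewrite -mulmxA cone_mx_perm ?mulmxA ?cone_mx_swap ?ps ?perm_mxM ?mulmxA//; left.
Qed.

Lemma perm_dependency_line (x : 'M[R]_(n, 1 + n.+1)) (p : {perm 'I_(1 + n.+1)}) l :
  dependency_line x l -> dependency_line (x *m perm_mx p) (perm_mx p^-1 *m l).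
Proof.
have pV v : perm_mx p *m (perm_mx p^-1 *m v) = v :> 'cV[R]_(1 + n.+1).
  by rewrite mulmxA -perm_mxM mulgV perm_mx1 mul1mx.
have Vp v : perm_mx p^-1 *m (perm_mx p *m v) = v :> 'cV[R]_(1 + n.+1).
  by rewrite mulmxA -perm_mxM mulVg perm_mx1 mul1mx.
move=> [dl l0 ker]; split; first by apply/perm_dependency; rewrite pV.
  by apply: contra l0 => /eqP pl0; rewrite -[l]pV pl0 mulmx0.
move=> v /perm_dependency/ker[a aE]; exists a.
by rewrite -[LHS]Vp aE -scalemxAr.
Qed.

(** The points with the two least coefficients are put first; exchanging two of
    the others adjusts the orientation. *)
Lemma cone_cover x : E x -> exists p : {perm 'I_(1 + n.+1)}, cone_domain (x *m perm_mx p).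
Proof.
move=> Ex; have [l [dl pl ker]] := embedding_dependency n_gt2 Ex.
have l0 : l != 0.
  apply/eqP => l0; have p0 : pos_part_set l = finset.set0.
    by apply/setP => i; rewrite !inE l0 mxE ltxx.
  by move: pl; rewrite p0 cards0 leqNgt n_gt0.
have line : dependency_line x l by [].
have [a la_min] : exists a, forall i, l a 0 <= l i 0.
  have [a _ aP] := @arg_minP _ _ _ apex xpredT (fun i => l i 0) isT.
  by exists a => i; exact: aP.
have la : l a 0 < 0 by have [i li] := negative_coef line; exact: le_lt_trans (la_min i) li.
have [b ba lb_min] : exists2 b, b != a & forall i, i != a -> l b 0 <= l i 0.
  have [b0 b0a] : exists b, b != a.
    by exists (lift a (0 : 'I_n.+1)); rewrite eq_sym neq_lift.
  have [b ba bP] := @arg_minP _ _ _ b0 (fun i => i != a) (fun i => l i 0) b0a.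
  by exists b.
have l_pos i : i != a -> i != b -> 0 < l i 0.
  move=> ia ib; rewrite ltNge; apply/negP => li.
  have lb := le_trans (lb_min i ia) li.
  have := three_nonpos (l := l) (i := a) (j := b) (k := i).
  rewrite eq_sym ba eq_sym ia eq_sym ib (ltW la) lb li => /(_ isT isT isT isT isT isT).
  by rewrite ltnNge pl.
have lead (p : {perm 'I_(1 + n.+1)}) : p a = apex -> p b = base i0 -> leading_pair (x *m perm_mx p).
  move=> pa pb; apply/(leading_pairP (perm_dependency_line p line)) => k ki.
  rewrite !perm_mx_col -pa -pb !permK; set i := (p^-1)%g _.
  have li : 0 < l i 0.
    apply: l_pos; apply: contra ki => /eqP ia.
      by have := permKV p (base k); rewrite -/i ia pa => /eqP.
    by have := permKV p (base k); rewrite -/i ia pb => /(@rshift_inj 1 n.+1) ->.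
  by rewrite ler_pM2r// pmulr_lle0// (ltW la) la_min.
pose p := (tperm a apex * tperm (tperm a apex b) (base i0))%g.
have b_apex : tperm a apex b != apex by rewrite -{2}(tpermL a apex) (inj_eq perm_inj).
have pa : p a = apex by rewrite permM tpermL tpermD// ?eq_rlshift.
have pb : p b = base i0 by rewrite permM tpermL.
have [dp|dp] := leP 0 (\det (rsubmx (x *m perm_mx p) *m D^T)).
  by exists p; split => //; exact: lead.
have [i ii] := other_vertex n_gt2 i0; have [j ij ji] := third_vertex n_gt2 i i0.
exists (p * lift0_perm (tperm i j))%g; split.
  apply: lead; first by rewrite permM pa (_ : apex = 0) ?lift0_perm0//; exact: val_inj.
  by rewrite permM pb !rshift1 lift0_perm_lift tpermD.
rewrite /= perm_mxM mulmxA -[x *m perm_mx p]hsubmxK row_mx_lift_perm row_mxKr.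
by rewrite (det_perm_Dt D_ones) odd_tperm eq_sym ij expr1 mulN1r oppr_ge0 ltW.
Qed.

Lemma adj_sq_continuous i j : continuous (fun x : 'M[R]_(n, 1 + n.+1) => adj_sq x i j).
Proof.
move=> x; apply: (@cvg_mxE _ _ (nbhs x) _ _ _ (fun y => adj_sq y)).
have ca : \adj (gram y) @[y --> x] --> \adj (gram x).
  by apply: (@cvg_adj _ _ (nbhs x) _ _ (fun y => gram y)); exact: gram_continuous.
by apply: (@cvg_mulmx _ _ (nbhs x) _ _ _ _ (fun y => \adj (gram y)) (fun y => \adj (gram y))).
Qed.

Lemma cone_apex_neq0 x : U x -> adj_sq x apex apex != 0.
Proof.
move=> /oriented_coneP[z [mu [[mu1 z0 _ _ _] ->]]].
have zn0 : \det (z *m D^T) != 0 by rewrite gt_eqF.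
have [dl l0 ker] := cone_line mu1 zn0.
have [a a0 aE] := adj_sqE dl l0 ker.
by rewrite aE cone_dep_apex mulrNN mulr1 mulr1 gt_eqF.
Qed.

Lemma weight_continuous x : U x -> weight y @[y --> x] --> weight x.
Proof.
move=> Ux; apply/(@cvg_mxP _ _ (nbhs x) _) => k j; rewrite mxE.
under eq_cvg do rewrite mxE.
apply: (@cvgM _ _ (nbhs x)); first by apply: (@cvgN _ _ _ (nbhs x)); exact: adj_sq_continuous.
by apply: cvgV; [exact: cone_apex_neq0|exact: adj_sq_continuous].
Qed.

Lemma cone_height_continuous x : U x -> height y @[y --> x] --> height x.
Proof.
move=> Ux; apply: (@cvg_maxr _ _ (nbhs x)); first exact: cvg_cst.
apply: (@cvgN _ _ _ (nbhs x)).
by apply: (@cvg_mxE _ _ (nbhs x) _ _ _ weight); exact: weight_continuous.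
Qed.

Lemma rsubmx_continuous : continuous (fun x : 'M[R]_(n, 1 + n.+1) => rsubmx x).
Proof.
move=> x; apply/(@cvg_mxP _ _ (nbhs x) _) => i j; rewrite mxE.
under eq_cvg do rewrite mxE.
by apply: (@cvg_mxE _ _ (nbhs x) _ _ _ id); exact: cvg_id.
Qed.

Lemma centered_cone_continuous x : U x -> simplex y @[y --> x] --> simplex x.
Proof.
move=> Ux; apply: (@cvg_mulmx _ _ (nbhs x) _); first exact: rsubmx_continuous.
apply: (@cvg_addmx _ _ (nbhs x) _); first exact: cvg_cstmx.
apply: (@cvg_oppmx _ _ (nbhs x) _); apply: (@cvg_scalemx _ _ (nbhs x) _).
  by apply: (@cvgM _ _ (nbhs x)); [exact: cone_height_continuous|exact: cvg_cst].
apply: (@cvg_mulmx _ _ (nbhs x) _); last exact: cvg_cstmx.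
have cw := weight_continuous Ux.
apply: (@cvg_addmx _ _ (nbhs x) _).
  apply: (@cvg_addmx _ _ (nbhs x) _); last exact: cvg_cstmx.
  by apply: (@cvg_addmx _ _ (nbhs x) _); last exact: cvg_cstmx.
apply: (@cvg_scalemx _ _ (nbhs x) _); last exact: cvg_cstmx.
exact: (@cvg_mxE _ _ (nbhs x) _ _ _ weight).
Qed.

Lemma cone_domain_closed : closed cone_domain.
Proof.
apply: closedI.
  apply: closed_bigI => k _; apply: closedI.
    exact: ((continuous_closedP _).1 (@adj_sq_continuous apex (base k))
      [set r | r <= 0] (@closed_le _ _)).
  have cd : continuous (fun x : 'M[R]_(n, 1 + n.+1) =>
      adj_sq x (base i0) (base k) - adj_sq x apex (base k)).
    by move=> x; apply: (@cvgB _ _ _ (nbhs x)); exact: adj_sq_continuous.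
  have := (continuous_closedP _).1 cd [set r | 0 <= r] (@closed_ge _ _).
  congr closed; apply/seteqP; split => x /=; by rewrite subr_ge0.
have cd : continuous (fun x : 'M[R]_(n, 1 + n.+1) => \det (rsubmx x *m D^T)).
  move=> x; apply: (@cvg_det _ _ (nbhs x) _ _ (fun x => rsubmx x *m D^T)).
  by apply: (@cvg_mulmx _ _ (nbhs x) _); [exact: rsubmx_continuous|exact: cvg_cstmx].
exact: ((continuous_closedP _).1 cd [set r | 0 <= r] (@closed_ge _ _)).
Qed.

Local Notation model q t := (q *m shift t *m cone_mx t).

Lemma cone_weight_ge (t : R) : 0 <= t <= 1 -> -1 <= cone_weight t i0 0.
Proof.
move=> /andP[t0 t1]; have n0 : 0 <= n%:R :> R by rewrite ler0n.
rewrite cone_weight_i0 ler_pdivlMr; last by rewrite natr1 ltr0n.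
have : t * (n%:R + 2) <= n%:R + 2 by rewrite ler_piMl// addr_ge0.
by lra.
Qed.

Lemma model_oriented (q : 'M[R]_n) (t : R) : SO q -> 0 <= t <= 1 ->
  oriented_cone (q *m shift t) (cone_weight t).
Proof.
move=> [_ q1] t01; have /andP[t0 _] := t01; split.
- exact: ones_cone_weight.
- by rewrite -mulmxA (shifted_Dt _ D_ones DDt) det_mulmx q1 mul1r det_scalar exprn_gt0.
- by apply: pos_off_card => k; exact: cone_weight_gt0.
- by move=> k ki; rewrite ltW// cone_weight_gt0.
exact: cone_weight_ge.
Qed.

Lemma skew_cone_weight (t : R) : skew (cone_weight t) = 0.
Proof.
apply/colP => k; have [->|ki] := eqVneq k i0.
  by have /matrixP/(_ 0 0) := skew_i0 (cone_weight t); rewrite -rowE !mxE.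
rewrite skew_off// cone_weight_off// cone_weight_i0 mxE; field.
by rewrite n_neq0// nS_neq0.
Qed.

Lemma cone_data z mu : oriented_cone z mu ->
  rsubmx (cone z mu) = z /\ weight (cone z mu) = mu.
Proof.
by move=> [mu1 z0 _ _ _]; rewrite /cone row_mxKr weight_cone// gt_eqF.
Qed.

Theorem cone_skeleton_equivalence :
  homotopy_equivalent R (configuration_space R n X) (rotation_cylinder D i0).
Proof.
have Um (q : 'M[R]_n) (t : R) : SO q -> 0 <= t <= 1 -> U (model q t).
  by move=> soq t01; rewrite mul_cone_mx; apply/cone_oriented/model_oriented.
have md (q : 'M[R]_n) (t : R) : SO q -> 0 <= t <= 1 ->
    rsubmx (model q t) = q *m shift t /\ weight (model q t) = cone_weight t.
  by move=> soq t01; rewrite mul_cone_mx; apply/cone_data/model_oriented.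
have b0 : 0 <= (0 : R) <= 1 by rewrite lexx ler01.
have b1 : 0 <= (1 : R) <= 1 by rewrite lexx ler01.
apply: (@configuration_space_equivalent R n (1 + n.+1) n_gt0 i0 c D c_gt0 D_ones DDt DtD X
  (skeleton_aut n_gt2) (@embedding_perm R n (1 + n.+1) n_gt2)
  cone_mx cone_mx_continuous cone_mx_embedding cone_domain
  (fun x => height x) (fun x => simplex x) cone_domain_closed cone_cover
  cone_height_continuous centered_cone_continuous _ _ _ _ _ _ _ _ (fun _ _ => 1)).
- by move=> x /oriented_coneP[z [mu [zmu ->]]]; have [_ ->] := cone_data zmu;
    apply: cone_height01; case: zmu.
- move=> x /oriented_coneP[z [mu [zmu ->]]]; have [-> ->] := cone_data zmu.
  have [mu1 z0 _ _ _] := zmu.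
  by rewrite /centered_cone shear_det ?skew_i0 ?ones_skew.
- move=> x s /oriented_coneP[z [mu [zmu ->]]] s01; have [-> ->] := cone_data zmu.
  exact: cone_path.
- move=> x p /oriented_coneP[z [mu [zmu ->]]] /oriented_coneP[z' [mu' [zmu' pE]]].
  have [zE wE] := cone_data zmu; have [zE' wE'] := cone_data zmu'.
  by rewrite pE zE wE zE' wE'; exact: cone_relabel.
- by move=> t T _; exact: cone_mx_adm.
- by move=> q t soq t01; case: (Um q t soq t01).
- move=> q soq; have [_ ->] := md q 0 soq b0.
  by rewrite /cone_height cone_weight_i0 mul0r subr0 div1r (max_idPl _)// oppr_le0 invr_ge0 addr_ge0.
- move=> q soq; have [_ ->] := md q 1 soq b1.
  rewrite /cone_height cone_weight1 !mxE !eqxx /= (max_idPr _); last by lra.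
  by lra.
- by move=> p; exact: cvg_cst.
- by move=> *; exact: ltr01.
- by [].
- move=> q t soq t01; have [-> ->] := md q t soq t01.
  rewrite /centered_cone skew_cone_weight mul0mx scaler0 subr0 mulmx1 dilation1 mulmx1 DDt.
  by rewrite -mulmxA (shifted_Dt _ D_ones DDt).
Qed.

End ConeConfigurations.

Theorem theorem2p8 (R : realType) (n : nat) (D : 'M[R]_(n, n.+1))
    (i0 : 'I_n.+1) :
  (2 < n)%N -> centered_regular_simplex D ->
  homotopy_equivalent R
    (configuration_space R n (skeleton (n - 2) (full_simplex 'I_n.+1)))
    (rotation_cylinder D i0) /\
  homotopy_equivalent R
    (configuration_space R n (skeleton (n - 2) (full_simplex 'I_n.+2)))
    (rotation_cylinder D i0).
Proof.
move=> n_gt2 simplexD.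
have [c c_gt0 [D_ones DDt DtD]] := regular_simplex_gram simplexD.
split; first exact: (simplex_skeleton_equivalence n_gt2 i0 c_gt0 D_ones DDt DtD).
exact: (cone_skeleton_equivalence n_gt2 i0 c_gt0 D_ones DDt DtD).
Qed.
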